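(* Let $X$ be a quandle and $k$ a commutative ring with unit. Then the two-sided ideal $\langle e_x^2:x\in X\rangle$ of $B$ is a coideal, so that $B^Q=B/\langle e_x^2:x\in X\rangle$ inherits from $B$ a comultiplication compatible with the differential, and the induced product makes $C_Q^\bullet(X,k)$ a differential graded algebra (the differential being a super derivation). Moreover the map $h$ induces a map $h^Q:B^Q\to B^Q\otimes^D B^Q$ (a homotopy between the comultiplication of $B^Q$ and its composition with the signed flip $\tau$), and hence the quandle cohomology, i.e. the cohomology of $C_Q^\bullet(X,k)$, is a graded commutative algebra.
   Context: A rack is a nonempty set $X$ with a binary operation $(x,y)\mapsto x\triangleleft y=x^y$ such that $-\triangleleft y:X\to X$ is a bijection for every $y$, and $(x\triangleleft y)\triangleleft z=(x\triangleleft z)\triangleleft(y\triangleleft z)$ for all $x,y,z$. A quandle is a rack with $x\triangleleft x=x$ for all $x$. Complexes: $C_n(X,k)=k[X^n]$ is the free $k$-module on $X^n$, with $$\partial(x_1,\dots,x_n)=\sum_{i=1}^n(-1)^i(x_1,\dots,\widehat{x_i},\dots,x_n)-\sum_{i=1}^n(-1)^i(x_1^{x_i},\dots,x_{i-1}^{x_i},\widehat{x_i},x_{i+1},\dots,x_n).$$ $C_n^D(X,k)\subset C_n(X,k)$ is the span of all tuples $(x_1,\dots,x_{i-1},y,y,x_{i+2},\dots,x_n)$; it is a subcomplex. $C^Q_\bullet(X,k)=C_\bullet(X,k)/C^D_\bullet(X,k)$, $C_Q^\bullet(X,k)=\mathrm{Hom}_k(C^Q_\bullet(X,k),k)$ with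 $\partial^*f=f\circ\partial$. Let $A$ be the $k$-algebra generated by $X$ with relations $yx^y=xy$. Let $B$ be the $k$-algebra generated by symbols $x,e_x$ ($x\in X$) with relations $yx^y=xy$ and $y\,e_{x^y}=e_x\,y$ for all $x,y\in X$, graded by $|x|=0$, $|e_x|=1$. $d$ is the degree $-1$ super-derivation of $B$ with $d(x)=0$, $d(e_x)=x-1$. $B\otimes B$ (over $k$) has the Koszul-signed product $(a\otimes b)(a'\otimes b')=(-1)^{|b||a'|}aa'\otimes bb'$ and differential $d(a\otimes b)=da\otimes b+(-1)^{|a|}a\otimes db$; $\Delta:B\to B\otimes B$ is the algebra morphism with $\Delta(x)=x\otimes x$, $\Delta(e_x)=e_x\otimes x+1\otimes e_x$; $\tau(a\otimes b)=(-1)^{|a||b|}b\otimes a$. The superscript in $B\otimes^D B$, $B^Q\otimes^D B^Q$ indicates the diagonal left $A$-action $x\cdot(b\otimes b')=xb\otimes xb'$ for $x\in X$. $B$ is a free left $A$-module with basis the monomials $e_{x_1}\cdots e_{x_n}$, and $h:B\to B\otimes^D B$ is the degree one left $A$-module morphism with $h(1)=0$, $h(e_x)=e_x\otimes e_x$ and $$h(e_{x_1}\cdots e_{x_n})=\sum_{i=1}^n(-1)^{i-1}(\tau\circ\Delta)(e_{x_1})\cdots(\tau\circ\Delta)(e_{x_{i-1}})\,h(e_{x_i})\,\Delta(e_{x_{i+1}})\cdots\Delta(e_{x_n}).$$ With $k$ the trivial left $A$-module (each $x\in X$ acts as the identity), $C_Q^n(X,k)$ is identified with $\mathrm{Hom}_A(B^Q_n,k)$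 via $f(e_{x_1}\cdots e_{x_n})=f(x_1,\dots,x_n)$, elements being extended by zero to the other degrees. The product on $C_Q^\bullet(X,k)$ is $f\smile g=i(f\otimes g)\circ\Delta$, with $i(f\otimes g)(b\otimes b')=(-1)^{|g||b|}f(b)g(b')$ for homogeneous elements. With $\partial^*f=f\circ\partial$ and these signs, ``super derivation'' means $\partial^*(f\smile g)=(-1)^{|g|}\partial^*f\smile g+f\smile\partial^*g$. *)

(* Defs.v *)
From HB Require Import structures.
From mathcomp Require Import all_boot all_algebra generic_quotient finmap.
From mathcomp Require Import boolp classical_sets functions cardinality fsbigop.

Set Implicit Arguments.
Unset Strict Implicit.
Unset Printing Implicit Defensive.

Import GRing.Theory.

Local Open Scope classical_set_scope.
Local Open Scope ring_scope.

Section Submodules.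
Variables (k : pzRingType) (V : lmodType k).

Inductive span (S : set V) : V -> Prop :=
| span0 : span S 0
| span_gen v : S v -> span S v
| spanD u v : span S u -> span S v -> span S (u + v)
| spanZ a v : span S v -> span S (a *: v).

Lemma spanN S v : span S v -> span S (- v).
Proof. by move=> Sv; rewrite -scaleN1r; apply: spanZ. Qed.

Lemma spanB S u v : span S u -> span S v -> span S (u - v).
Proof. by move=> Su Sv; apply: spanD => //; apply: spanN. Qed.

End Submodules.

Section QuotientModule.
Variables (k : pzRingType) (V : lmodType k) (S : set V).

Definition span_equiv (u v : V) : bool := `[< span S (u - v) >].

Lemma span_equiv_refl : reflexive span_equiv.
Proof. by move=> u; apply/asboolP; rewrite subrr; apply: span0. Qed.

Lemma span_equiv_sym : symmetric span_equiv.
Proof.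
by move=> u v; apply/asboolP/asboolP => /spanN; rewrite opprB.
Qed.

Lemma span_equiv_trans : transitive span_equiv.
Proof.
move=> v u w /asboolP uv /asboolP vw; apply/asboolP.
by rewrite -(subrKA v); apply: spanD.
Qed.

Canonical span_equiv_rel :=
  EquivRel span_equiv span_equiv_refl span_equiv_sym span_equiv_trans.

Definition quotmod := {eq_quot span_equiv}%qT.

HB.instance Definition _ := Choice.on quotmod.
HB.instance Definition _ := EqQuotient.on quotmod.

Definition qpi (v : V) : quotmod := \pi_(quotmod)%qT v.
Definition qrepr (c : quotmod) : V := repr c.

Lemma qreprK : cancel qrepr qpi. Proof. exact: reprK. Qed.

Lemma qpiP u v : qpi u = qpi v <-> span S (u - v).
Proof.
by split=> [/eqquotP/asboolP //|uv]; apply/eqquotP/asboolP.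
Qed.

Lemma qrepr_qpi v : span S (qrepr (qpi v) - v).
Proof. by apply/qpiP; rewrite qreprK. Qed.

Definition qadd (c e : quotmod) := qpi (qrepr c + qrepr e).
Definition qopp (c : quotmod) := qpi (- qrepr c).
Definition qscale (a : k) (c : quotmod) := qpi (a *: qrepr c).

Lemma qaddE u v : qadd (qpi u) (qpi v) = qpi (u + v).
Proof. by apply/qpiP; rewrite opprD addrACA; apply: spanD; apply: qrepr_qpi. Qed.
Lemma qoppE u : qopp (qpi u) = qpi (- u).
Proof. by apply/qpiP; rewrite -opprD; apply/spanN/qrepr_qpi. Qed.
Lemma qscaleE a u : qscale a (qpi u) = qpi (a *: u).
Proof. by apply/qpiP; rewrite -scalerBr; apply/spanZ/qrepr_qpi. Qed.

Lemma qpi_ind (P : quotmod -> Prop) : (forall v, P (qpi v)) -> forall c, P c.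
Proof. by move=> Pv c; rewrite -(qreprK c). Qed.

Let qaddA : associative qadd.
Proof.
elim/qpi_ind=> u; elim/qpi_ind=> v; elim/qpi_ind=> w.
by rewrite !qaddE addrA.
Qed.
Let qaddC : commutative qadd.
Proof. by elim/qpi_ind=> u; elim/qpi_ind=> v; rewrite !qaddE addrC. Qed.
Let qadd0 : left_id (qpi 0) qadd.
Proof. by elim/qpi_ind=> u; rewrite qaddE add0r. Qed.
Let qaddN : left_inverse (qpi 0) qopp qadd.
Proof. by elim/qpi_ind=> u; rewrite qoppE qaddE addNr. Qed.

HB.instance Definition _ := GRing.isZmodule.Build quotmod qaddA qaddC qadd0 qaddN.

Let qscaleA a b c : qscale a (qscale b c) = qscale (a * b) c.
Proof. by elim/qpi_ind: c => u; rewrite !qscaleE scalerA. Qed.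
Let qscale1 : left_id 1 qscale.
Proof. by elim/qpi_ind=> u; rewrite qscaleE scale1r. Qed.
Let qscaleDr : right_distributive qscale +%R.
Proof.
move=> a; elim/qpi_ind=> u; elim/qpi_ind=> v.
by rewrite [_ + _]qaddE !qscaleE [RHS]qaddE scalerDr.
Qed.
Let qscaleDl c : {morph qscale^~ c : a b / a + b}.
Proof.
by elim/qpi_ind: c => u a b; rewrite !qscaleE [RHS]qaddE scalerDl.
Qed.

HB.instance Definition _ :=
  GRing.Zmodule_isLmodule.Build k quotmod qscaleA qscale1 qscaleDr qscaleDl.

Lemma qpi_is_linear : linear qpi.
Proof. by move=> a u v; rewrite -qaddE -qscaleE. Qed.

HB.instance Definition _ := GRing.isLinear.Build k V quotmod _ qpi qpi_is_linear.

Lemma qpi_eq0 v : qpi v = 0 <-> span S v.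
Proof. by rewrite -[in X in _ <-> X](subr0 v) -qpiP linear0. Qed.

End QuotientModule.

Arguments qpi {k V} S.

Section QuotientLift.
Variables (k : pzRingType) (V W : lmodType k) (S : set V).

(* Meaningful when f is linear and vanishes on S, see [qliftE]. *)
Definition qlift (f : V -> W) (c : quotmod S) : W := f (qrepr c).

Lemma span_ker (f : {linear V -> W}) :
  (forall v, S v -> f v = 0) -> forall v, span S v -> f v = 0.
Proof.
move=> f0 v; elim=> [|u /f0 //|u w _ fu _ fw|a u _ fu].
- exact: linear0.
- by rewrite linearD fu fw addr0.
- by rewrite linearZ /= fu scaler0.
Qed.

Lemma qliftE (f : {linear V -> W}) :
  (forall v, S v -> f v = 0) -> forall v, qlift f (qpi S v) = f v.
Proof.
move=> f0 v; apply/eqP; rewrite -subr_eq0 /qlift -linearB.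
by apply/eqP/(span_ker f0)/qrepr_qpi.
Qed.

Lemma qlift_is_linear (f : {linear V -> W}) :
  (forall v, S v -> f v = 0) -> linear (qlift f).
Proof.
move=> f0 a; elim/qpi_ind=> u; elim/qpi_ind=> v.
by rewrite -linearP !qliftE ?linearP.
Qed.

End QuotientLift.

(* The free k-module on T. [malg] of multinomials is a module only over nonzero
   rings k. *)
Section FreeModule.
Variables (k : pzRingType) (T : choiceType).

Definition finsupp_pred : {pred T -> k^o} :=
  [pred f | `[< finite_set [set t | f t != 0] >]].

Lemma finsupp_closed : submod_closed finsupp_pred.
Proof.
split.
  apply/asboolP; apply: (sub_finite_set _ (@finite_set0 T)).
  by move=> t /= /eqP; apply.
move=> a f g /asboolP ff /asboolP fg; apply/asboolP.
apply: (@sub_finite_set _ _ ([set t | f t != 0] `|` [set t | g t != 0])).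
  move=> t /=; have [f0|] := eqVneq (f t) 0; last by left.
  have [g0|] := eqVneq (g t) 0; last by right.
  by rewrite addrfctE scalrfctE /= f0 g0 scaler0 addr0 eqxx.
by rewrite finite_setU.
Qed.

HB.instance Definition _ :=
  GRing.isSubmodClosed.Build k (T -> k^o) finsupp_pred finsupp_closed.

Record freemod := FreeMod { coef : T -> k^o ; coefP : coef \in finsupp_pred }.

HB.instance Definition _ := [isSub for coef].
HB.instance Definition _ := [Choice of freemod by <:].
HB.instance Definition _ := [SubChoice_isSubLmodule of freemod by <:].

Lemma delta_finsupp (t : T) :
  (fun u => (u == t)%:R : k^o) \in finsupp_pred.
Proof.
apply/asboolP; apply: (@sub_finite_set _ _ [set t]); last exact: finite_set1.
by move=> u /=; case: (eqVneq u t) => // _ /eqP[].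
Qed.

Definition delta (t : T) : freemod := FreeMod (delta_finsupp t).

Definition linext (V : lmodType k) (phi : T -> V) (f : freemod) : V :=
  \sum_(t \in [set: T]) (coef f t : k) *: phi t.

Section Linext.
Variables (V : lmodType k) (phi : T -> V).

Lemma linextE (A : {fset T}) (f : freemod) :
  (forall t, t \notin A -> coef f t = 0) ->
  linext phi f = \sum_(t <- A) (coef f t : k) *: phi t.
Proof.
by move=> fA; rewrite /linext (fsbigTE A) // => t /fA ->; rewrite scale0r.
Qed.

Lemma coef_supp (f : freemod) :
  exists A : {fset T}, forall t, t \notin A -> coef f t = 0.
Proof.
have /asboolP/finite_fsetP[A sA] := coefP f.
exists A => t tA; apply/eqP; apply: contraNT tA => ft.
by have : [set` A] t by rewrite -sA.
Qed.

Lemma coefP_lin a (f g : freemod) t :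
  coef (a *: f + g) t = a * coef f t + coef g t.
Proof. by []. Qed.

Lemma linext_is_linear : linear (linext phi).
Proof.
move=> a f g; have [A fA] := coef_supp f; have [B gB] := coef_supp g.
pose C := (A `|` B)%fset.
have fC t : t \notin C -> coef f t = 0 by rewrite inE negb_or => /andP[/fA].
have gC t : t \notin C -> coef g t = 0 by rewrite inE negb_or => /andP[_ /gB].
rewrite !(@linextE C) //; last first.
  by move=> t tC; rewrite coefP_lin fC // gC // mulr0 addr0.
rewrite scaler_sumr -big_split; apply: eq_bigr => t _.
by rewrite coefP_lin scalerDl scalerA.
Qed.

HB.instance Definition _ :=
  GRing.isLinear.Build k freemod V _ (linext phi) linext_is_linear.

Lemma linext_delta t : linext phi (delta t) = phi t.
Proof.
rewrite (@linextE [fset t]%fset) ?big_seq_fset1 /= ?eqxx ?scale1r //.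
by move=> u; rewrite inE => /negbTE /= ->.
Qed.

End Linext.

Lemma freemodE (f : freemod) : f = linext delta f.
Proof.
have [A fA] := coef_supp f; rewrite (linextE _ fA).
apply/val_inj/funext => t /=.
have -> : coef (\sum_(u <- A) (coef f u : k) *: delta u) t
    = \sum_(u <- A) coef f u * (t == u)%:R.
  elim/big_rec2: _ => //= u y1 y2 _ <-; first by [].
case: (boolP (t \in A)) => tA; last first.
  rewrite fA // big_seq big1 // => u uA.
  by case: eqVneq tA uA => [->|_ _ _]; [case: (u \in A)|rewrite mulr0].
rewrite (big_fsetD1 t) //= eqxx mulr1 big_seq big1 ?addr0 // => u.
by rewrite !inE => /andP[/negbTE]; rewrite eq_sym => ->; rewrite mulr0.
Qed.

Lemma freemod_ind (P : freemod -> Prop) :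
  (forall a f g, P f -> P g -> P (a *: f + g)) -> P 0 ->
  (forall t, P (delta t)) -> forall f, P f.
Proof.
move=> PD P0 Pd f; rewrite (freemodE f) /linext.
have [A fA] := coef_supp f; rewrite (fsbigTE A); last first.
  by move=> t /fA ->; rewrite scale0r.
by elim/big_rec: _ => // t g _ Pg; apply: PD.
Qed.

Lemma linear_freemod_eq (V : lmodType k) (f g : {linear freemod -> V}) :
  (forall t, f (delta t) = g (delta t)) -> f =1 g.
Proof.
move=> fg; elim/freemod_ind => [a u v fu fv||//]; last by rewrite !linear0.
by rewrite !linearP fu fv.
Qed.

End FreeModule.

Arguments delta k {T} t.

(* Unital associative k-algebras, including the zero algebra, which [algType]
   excludes and which is unavoidable for k = 0. *)
HB.mixin Record isKAlgebra (k : pzRingType) A of GRing.Lmodule k A := {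
  kone : A;
  kmul : A -> A -> A;
  kmulA : associative kmul;
  kmul1l : left_id kone kmul;
  kmul1r : right_id kone kmul;
  kmulPl : forall v, linear (kmul^~ v);
  kmulPr : forall u, linear (kmul u)
}.

#[short(type="kalgType")]
HB.structure Definition KAlgebra (k : pzRingType) :=
  {A of GRing.Lmodule k A & isKAlgebra k A}.

Section KAlgebraTheory.
Variables (k : pzRingType) (A : kalgType k).
Implicit Types u v w : A.

Lemma kmulDl : left_distributive (@kmul k A) +%R.
Proof. by move=> u v w; have := kmulPl w 1 u v; rewrite /= !scale1r. Qed.
Lemma kmulDr : right_distributive (@kmul k A) +%R.
Proof. by move=> u v w; have := kmulPr u 1 v w; rewrite !scale1r. Qed.
Lemma kmul0l u : kmul 0 u = 0 :> A.
Proof. by apply: (addIr (kmul 0 u)); rewrite -kmulDl !add0r. Qed.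
Lemma kmul0r u : kmul u 0 = 0 :> A.
Proof. by apply: (addIr (kmul u 0)); rewrite -kmulDr !add0r. Qed.
Lemma kmulZl a u v : kmul (a *: u) v = a *: kmul u v.
Proof. by have := kmulPl v a u 0; rewrite /= kmul0l !addr0. Qed.
Lemma kmulZr a u v : kmul u (a *: v) = a *: kmul u v.
Proof. by have := kmulPr u a v 0; rewrite kmul0r !addr0. Qed.
Lemma kmulNl u v : kmul (- u) v = - kmul u v.
Proof. by rewrite -scaleN1r kmulZl scaleN1r. Qed.
Lemma kmulNr u v : kmul u (- v) = - kmul u v.
Proof. by rewrite -scaleN1r kmulZr scaleN1r. Qed.

End KAlgebraTheory.

Section FreeAlgebra.
Variables (k : comPzRingType) (G : choiceType).

Definition freealg := freemod k (seq G).

HB.instance Definition _ := GRing.Lmodule.on freealg.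

Definition fa_mul (f g : freealg) : freealg :=
  linext (fun u => linext (fun v => delta k (u ++ v)) g) f.

Lemma fa_mul_delta u v : fa_mul (delta k u) (delta k v) = delta k (u ++ v).
Proof. by rewrite /fa_mul !linext_delta. Qed.

Lemma fa_mulPl a f g h : fa_mul (a *: f + g) h = a *: fa_mul f h + fa_mul g h.
Proof. exact: linearP. Qed.

Lemma linext_lin (T : choiceType) (V : lmodType k) a (phi psi : T -> V) f :
  linext (fun t => a *: phi t + psi t) f = a *: linext phi f + linext psi f.
Proof.
have [A fA] := coef_supp f; rewrite !(linextE _ fA) scaler_sumr -big_split.
by apply: eq_bigr => t _; rewrite scalerDr !scalerA mulrC.
Qed.

Lemma fa_mulPr a f g h : fa_mul h (a *: f + g) = a *: fa_mul h f + fa_mul h g.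
Proof.
rewrite /fa_mul -linext_lin; congr (linext _ h).
by apply/funext => u; rewrite linearP.
Qed.

Let fa_mul0l f : fa_mul 0 f = 0.
Proof. exact: linear0. Qed.
Let fa_mul0r f : fa_mul f 0 = 0.
Proof.
by have := fa_mulPr (-1) 0 0 f; rewrite !scaleN1r oppr0 addr0 addNr.
Qed.

Let fa_mulA : associative fa_mul.
Proof.
elim/freemod_ind => [a f f' Pf Pf'||u] g h; last 1 first.
- elim/freemod_ind: g => [a g g' Pg Pg'||v]; last 1 first.
  + elim/freemod_ind: h => [a h h' Ph Ph'||w].
    * by rewrite !fa_mulPr Ph Ph'.
    * by rewrite !fa_mul0r.
    * by rewrite !fa_mul_delta catA.
  + by rewrite !(fa_mulPl, fa_mulPr) Pg Pg'.
  + by rewrite !(fa_mul0l, fa_mul0r).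
- by rewrite !fa_mulPl Pf Pf'.
- by rewrite !fa_mul0l.
Qed.

Let fa_mul1l : left_id (delta k [::]) fa_mul.
Proof.
elim/freemod_ind => [a f f' Pf Pf'||u]; first by rewrite fa_mulPr Pf Pf'.
  exact: fa_mul0r.
exact: fa_mul_delta.
Qed.

Let fa_mul1r : right_id (delta k [::]) fa_mul.
Proof.
elim/freemod_ind => [a f f' Pf Pf'||u]; first by rewrite fa_mulPl Pf Pf'.
  exact: fa_mul0l.
by rewrite fa_mul_delta cats0.
Qed.

HB.instance Definition _ := isKAlgebra.Build k freealg
  fa_mulA fa_mul1l fa_mul1r
  (fun h a f g => fa_mulPl a f g h) (fun h a f g => fa_mulPr a f g h).
HB.instance Definition _ := GRing.Zmodule_isPzRing.Build freealg
  fa_mulA fa_mul1l fa_mul1r (@kmulDl k freealg) (@kmulDr k freealg).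

Definition fa_gen (g : G) : freealg := delta k [:: g].

End FreeAlgebra.

Section QuotientAlgebra.
Variables (k : pzRingType) (R : kalgType k) (S : set R).

Definition ideal_gens : set R :=
  [set b | exists s a c, S s /\ b = kmul (kmul a s) c].

Definition ideal : set R := span ideal_gens.

Definition qalg := quotmod ideal_gens.

HB.instance Definition _ := GRing.Lmodule.on qalg.

Lemma ideal_mul a b c : ideal b -> ideal (kmul (kmul a b) c).
Proof.
elim=> [|_ [s [a' [c' [Ss ->]]]]|u v _ Iu _ Iv|z u _ Iu].
- by rewrite kmul0r kmul0l; apply: span0.
- apply: span_gen; exists s, (kmul a a'), (kmul c' c); split=> //.
  by rewrite !kmulA.
- by rewrite kmulDr kmulDl; apply: spanD.
- by rewrite kmulZr kmulZl; apply: spanZ.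
Qed.

Definition qproj (b : R) : qalg := qpi ideal_gens b.

HB.instance Definition _ :=
  GRing.isLinear.Build k R qalg _ qproj (@qpi_is_linear k R ideal_gens).

Definition qmul (c e : qalg) : qalg := qproj (kmul (qrepr c) (qrepr e)).

Lemma qmulE u v : qmul (qproj u) (qproj v) = qproj (kmul u v).
Proof.
apply/qpiP; rewrite -(subrKA (kmul u (qrepr (qproj v)))).
apply: spanD.
  rewrite -kmulNl -kmulDl -[kmul _ _]kmul1l kmulA.
  by apply: ideal_mul; apply: qrepr_qpi.
rewrite -kmulNr -kmulDr -[kmul _ _]kmul1r.
by apply: ideal_mul; apply: qrepr_qpi.
Qed.

Lemma qproj_ind (P : qalg -> Prop) : (forall v, P (qproj v)) -> forall c, P c.
Proof. exact: qpi_ind. Qed.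

Let qmulA : associative qmul.
Proof.
by elim/qproj_ind=> u; elim/qproj_ind=> v; elim/qproj_ind=> w; rewrite !qmulE kmulA.
Qed.
Let qmul1l : left_id (qproj kone) qmul.
Proof. by elim/qproj_ind=> u; rewrite qmulE kmul1l. Qed.
Let qmul1r : right_id (qproj kone) qmul.
Proof. by elim/qproj_ind=> u; rewrite qmulE kmul1r. Qed.
Let qmulPl (w : qalg) : linear (qmul^~ w).
Proof.
move=> a; elim/qproj_ind=> u; elim/qproj_ind=> v; elim/qproj_ind: w => w /=.
by rewrite -linearP !qmulE kmulPl linearP.
Qed.
Let qmulPr (w : qalg) : linear (qmul w).
Proof.
move=> a; elim/qproj_ind=> u; elim/qproj_ind=> v; elim/qproj_ind: w => w /=.
by rewrite -linearP !qmulE kmulPr linearP.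
Qed.

HB.instance Definition _ :=
  isKAlgebra.Build k qalg qmulA qmul1l qmul1r qmulPl qmulPr.
HB.instance Definition _ := GRing.Zmodule_isPzRing.Build qalg
  qmulA qmul1l qmul1r (@kmulDl k qalg) (@kmulDr k qalg).

End QuotientAlgebra.

Arguments qproj {k R} S.

Section TensorProduct.
Variables (k : comPzRingType) (V W : lmodType k).

Definition tens_rel : set (freemod k (V * W)%type) :=
  [set r | (exists a v v' w, r = delta k (a *: v + v', w)
                                 - (a *: delta k (v, w) + delta k (v', w)))
        \/ (exists a v w w', r = delta k (v, a *: w + w')
                                 - (a *: delta k (v, w) + delta k (v, w')))].

Definition tens := quotmod tens_rel.

HB.instance Definition _ := GRing.Lmodule.on tens.

Definition ptens (v : V) (w : W) : tens := qpi tens_rel (delta k (v, w)).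

Lemma ptensPl a v v' w : ptens (a *: v + v') w = a *: ptens v w + ptens v' w.
Proof.
rewrite -linearP; apply/qpiP/span_gen; left.
by exists a, v, v', w.
Qed.

Lemma ptensPr a v w w' : ptens v (a *: w + w') = a *: ptens v w + ptens v w'.
Proof.
rewrite -linearP; apply/qpiP/span_gen; right.
by exists a, v, w, w'.
Qed.

Variable U : lmodType k.

Definition bilin (beta : V -> W -> U) : Prop :=
  (forall w, linear (beta^~ w)) /\ (forall v, linear (beta v)).

(* Meaningful when beta is bilinear, see [tliftE]. *)
Definition tlift (beta : V -> W -> U) : tens -> U :=
  qlift (linext (fun p => beta p.1 p.2)).

Lemma tlift_ker (beta : V -> W -> U) : bilin beta ->
  forall r, tens_rel r -> linext (fun p => beta p.1 p.2) r = 0.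
Proof.
move=> [bl br] r [] [a [v [v' [w ->]]]].
  by rewrite linearB linearP /= !linext_delta /= bl subrr.
by rewrite linearB linearP /= !linext_delta /= br subrr.
Qed.

Lemma tliftE (beta : V -> W -> U) : bilin beta ->
  forall v w, tlift beta (ptens v w) = beta v w.
Proof.
move=> bb v w; rewrite /tlift /ptens qliftE /= ?linext_delta //.
exact: tlift_ker.
Qed.

Lemma tlift_is_linear (beta : V -> W -> U) : bilin beta -> linear (tlift beta).
Proof. by move=> bb; apply: qlift_is_linear; exact: tlift_ker. Qed.

End TensorProduct.

Notation "V ⊗ W" := (tens V W) (at level 40, left associativity) : type_scope.
Notation "v ⊗ w" := (ptens v w) (at level 40, left associativity) : ring_scope.

Section TensorMaps.
Variable k : comPzRingType.

Definition tmap (V V' W W' : lmodType k) (f : V -> V') (g : W -> W') :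
    tens V W -> tens V' W' :=
  tlift (fun v w => f v ⊗ g w).

Definition tassoc (U V W : lmodType k) :
    tens (tens U V) W -> tens U (tens V W) :=
  tlift (fun t w => tlift (fun u v => u ⊗ (v ⊗ w)) t).

End TensorMaps.

Section Hom.
Variables (k : comPzRingType) (V W : lmodType k).

Definition linear_pred : {pred V -> W} := [pred f | `[< linear f >]].

Lemma linear_pred_closed : submod_closed linear_pred.
Proof.
split.
  apply/asboolP => a u v; change (0 = a *: (0 : W) + 0).
  by rewrite scaler0 addr0.
move=> a f g /asboolP lf /asboolP lg; apply/asboolP => b u v.
have E x : (a *: f + g) x = a *: f x + g x by [].
rewrite !E lf lg !scalerDr !scalerA -!addrA; congr (_ + _).
  by rewrite mulrC.
by rewrite addrCA.
Qed.

HB.instance Definition _ :=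
  GRing.isSubmodClosed.Build k (V -> W) linear_pred linear_pred_closed.

Record hom := Hom { hom_fun :> V -> W ; homP : hom_fun \in linear_pred }.

HB.instance Definition _ := [isSub for hom_fun].
HB.instance Definition _ := [Choice of hom by <:].
HB.instance Definition _ := [SubChoice_isSubLmodule of hom by <:].

End Hom.

Section GradedAlgebras.
Variables (k : comPzRingType) (C : nat -> lmodType k).

Definition castdeg m n (e : m = n) (c : C m) : C n := ecast i (C i) e c.

Definition graded_product := forall p q, C p -> C q -> C (p + q).

Record is_graded_algebra (one : C 0) (mul : graded_product) : Prop := {
  gr_bilin : forall p q,
    (forall g : C q, linear (fun f : C p => mul p q f g)) /\
    (forall f : C p, linear (mul p q f));
  gr_assoc : forall p q r (f : C p) (g : C q) (h : C r),
    castdeg (addnA p q r) (mul _ _ f (mul _ _ g h))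
      = mul _ _ (mul _ _ f g) h;
  gr_mul1l : forall p (f : C p), castdeg (add0n p) (mul _ _ one f) = f;
  gr_mul1r : forall p (f : C p), castdeg (addn0 p) (mul _ _ f one) = f
}.

Definition is_graded_commutative (mul : graded_product) : Prop :=
  forall p q (f : C p) (g : C q),
    mul _ _ f g = (-1) ^+ (p * q) *: castdeg (addnC q p) (mul _ _ g f).

(* [dga_leibniz] has the sign of a derivation acting from the right. *)
Record is_dga (d : forall n, {linear C n -> C n.+1}) (one : C 0)
    (mul : graded_product) : Prop := {
  dga_alg : is_graded_algebra one mul;
  dga_sqr0 : forall n (f : C n), d _ (d _ f) = 0;
  dga_leibniz : forall p q (f : C p) (g : C q),
    d _ (mul _ _ f g)
      = (-1) ^+ q *: castdeg (addSn p q) (mul _ _ (d _ f) g)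
        + castdeg (addnS p q) (mul _ _ f (d _ g))
}.

End GradedAlgebras.

Section Cohomology.
Variables (k : comPzRingType) (C : nat -> lmodType k).
Variable d : forall n, {linear C n -> C n.+1}.

Definition cocycle_pred n : {pred C n} := [pred c | d n c == 0].

Lemma cocycle_pred_closed n : submod_closed (@cocycle_pred n).
Proof.
split; first by rewrite !inE linear0.
by move=> a u v; rewrite !inE linearP => /eqP-> /eqP->; rewrite scaler0 addr0.
Qed.

HB.instance Definition _ n :=
  GRing.isSubmodClosed.Build k (C n) (@cocycle_pred n) (@cocycle_pred_closed n).

Record cocycle n :=
  Cocycle { cocycle_val :> C n ; _ : cocycle_val \in @cocycle_pred n }.

HB.instance Definition _ n := [isSub for @cocycle_val n].
HB.instance Definition _ n := [Choice of cocycle n by <:].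
HB.instance Definition _ n := [SubChoice_isSubLmodule of cocycle n by <:].

Definition is_coboundary n : set (C n) :=
  if n is m.+1 then range (d m) else [set 0].

Definition coboundaries n : set (cocycle n) :=
  [set z | is_coboundary (cocycle_val z)].

Definition cohomology n : lmodType k := quotmod (@coboundaries n).

Definition cclass n (z : cocycle n) : cohomology n := qpi (@coboundaries n) z.

Record is_induced_product (one : C 0) (mul : graded_product C)
    (hone : cohomology 0) (hmul : graded_product cohomology) : Prop := {
  hone_class : exists2 z : cocycle 0, cocycle_val z = one & hone = cclass z;
  hmul_class : forall p q (f : cocycle p) (g : cocycle q),
    exists2 z : cocycle (p + q),
      cocycle_val z = mul _ _ f g & hmul _ _ (cclass f) (cclass g) = cclass z
}.

End Cohomology.

HB.mixin Record isRack X of Choice X := {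
  rack_op : X -> X -> X;
  rack_inhabited : inhabited X;
  rack_bij : forall y, bijective (rack_op^~ y);
  rack_distr : forall x y z,
    rack_op (rack_op x y) z = rack_op (rack_op x z) (rack_op y z)
}.

#[short(type="rackType")]
HB.structure Definition Rack := {X of Choice X & isRack X}.

HB.mixin Record Rack_isQuandle X of Rack X := {
  quandle_idem : forall x : X, rack_op x x = x
}.

#[short(type="quandleType")]
HB.structure Definition Quandle := {X of Rack X & Rack_isQuandle X}.

Notation "x ◁ y" := (rack_op x y) (at level 40, left associativity).

Section RackComplex.
Variables (k : comPzRingType) (X : rackType).

Definition chain n := freemod k (n.-tuple X).
HB.instance Definition _ n := GRing.Lmodule.on (chain n).

(* Tuples are indexed from 0, whence the exponents [i.+1] in [bdry]. *)
Definition face0 n (x : n.+1.-tuple X) (i : 'I_n.+1) : n.-tuple X :=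
  [tuple tnth x (lift i j) | j < n].

Definition face1 n (x : n.+1.-tuple X) (i : 'I_n.+1) : n.-tuple X :=
  [tuple if (lift i j < i)%N then tnth x (lift i j) ◁ tnth x i
         else tnth x (lift i j) | j < n].

Definition bdry n : chain n.+1 -> chain n :=
  linext (fun x : n.+1.-tuple X =>
    \sum_(i < n.+1) (-1) ^+ i.+1 *: delta k (face0 x i)
    - \sum_(i < n.+1) (-1) ^+ i.+1 *: delta k (face1 x i)).

HB.instance Definition _ n := GRing.Linear.copy (@bdry n)
  (linext (fun x : n.+1.-tuple X =>
    \sum_(i < n.+1) (-1) ^+ i.+1 *: delta k (face0 x i)
    - \sum_(i < n.+1) (-1) ^+ i.+1 *: delta k (face1 x i))).

Definition degenerate n : set (chain n) :=
  [set c | exists x : n.-tuple X, c = delta k x /\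
     exists i j : 'I_n, j = i.+1 :> nat /\ tnth x i = tnth x j].

End RackComplex.

Section QuandleComplex.
Variables (k : comPzRingType) (X : quandleType).

Definition qchain n : lmodType k := quotmod (@degenerate k X n).

Definition qclass n (x : n.-tuple X) : qchain n := qpi (@degenerate k X n) (delta k x).

Lemma bdry_degenerate n (c : chain k X n.+1) :
  degenerate c -> span (@degenerate k X n) (bdry c).
Proof.
case=> x [-> [i0 [i1 [i01 x01]]]].
rewrite /bdry linext_delta -sumrB.
under eq_bigr do rewrite -scalerBr.
have i10 : i1 != i0 by rewrite -val_eqE /= i01 gtn_eqF.
rewrite (bigD1 i0) //= (bigD1 i1) //= addrA.
have lift_lt (j : 'I_n) : (j < i0)%N ->
    lift i1 j = lift i0 j /\ (lift i0 j < i0)%N.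
  move=> ji; have E0 : lift i0 j = j :> nat by rewrite /= /bump leqNgt ji.
  split; last by rewrite E0.
  by apply/ord_inj; rewrite E0 /= /bump i01 leqNgt ltnS (ltnW ji).
have lift_gt (j : 'I_n) : (i0 < j)%N ->
    lift i1 j = lift i0 j /\ (i1 < lift i0 j)%N.
  move=> ji; have E0 : lift i0 j = j.+1 :> nat by rewrite /= /bump (ltnW ji).
  split; last by rewrite E0 i01 ltnS.
  by apply/ord_inj; rewrite E0 /= /bump i01 ji.
have lift_eq (j : 'I_n) : j = i0 :> nat -> lift i1 j = i0 /\ lift i0 j = i1.
  move=> ji; split; apply/ord_inj; rewrite /= /bump ji ?i01 ?ltnn //.
  by rewrite leqnn.
have lt01 : (i0 < i1)%N by rewrite i01.
have f0 : face0 x i1 = face0 x i0.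
  apply: eq_from_tnth => j; rewrite !tnth_mktuple.
  case: (ltngtP j i0) => [/lift_lt[-> _]|/lift_gt[-> _]|/lift_eq[-> ->]] //.
have f1 : face1 x i1 = face1 x i0.
  apply: eq_from_tnth => j; rewrite !tnth_mktuple.
  case: (ltngtP j i0) => [/lift_lt[-> l]|/lift_gt[-> l]|/lift_eq[-> ->]].
  - by rewrite l (ltn_trans l lt01) x01.
  - have -> : (lift i0 j < i1)%N = false by rewrite ltnNge (ltnW l).
    by have -> : (lift i0 j < i0)%N = false
      by rewrite ltnNge (ltnW (ltn_trans lt01 l)).
  - by rewrite lt01 ltnNge (ltnW lt01) /= -x01 quandle_idem.
rewrite f0 f1 i01 [(-1) ^+ i0.+2]exprS mulN1r scaleNr subrr add0r.
elim/big_ind: _ => [||i /andP[ii0 ii1]]; [exact: span0|exact: spanD|].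
apply: spanZ.
have [j0 j0E] : exists j, lift i j = i0.
  by case: (unliftP i i0) ii0 => [j ->|->]; [exists j|rewrite eqxx].
have [j1 j1E] : exists j, lift i j = i1.
  by case: (unliftP i i1) ii1 => [j ->|->]; [exists j|rewrite eqxx].
have side : (i0 < i)%N = (i1 < i)%N.
  rewrite i01; apply/idP/idP; last exact: ltnW.
  by move=> lt; rewrite ltn_neqAle lt andbT -i01 val_eqE eq_sym.
have j01 : j1 = j0.+1 :> nat.
  have := congr1 val j0E; have := congr1 val j1E; rewrite /= /bump i01.
  case: (leqP i j0) => a; case: (leqP i j1) => b;
    rewrite ?add0n ?add1n => e1 e0.
  - by case: e1 => ->; rewrite e0.
  - by have := leq_trans b a; rewrite e1 -e0 => /ltnW/ltnW; rewrite ltnn.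
  - by case: e1 => e1; have := leq_trans a b; rewrite e0 e1 ltnn.
  - by rewrite e1 e0.
apply: spanB; apply: span_gen.
  exists (face0 x i); split=> //; exists j0, j1; split=> //.
  by rewrite !tnth_mktuple j0E j1E.
exists (face1 x i); split=> //; exists j0, j1; split=> //.
by rewrite !tnth_mktuple j0E j1E side x01.
Qed.

Definition qbdry n : qchain n.+1 -> qchain n :=
  qlift (fun c : chain k X n.+1 => qpi (@degenerate k X n) (bdry c)).

Lemma qbdry_is_linear n : linear (@qbdry n).
Proof.
apply: (@qlift_is_linear _ _ _ _ (qpi (@degenerate k X n) \o @bdry k X n)) => c.
by move=> /bdry_degenerate cd; apply/qpi_eq0.
Qed.

Definition cochain n : lmodType k := hom (qchain n) k^o.

Lemma codiff_subproof n (f : cochain n) :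
  ((f : qchain n -> k^o) \o @qbdry n) \in @linear_pred k (qchain n.+1) k^o.
Proof.
apply/asboolP => a u v /=; rewrite qbdry_is_linear.
by case: f => f /= /asboolP ->.
Qed.

Definition codiff n (f : cochain n) : cochain n.+1 := Hom (codiff_subproof f).

Lemma codiff_is_linear n : linear (@codiff n).
Proof. by move=> a f g; apply/val_inj/funext. Qed.

HB.instance Definition _ n :=
  GRing.isLinear.Build k (cochain n) (cochain n.+1) _ (@codiff n)
    (@codiff_is_linear n).

Definition quandle_diff n : {linear cochain n -> cochain n.+1} := @codiff n.

End QuandleComplex.

Arguments qclass k {X n} x.

(* The map determined by the property P, for properties P that are satisfied
   by exactly one map. *)
Definition the_map (U : Type) (V : zmodType) (P : set (U -> V)) : U -> V :=
  xget (fun=> 0) P.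

(* R is graded by the submodules [deg n]; all the maps below are prescribed on
   tensors of homogeneous elements, which span R ⊗ R. *)
Section Koszul.
Variables (k : comPzRingType) (R : kalgType k) (deg : nat -> set R).

Definition tens_deg (n : nat) : set (R ⊗ R) :=
  span [set t | exists p q a b,
    [/\ deg p a, deg q b, (p + q)%N = n & t = a ⊗ b]].

Definition koszul_mul : R ⊗ R -> R ⊗ R -> R ⊗ R :=
  the_map [set m | bilin m /\
    forall p q a b a' b', deg p b -> deg q a' ->
      m (a ⊗ b) (a' ⊗ b') = (-1) ^+ (p * q) *: (kmul a a' ⊗ kmul b b')].

Definition koszul_diff (d : R -> R) : R ⊗ R -> R ⊗ R :=
  the_map [set D | linear D /\
    forall p a b, deg p a ->
      D (a ⊗ b) = d a ⊗ b + (-1) ^+ p *: (a ⊗ d b)].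

Definition koszul_flip : R ⊗ R -> R ⊗ R :=
  the_map [set t | linear t /\
    forall p q a b, deg p a -> deg q b ->
      t (a ⊗ b) = (-1) ^+ (p * q) *: (b ⊗ a)].

(* i(f ⊗ g) for g of degree q *)
Definition koszul_form (q : nat) (f g : R -> k^o) : R ⊗ R -> k^o :=
  the_map [set F | linear F /\
    forall m b b', deg m b -> F (b ⊗ b') = (-1) ^+ (q * m) * (f b * g b')].

End Koszul.

Section Coalgebras.
Variables (k : comPzRingType) (R : lmodType k).
Variables (D : R -> R ⊗ R) (eps : R -> k^o).

Definition is_coideal (I : set R) : Prop :=
  (forall b, I b -> eps b = 0) /\
  (forall b, I b ->
     span [set t | exists a c, (I a \/ I c) /\ t = a ⊗ c] (D b)).

Record is_coalgebra : Prop := {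
  comul_linear : linear D;
  counit_linear : linear eps;
  comul_coassoc : forall b, tassoc (tmap D id (D b)) = tmap id D (D b);
  comul_counitl : forall b, tlift (fun a c => (eps a : k) *: c) (D b) = b;
  comul_counitr : forall b, tlift (fun a c => (eps c : k) *: a) (D b) = b
}.

End Coalgebras.

Section AlgebraB.
Variables (k : comPzRingType) (X : rackType).

(* [inl x] stands for the generator x and [inr x] for e_x. *)
Definition B_gen : choiceType := (X + X)%type.

Let fx (x : X) : freealg k B_gen := fa_gen k (inl x : B_gen).
Let fe (x : X) : freealg k B_gen := fa_gen k (inr x : B_gen).

Definition B_rel : set (freealg k B_gen) :=
  [set r | exists x y, r = fx y * fx (x ◁ y) - fx x * fx y
                    \/ r = fx y * fe (x ◁ y) - fe x * fx y].

Definition B := qalg B_rel.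
HB.instance Definition _ := KAlgebra.on B.
HB.instance Definition _ := GRing.PzRing.on B.

Definition bx (x : X) : B := qproj B_rel (fx x).
Definition be (x : X) : B := qproj B_rel (fe x).

Definition emon (s : seq X) : B := \prod_(x <- s) be x.

Definition B_deg (n : nat) : set B :=
  span [set b | exists w : seq B_gen,
    count (fun g => if g is inr _ then true else false) w = n
    /\ b = qproj B_rel (delta k w)].

Definition B_diff : B -> B :=
  the_map [set d : B -> B | [/\ linear d,
    forall n b, B_deg n.+1 b -> B_deg n (d b),
    forall p a b, B_deg p a -> d (a * b) = d a * b + (-1) ^+ p *: (a * d b),
    forall x, d (bx x) = 0
    & forall x, d (be x) = bx x - 1]].

Definition BB_mul := @koszul_mul k B B_deg.
Definition B_flip := @koszul_flip k B B_deg.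
Definition BB_prod (s : seq (B ⊗ B)) : B ⊗ B :=
  \big[BB_mul / (1 : B) ⊗ (1 : B)]_(t <- s) t.

Definition B_comul : B -> B ⊗ B :=
  the_map [set D : B -> B ⊗ B | [/\ linear D, D 1 = (1 : B) ⊗ (1 : B),
    forall a b, D (a * b) = BB_mul (D a) (D b),
    forall x, D (bx x) = bx x ⊗ bx x
    & forall x, D (be x) = be x ⊗ bx x + (1 : B) ⊗ be x]].

Definition B_counit : B -> k^o :=
  the_map [set eps : B -> k^o | [/\ linear eps, eps 1 = 1,
    forall a b, eps (a * b) = eps a * eps b,
    forall x, eps (bx x) = 1
    & forall x, eps (be x) = 0]].

(* The diagonal left action of x on B ⊗ B. A map is A-linear if and only if it
   is k-linear and commutes with the action of the generators x of A. *)
Definition B_diag (x : X) : B ⊗ B -> B ⊗ B := tmap ( *%R (bx x)) ( *%R (bx x)).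

Definition B_h : B -> B ⊗ B :=
  the_map [set h : B -> B ⊗ B | [/\ linear h,
    forall x b, h (bx x * b) = B_diag x (h b),
    h 1 = 0,
    forall x, h (be x) = be x ⊗ be x
    & forall n (s : n.-tuple X), h (emon s) =
        \sum_(i < n) (-1) ^+ i *:
          BB_mul
            (BB_mul (BB_prod [seq B_flip (B_comul (be x)) | x <- take i s])
                    (h (be (tnth s i))))
            (BB_prod [seq B_comul (be x) | x <- drop i.+1 s])]].

Definition B_squares : set B := [set b | exists x, b = be x * be x].

Definition B_ideal : set B := ideal B_squares.

Definition BQ := qalg B_squares.
HB.instance Definition _ := KAlgebra.on BQ.
HB.instance Definition _ := GRing.PzRing.on BQ.

Definition BQ_proj : B -> BQ := qproj B_squares.

Definition BQ_deg (n : nat) : set BQ := BQ_proj @` B_deg n.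

Definition BQ_diag (x : X) : BQ ⊗ BQ -> BQ ⊗ BQ :=
  tmap ( *%R (BQ_proj (bx x))) ( *%R (BQ_proj (bx x))).

End AlgebraB.

Section Cup.
Variables (k : comPzRingType) (X : quandleType).

(* The identification of C_Q^n(X, k) with Hom_A(B^Q_n, k), extended by zero. *)
Definition cochain_ext n (f : cochain k X n) : BQ k X -> k^o :=
  the_map [set F : BQ k X -> k^o | [/\ linear F,
    forall x b, F (BQ_proj (bx k x) * b) = F b,
    forall s : n.-tuple X, F (BQ_proj (emon k s)) = f (qclass k s)
    & forall m b, m <> n -> BQ_deg m b -> F b = 0]].

Definition is_cup_product (DQ : BQ k X -> BQ k X ⊗ BQ k X)
    (cup : graded_product (cochain k X)) : Prop :=
  forall p q (f : cochain k X p) (g : cochain k X q) b,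
    cochain_ext (cup _ _ f g) b
      = koszul_form (@BQ_deg k X) q (cochain_ext f) (cochain_ext g) (DQ b).

End Cup.

(* Main.v *)
From HB Require Import structures.
Require Import Defs.
From mathcomp Require Import all_boot all_algebra.
From mathcomp Require Import boolp classical_sets functions.


(** The algebra [B] is a quotient of the free algebra on the letters x and e_x,
    so a linear map out of [B] is the same as a function on words that respects
    the relations ([B_lift]). Besides the algebra morphism Delta this gives two
    skew derivations. Write s(a) = (-1)^|a| a and T for the signed flip; then

      d(ab) = d(a) b + s(a) d(b),
      h(ab) = h(a) Delta(b) + T(Delta(s(a))) h(b),

    with h(x) = 0 and h(e_x) = e_x (x) e_x. Expanding the second rule on
    e_{x_1} ... e_{x_n} gives the alternating sum that defines h ([h_mon]), so
    the A-linear map h is this skew derivation ([hmap_homotopy]). Coassociativity,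
    compatibility of Delta with the differentials and the homotopy identity
    D h + h d = T Delta - Delta, where D is the differential of the tensor
    square, have both sides multiplicative or skew in the same way. They
    therefore pass from b to x b and e_x b as soon as they hold on the letters
    ([comul_coassociative], [comul_diff], [homotopy]).

    In a quandle x e_x = e_x x. This makes the two mixed terms of Delta(e_x)^2
    cancel, so that Delta(e_x^2) = e_x^2 (x) x^2 + 1 (x) e_x^2 ([De_sqr]). It also
    gives d(e_x^2) = 0, and every term of h(e_x^2) has a tensor factor divisible
    by e_x^2 ([h_sqr]). Hence the ideal of squares is a coideal and Delta, d, h
    descend to the quotient. The quotient is generated by the same letters, so
    the identities above hold there by the same argument; this is why they are
    proved for any algebra with such generators ([rack_gens]).

    A quandle cochain of degree n is the same thing as a linear form on the
    quotient that is invariant under left multiplication by every x and vanishes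
    outside degree n ([cochain_ext_spec], [cochain_ext_surj]). Under this
    identification the coboundary is composition with d ([cochain_ext_diff]) and
    the product is composition of f (x) g with Delta, so the axioms of a
    differential graded algebra are the transposes of those of a differential
    graded coalgebra ([cup_dga]). Transposing the homotopy identity shows that
    for cocycles f and g of degrees p and q the cochain
    (-1)^(pq) f g - g f is the coboundary of (g (x) f) h ([cup_comm]), which is
    graded commutativity in cohomology. *)

Set Implicit Arguments.
Unset Strict Implicit.
Unset Printing Implicit Defensive.

Import GRing.Theory.
Local Open Scope ring_scope.

Local Notation "a ** b" := (kmul a b) (at level 40, left associativity).
Local Notation span := Defs.span.

(** * Linear maps and tensor products *)
Section LinearMaps.
Variables (k : pzRingType) (U V W : lmodType k).
Implicit Types f g : U -> V.

Lemma lin0 f : linear f -> f 0 = 0.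
Proof. by move=> lf; apply: (addrI (f 0)); have := lf 1 0 0; rewrite !scale1r !addr0. Qed.
Lemma linZ f : linear f -> forall a u, f (a *: u) = a *: f u.
Proof. by move=> lf a u; have := lf a u 0; rewrite (lin0 lf) !addr0. Qed.
Lemma linD f : linear f -> forall u v, f (u + v) = f u + f v.
Proof. by move=> lf u v; have := lf 1 u v; rewrite !scale1r. Qed.
Lemma linN f : linear f -> forall u, f (- u) = - f u.
Proof. by move=> lf u; rewrite -scaleN1r (linZ lf) scaleN1r. Qed.
Lemma linB f : linear f -> forall u v, f (u - v) = f u - f v.
Proof. by move=> lf u v; rewrite (linD lf) (linN lf). Qed.
Lemma lin_sum f : linear f ->
  forall I (r : seq I) (F : I -> U), f (\sum_(i <- r) F i) = \sum_(i <- r) f (F i).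
Proof.
move=> lf I r F; elim/big_rec2: _ => [|i u v _ <-]; first exact: lin0.
by rewrite (linD lf).
Qed.

Lemma lin_comp f (g : V -> W) : linear f -> linear g -> linear (g \o f).
Proof. by move=> lf lg a u v /=; rewrite lf lg. Qed.
Lemma lin_add f g : linear f -> linear g -> linear (fun u => f u + g u).
Proof. by move=> lf lg a u v; rewrite lf lg scalerDr addrACA. Qed.
Lemma lin_opp f : linear f -> linear (fun u => - f u).
Proof. by move=> lf a u v; rewrite lf opprD scalerN. Qed.
Lemma lin_sub f g : linear f -> linear g -> linear (fun u => f u - g u).
Proof. by move=> lf lg; apply: lin_add => //; apply: lin_opp. Qed.
Lemma lin_id : linear (fun u : U => u). Proof. by []. Qed.
Lemma lin_zero : linear (fun u : U => 0 : V).
Proof. by move=> a u v; rewrite scaler0 addr0. Qed.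

Lemma span_image f (S : set U) (T : set V) : linear f ->
  (forall u, S u -> span T (f u)) -> forall u, span S u -> span T (f u).
Proof.
move=> lf fS u; elim=> [|{}u /fS//|v w _ Tv _ Tw|a v _ Tv].
- by rewrite (lin0 lf); apply: span0.
- by rewrite (linD lf); apply: spanD.
- by rewrite (linZ lf); apply: spanZ.
Qed.

Lemma span_eq f g (S : set U) : linear f -> linear g ->
  (forall u, S u -> f u = g u) -> forall u, span S u -> f u = g u.
Proof.
move=> lf lg fg u; elim=> [|{}u /fg//|v w _ E _ F|a v _ E].
- by rewrite (lin0 lf) (lin0 lg).
- by rewrite (linD lf) (linD lg) E F.
- by rewrite (linZ lf) (linZ lg) E.
Qed.

End LinearMaps.

Lemma span_sub (k : pzRingType) (U : lmodType k) (S T : set U) :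
  (forall u, S u -> span T u) -> forall u, span S u -> span T u.
Proof. exact: (span_image (@lin_id k U)). Qed.

Lemma span_span (k : pzRingType) (U : lmodType k) (S : set U) u :
  span (span S) u -> span S u.
Proof. exact: span_sub. Qed.

Lemma lin_scale (k : comPzRingType) (U V : lmodType k) (f : U -> V) (a : k) :
  linear f -> linear (fun u => a *: f u).
Proof. by move=> lf b u v; rewrite lf scalerDr !scalerA mulrC. Qed.

(** Every operation defined by [the_map] is used through this lemma: once some
    map with the defining property exists, the chosen one has it too. *)
Lemma the_mapP (U : Type) (V : zmodType) (P : set (U -> V)) :
  (exists f, P f) -> P (the_map P).
Proof. by case=> f Pf; apply: (xgetPex (fun=> 0)); exists f. Qed.

Section TensorProducts.
Variable k : comPzRingType.
Implicit Types U V W : lmodType k.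

Lemma ptensDl V W (v v' : V) (w : W) : (v + v') ⊗ w = v ⊗ w + v' ⊗ w.
Proof. by have := ptensPl 1 v v' w; rewrite !scale1r. Qed.
Lemma ptensDr V W (v : V) (w w' : W) : v ⊗ (w + w') = v ⊗ w + v ⊗ w'.
Proof. by have := ptensPr 1 v w w'; rewrite !scale1r. Qed.
Lemma lin_ptensl V W (w : W) : linear (fun v : V => v ⊗ w).
Proof. by move=> a u v; apply: ptensPl. Qed.
Lemma lin_ptensr V W (v : V) : linear (fun w : W => v ⊗ w).
Proof. by move=> a u w; apply: ptensPr. Qed.
Definition ptens0l V W (w : W) := lin0 (@lin_ptensl V W w).
Definition ptens0r V W (v : V) := lin0 (@lin_ptensr V W v).
Definition ptensZl V W (w : W) := linZ (@lin_ptensl V W w).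
Definition ptensZr V W (v : V) := linZ (@lin_ptensr V W v).
Definition ptensNl V W (w : W) := linN (@lin_ptensl V W w).
Definition ptensNr V W (v : V) := linN (@lin_ptensr V W v).
Definition ptensBl V W (w : W) := linB (@lin_ptensl V W w).
Definition ptensBr V W (v : V) := linB (@lin_ptensr V W v).

Lemma tens_span V W (t : V ⊗ W) : span [set t | exists v w, t = v ⊗ w] t.
Proof.
elim/qpi_ind: t; elim/freemod_ind => [a f g Sf Sg||[v w]].
- by rewrite linearP; apply: spanD => //; apply: spanZ.
- by rewrite linear0; apply: span0.
- by apply: span_gen; exists v, w.
Qed.

Lemma tens_span_gen V W (S : set V) (T : set W) :
  (forall v, span S v) -> (forall w, span T w) -> forall t : V ⊗ W,
  span [set t | exists v w, [/\ S v, T w & t = v ⊗ w]] t.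
Proof.
move=> SV TW t; apply: span_sub (tens_span t) => _ [v [w ->]].
apply: (span_image (lin_ptensl w)) (SV v) => {}v Sv.
apply: (span_image (lin_ptensr v)) (TW w) => {}w Tw.
by apply: span_gen; exists v, w.
Qed.

Lemma tens_eq U V W (f g : V ⊗ W -> U) : linear f -> linear g ->
  (forall v w, f (v ⊗ w) = g (v ⊗ w)) -> f =1 g.
Proof. by move=> lf lg E t; apply: (span_eq lf lg) (tens_span t) => _ [v [w ->]]. Qed.

Lemma bilin_tmap V V' W W' (f : V -> V') (g : W -> W') : linear f -> linear g ->
  bilin (fun v w => f v ⊗ g w).
Proof.
by move=> lf lg; split=> ? a u v; rewrite ?lf ?lg ?ptensPl ?ptensPr.
Qed.
Lemma tmapE V V' W W' (f : V -> V') (g : W -> W') : linear f -> linear g ->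
  forall v w, tmap f g (v ⊗ w) = f v ⊗ g w.
Proof. by move=> lf lg v w; rewrite /tmap tliftE //; apply: bilin_tmap. Qed.
Lemma lin_tmap V V' W W' (f : V -> V') (g : W -> W') : linear f -> linear g ->
  linear (tmap f g).
Proof. by move=> lf lg; apply/tlift_is_linear/bilin_tmap. Qed.

Lemma bilin_assoc U V W (w : W) :
  bilin (fun (u : U) (v : V) => u ⊗ (v ⊗ w)).
Proof. by split=> ? a u v; rewrite ?ptensPl ?ptensPr. Qed.
Lemma bilin_tassoc U V W : bilin (fun (t : U ⊗ V) (w : W) =>
  tlift (fun u v => u ⊗ (v ⊗ w)) t).
Proof.
split=> [w|t a w w']; first by apply/tlift_is_linear/bilin_assoc.
have lw (w1 : W) := tlift_is_linear (@bilin_assoc U V W w1).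
move: t; apply: tens_eq; first exact: lw.
  by apply: lin_add => //; apply: lin_scale.
move=> u v; rewrite !tliftE; try exact: bilin_assoc.
by rewrite !ptensPr.
Qed.
Lemma tassocE U V W (u : U) (v : V) (w : W) :
  tassoc ((u ⊗ v) ⊗ w) = u ⊗ (v ⊗ w).
Proof. by rewrite /tassoc !tliftE //; [apply: bilin_assoc|apply: bilin_tassoc]. Qed.
Lemma lin_tassoc U V W : linear (@tassoc k U V W).
Proof. exact/tlift_is_linear/bilin_tassoc. Qed.

(** Right exactness of the tensor product. Tensoring representatives gives a
    well defined map from the tensor product of the quotients to the quotient
    by the span on the right, and composing it with the projection gives the
    canonical projection; so the kernel of the projection is no larger. *)
Lemma ker_tmap_qpi V W (S : set V) (T : set W) (t : V ⊗ W) :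
  tmap (qpi S) (qpi T) t = 0 ->
  span [set t | exists v w, (span S v \/ span T w) /\ t = v ⊗ w] t.
Proof.
set J : set (V ⊗ W) := (X in span X).
(* The class of a pure tensor depends only on the classes of its factors. *)
have repl v v' w w' : qpi S v = qpi S v' -> qpi T w = qpi T w' ->
    qpi J (v ⊗ w) = qpi J (v' ⊗ w').
  move=> /qpiP Sv /qpiP Tw; apply/qpiP.
  rewrite -(subrKA (v' ⊗ w)) -ptensBl -ptensBr; apply: spanD; apply: span_gen.
    by exists (v - v'), w; split=> //; left.
  by exists v', (w - w'); split=> //; right.
pose b (c : quotmod S) (e : quotmod T) : quotmod J := qpi J (qrepr c ⊗ qrepr e).
have lS : linear (qpi S) by exact: linearP.
have lT : linear (qpi T) by exact: linearP.
have lJ : linear (qpi J) by exact: linearP.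
have bb : bilin b.
  split=> [e|c] a u v; rewrite /b -lJ -?ptensPl -?ptensPr; apply: repl => //;
  by rewrite ?lS ?lT !qreprK.
have E : tlift b \o tmap (qpi S) (qpi T) =1 qpi J.
  apply: tens_eq => // [|v w].
    by apply: lin_comp; [apply: lin_tmap|apply: tlift_is_linear].
  by rewrite /= tmapE // tliftE //; apply: repl; rewrite qreprK.
move=> t0; apply/qpi_eq0; rewrite -E /= t0.
exact/lin0/tlift_is_linear.
Qed.
End TensorProducts.

(** * Signed tensor squares of graded algebras *)
Section Graded.
Variables (k : comPzRingType) (R : kalgType k) (deg : nat -> set R).

(** Koszul signs depend only on the parity of degrees. For the signed operations
    to be well defined it is enough that the degrees span the algebra and that
    a linear projection on the odd part exists, as [deg_odd] asserts; over a
    ring with 2-torsion this says more than that the sign involution exists. *)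
Record is_graded : Prop := {
  deg_span : forall n b, span (deg n) b -> deg n b;
  deg_one : deg 0 kone;
  deg_mul : forall p q a b, deg p a -> deg q b -> deg (p + q) (a ** b);
  deg_total : forall b, span [set a | exists n, deg n a] b;
  deg_odd : exists o : R -> R, linear o /\
    forall n a, deg n a -> o a = (odd n)%:R *: a
}.

Hypothesis gr : is_graded.

Lemma deg_lin n (a : k) u v : deg n u -> deg n v -> deg n (a *: u + v).
Proof.
move=> du dv; apply: (deg_span gr); apply: spanD; last exact: span_gen.
by apply: spanZ; apply: span_gen.
Qed.
Lemma deg0 n : deg n 0.
Proof. by apply: (deg_span gr); apply: span0. Qed.
Lemma degZ n (a : k) u : deg n u -> deg n (a *: u).
Proof. by move=> du; rewrite -[_ *: _]addr0; apply: deg_lin => //; apply: deg0. Qed.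

Definition gsign : R -> R := the_map [set s : R -> R | linear s /\
  forall n a, deg n a -> s a = (-1) ^+ n *: a].

Lemma gsign_spec : linear gsign /\ forall n a, deg n a -> gsign a = (-1) ^+ n *: a.
Proof.
apply: (@the_mapP _ _ [set s : R -> R | linear s /\
  forall n a, deg n a -> s a = (-1) ^+ n *: a]).
have [o [lo oE]] := deg_odd gr.
(* a minus twice its odd part *)
exists (fun a => a - (o a + o a)); split.
  by apply: lin_sub; [exact: lin_id|apply: lin_add].
move=> n a /oE ->; rewrite -signr_odd; case: odd => /=.
  by rewrite scale1r expr1 scaleN1r opprD addNKr.
by rewrite scale0r addr0 subr0 expr0 scale1r.
Qed.
Definition lin_gsign := gsign_spec.1.
Definition gsignE := gsign_spec.2.

Lemma graded_eq (V : lmodType k) (f g : R -> V) : linear f -> linear g ->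
  (forall n a, deg n a -> f a = g a) -> f =1 g.
Proof.
by move=> lf lg E a; apply: (span_eq lf lg) (deg_total gr a) => u [n /E].
Qed.

Lemma hom_tens_eq (V : lmodType k) (f g : R ⊗ R -> V) : linear f -> linear g ->
  (forall p q a b, deg p a -> deg q b -> f (a ⊗ b) = g (a ⊗ b)) -> f =1 g.
Proof.
move=> lf lg E t.
apply: (span_eq lf lg) (tens_span_gen (deg_total gr) (deg_total gr) t).
by move=> _ [a [b [[p da] [q db] ->]]]; apply: E da db.
Qed.

Lemma gsign_deg n a : deg n a -> deg n (gsign a).
Proof. by move=> da; rewrite (gsignE da); apply: degZ. Qed.

Lemma signZZ (V : lmodType k) n (v : V) : (-1) ^+ n *: ((-1) ^+ n *: v) = v.
Proof. by rewrite scalerA -exprD addnn -signr_odd odd_double scale1r. Qed.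

Lemma lin_kmull (c : R) : linear (fun a => a ** c).
Proof. exact: kmulPl. Qed.
Lemma lin_kmulr (c : R) : linear (fun a => c ** a).
Proof. exact: kmulPr. Qed.

Lemma gsignM a b : gsign (a ** b) = gsign a ** gsign b.
Proof.
have l := lin_gsign; move: a; apply: graded_eq => [||p a da].
- by apply: (lin_comp (@lin_kmull b)).
- by apply: (lin_comp l (@lin_kmull _)).
move: b; apply: graded_eq => [||q b db].
- by apply: (lin_comp (@lin_kmulr a)).
- by apply: (lin_comp l (@lin_kmulr _)).
rewrite (gsignE da) (gsignE db) (gsignE (deg_mul gr da db)).
by rewrite kmulZl kmulZr scalerA exprD.
Qed.

Lemma gsign1 : gsign kone = kone.
Proof. by rewrite (gsignE (deg_one gr)) scale1r. Qed.

Lemma iter_gsign q p a : deg p a -> iter q gsign a = (-1) ^+ (p * q) *: a.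
Proof.
move=> da; elim: q => [|q /= ->]; first by rewrite muln0 scale1r.
by rewrite (linZ lin_gsign) (gsignE da) scalerA -exprD mulnS addnC.
Qed.
Lemma lin_iter_gsign q : linear (iter q gsign).
Proof. by elim: q => [|q IH] //; apply: (lin_comp IH lin_gsign). Qed.

(** The sign (-1)^(pq) equals 1 unless p and q are both odd, so the signed
    product is the unsigned one minus twice its part on which the two inner
    factors are odd. *)
Lemma koszul_mul_spec : bilin (koszul_mul deg) /\
  forall p q a b a' b', deg p b -> deg q a' ->
   koszul_mul deg (a ⊗ b) (a' ⊗ b') = (-1) ^+ (p * q) *: ((a ** a') ⊗ (b ** b')).
Proof.
pose P := [set m : R ⊗ R -> R ⊗ R -> R ⊗ R | bilin m /\
    forall p q a b a' b', deg p b -> deg q a' ->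
      m (a ⊗ b) (a' ⊗ b') = (-1) ^+ (p * q) *: (kmul a a' ⊗ kmul b b')]%classic.
have := @the_mapP _ _ P; apply; have [o [lo oE]] := deg_odd gr.
(* With f and g both the identity this gives the unsigned product, with both the
   parity projection its part with odd inner factors. *)
pose beta (f g : R -> R) a b t := tmap (fun a' => a ** f a') (fun b' => g b ** b') t.
have lr f c : linear f -> linear (fun a => c ** f a).
  by move=> lf z u v; rewrite lf kmulPr.
have bb f g : linear f -> linear g -> forall t, bilin (fun a b => beta f g a b t).
  move=> lf lg t; split=> [b|a] z u v; rewrite /beta; move: t; apply: tens_eq.
  - by apply: lin_tmap; [apply: lr|apply: lin_kmulr].
  - by apply: lin_add; [apply: lin_scale|];
      (apply: lin_tmap; [apply: lr|apply: lin_kmulr]).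
  - move=> a' b'; rewrite !tmapE; try by [apply: lr|apply: lin_kmulr].
    by rewrite kmulPl ptensPl.
  - by apply: lin_tmap; [apply: lr|apply: lin_kmulr].
  - by apply: lin_add; [apply: lin_scale|];
      (apply: lin_tmap; [apply: lr|apply: lin_kmulr]).
  - move=> a' b'; rewrite !tmapE; try by [apply: lr|apply: lin_kmulr].
    by rewrite lg kmulPl ptensPr.
pose m f g s t := tlift (fun a b => beta f g a b t) s.
have ml f g : linear f -> linear g -> forall t, linear (m f g ^~ t).
  by move=> lf lg t; apply: tlift_is_linear; apply: bb.
have mE f g : linear f -> linear g -> forall a b a' b',
   m f g (a ⊗ b) (a' ⊗ b') = (a ** f a') ⊗ (g b ** b').
  move=> lf lg a b a' b'; rewrite /m tliftE; last exact: bb.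
  by rewrite /beta tmapE //; [apply: lr|apply: lin_kmulr].
have mr f g : linear f -> linear g -> forall s, linear (m f g s).
  move=> lf lg s z u v; move: s; apply: tens_eq; first exact: ml.
    by apply: lin_add; [apply: lin_scale|]; apply: ml.
  move=> a b; rewrite /m !tliftE; try by apply: bb.
  by rewrite /beta lin_tmap; [|apply: lr|apply: lin_kmulr].
have l1 := @lin_id k R.
exists (fun s t => m id id s t - (m o o s t + m o o s t)); split.
  split=> s.
    exact: (lin_sub (ml id id l1 l1 s) (lin_add (ml o o lo lo s) (ml o o lo lo s))).
  exact: (lin_sub (mr id id l1 l1 s) (lin_add (mr o o lo lo s) (mr o o lo lo s))).
move=> p q a b a' b' db da'; rewrite !mE // (oE _ _ db) (oE _ _ da').
rewrite -signr_odd oddM kmulZl kmulZr ptensZl ptensZr.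
case: (odd p); case: (odd q); rewrite /= ?scale1r ?scale0r ?scaler0 ?addr0 ?subr0 //.
by rewrite expr1 scaleN1r opprD addNKr.
Qed.

Local Notation m := (koszul_mul deg).
Lemma lin_kml t : linear (m^~ t). Proof. exact: koszul_mul_spec.1.1. Qed.
Lemma lin_kmr t : linear (m t). Proof. exact: koszul_mul_spec.1.2. Qed.
Definition kmE := koszul_mul_spec.2.

(** When only one of the inner factors is homogeneous, the sign is carried by
    iterating the sign involution on the other one. *)
Lemma kmEr q a b a' b' : deg q a' ->
  m (a ⊗ b) (a' ⊗ b') = (a ** a') ⊗ (iter q gsign b ** b').
Proof.
move=> da'; move: b; apply: graded_eq => [||p b db].
- exact: (lin_comp (@lin_ptensr k R R a) (@lin_kml _)).
- by apply: (lin_comp _ (@lin_ptensr k R R _)); apply: (lin_comp _ (@lin_kmull _));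
    apply: lin_iter_gsign.
by rewrite (kmE _ _ db da') (iter_gsign _ db) kmulZl ptensZr.
Qed.

Lemma kmEl q a b a' b' : deg q b ->
  m (a ⊗ b) (a' ⊗ b') = (a ** iter q gsign a') ⊗ (b ** b').
Proof.
move=> db; move: a'; apply: graded_eq => [||p a' da'].
- by apply: (lin_comp (@lin_ptensl k R R b') (@lin_kmr _)).
- by apply: (lin_comp _ (@lin_ptensl k R R _)); apply: (lin_comp _ (@lin_kmulr _));
    apply: lin_iter_gsign.
by rewrite (kmE _ _ db da') (iter_gsign _ da') kmulZr ptensZl mulnC.
Qed.

Lemma kmA : associative m.
Proof.
move=> s t u.
move: s; apply: hom_tens_eq => [||p q a b da db].
- exact: lin_kml.
- exact: (lin_comp (@lin_kml _) (@lin_kml _)).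
move: t; apply: hom_tens_eq => [||p' q' a' b' da' db'].
- exact: (lin_comp (@lin_kml _) (@lin_kmr _)).
- exact: (lin_comp (@lin_kmr _) (@lin_kml _)).
move: u; apply: hom_tens_eq => [||p'' q'' a'' b'' da'' db''].
- exact: (lin_comp (@lin_kmr _) (@lin_kmr _)).
- exact: lin_kmr.
rewrite (kmE _ _ db' da'') (kmE _ _ db da') (linZ (@lin_kmr _)) (linZ (@lin_kml _)).
rewrite (kmE _ _ db (deg_mul gr da' da'')) (kmE _ _ (deg_mul gr db db') da'').
rewrite !scalerA !kmulA -!exprD; congr (_ ^+ _ *: _).
by rewrite mulnDr mulnDl addnC -addnA.
Qed.

Lemma km_1l : left_id (kone ⊗ kone) m.
Proof.
apply: tens_eq; [exact: lin_kmr|exact: lin_id|move=> a b].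
by rewrite (kmEl _ _ _ (deg_one gr)) /= !kmul1l.
Qed.
Lemma km_1r : right_id (kone ⊗ kone) m.
Proof.
apply: tens_eq; [exact: lin_kml|exact: lin_id|move=> a b].
by rewrite (kmEr _ _ _ (deg_one gr)) /= !kmul1r.
Qed.

Definition tsign : R ⊗ R -> R ⊗ R := tmap gsign gsign.
Lemma lin_tsign : linear tsign. Proof. exact/lin_tmap/lin_gsign/lin_gsign. Qed.
Lemma tsignE a b : tsign (a ⊗ b) = gsign a ⊗ gsign b.
Proof. by rewrite /tsign tmapE //; exact: lin_gsign. Qed.
Lemma tsignM s t : tsign (m s t) = m (tsign s) (tsign t).
Proof.
have l := lin_tsign.
move: s; apply: hom_tens_eq => [||p q a b da db].
- exact: (lin_comp (@lin_kml _)).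
- exact: (lin_comp l (@lin_kml _)).
move: t; apply: hom_tens_eq => [||p' q' a' b' da' db'].
- exact: (lin_comp (@lin_kmr _)).
- exact: (lin_comp l (@lin_kmr _)).
rewrite (kmE _ _ db da') (linZ l) !tsignE !gsignM.
by rewrite (kmE _ _ (gsign_deg db) (gsign_deg da')).
Qed.

End Graded.

(** A name for the tensor square that carries the algebra structure of the signed
    product, which depends on the grading. *)
Definition ktens (k : comPzRingType) (R : kalgType k) (deg : nat -> set R)
  (gr : is_graded deg) := (R ⊗ R)%type.

(** * Signed flip, differential and pairing on the tensor square *)
Section KoszulCalculus.
Variables (k : comPzRingType) (R : kalgType k) (deg : nat -> set R).
Hypothesis gr : is_graded deg.
Local Notation m := (koszul_mul deg).
Local Notation sg := (gsign deg).

HB.instance Definition _ := GRing.Lmodule.on (ktens gr).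
HB.instance Definition _ := isKAlgebra.Build k (ktens gr)
  (kmA gr) (km_1l gr) (km_1r gr) (lin_kml gr) (lin_kmr gr).

Lemma tens_deg_pure p q a b : deg p a -> deg q b -> tens_deg deg (p + q) (a ⊗ b).
Proof. by move=> da db; apply: span_gen; exists p, q, a, b. Qed.

Lemma tens_deg_mul i j s t :
  tens_deg deg i s -> tens_deg deg j t -> tens_deg deg (i + j) (m s t).
Proof.
move=> ds dt; apply: (span_image (lin_kml gr t)) ds => _ [p [q [a [b [da db <- ->]]]]].
apply: (span_image (lin_kmr gr _)) dt => _ [p' [q' [a' [b' [da' db' <- ->]]]]].
rewrite (kmE gr _ _ db da'); apply: spanZ; rewrite addnACA.
by apply: tens_deg_pure; apply: (deg_mul gr).
Qed.

Local Notation fl := (koszul_flip deg).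

Lemma koszul_flip_spec : linear fl /\ forall p q a b, deg p a -> deg q b ->
  fl (a ⊗ b) = (-1) ^+ (p * q) *: (b ⊗ a).
Proof.
apply: (@the_mapP _ _ [set t : R ⊗ R -> R ⊗ R | linear t /\
    forall p q a b, deg p a -> deg q b ->
      t (a ⊗ b) = (-1) ^+ (p * q) *: (b ⊗ a)]%classic).
have [o [lo oE]] := deg_odd gr.
pose b0 (a b : R) := b ⊗ a; pose b1 (a b : R) := o b ⊗ o a.
have bb0 : bilin b0 by split=> ? a u v; rewrite /b0 ?ptensPl ?ptensPr.
have bb1 : bilin b1 by split=> ? a u v; rewrite /b1 lo ?ptensPl ?ptensPr.
exists (fun t => tlift b0 t - (tlift b1 t + tlift b1 t)); split.
  have l0 := tlift_is_linear bb0; have l1 := tlift_is_linear bb1.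
  exact: lin_sub l0 (lin_add l1 l1).
move=> p q a b da db; rewrite !tliftE // /b0 /b1 (oE _ _ da) (oE _ _ db).
rewrite -signr_odd oddM ptensZl ptensZr.
case: (odd p); case: (odd q); rewrite /= ?scale1r ?scale0r ?scaler0 ?addr0 ?subr0 //.
by rewrite expr1 scaleN1r opprD addNKr.
Qed.
Definition lin_flip := koszul_flip_spec.1.
Definition flipE := koszul_flip_spec.2.

Lemma flipEl p a b : deg p a -> fl (a ⊗ b) = iter p sg b ⊗ a.
Proof.
move=> da; move: b; apply: (graded_eq gr) => [||q b db].
- exact: (lin_comp (@lin_ptensr k R R a) lin_flip).
- exact: (lin_comp (lin_iter_gsign gr p) (@lin_ptensl k R R a)).
by rewrite (flipE da db) (iter_gsign gr _ db) ptensZl mulnC.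
Qed.
Lemma flipEr q a b : deg q b -> fl (a ⊗ b) = b ⊗ iter q sg a.
Proof.
move=> db; move: a; apply: (graded_eq gr) => [||p a da].
- exact: (lin_comp (@lin_ptensl k R R b) lin_flip).
- exact: (lin_comp (lin_iter_gsign gr q) (@lin_ptensr k R R b)).
by rewrite (flipE da db) (iter_gsign gr _ da) ptensZr.
Qed.

(** On homogeneous tensors both sides are the same pure tensor, and the signs
    agree because the exponents have the same parity. *)
Lemma flipM s t : fl (m s t) = m (fl s) (fl t).
Proof.
have l := lin_flip.
move: s; apply: (hom_tens_eq gr) => [||p q a b da db].
- exact: (lin_comp (lin_kml gr _) l).
- exact: (lin_comp l (lin_kml gr _)).
move: t; apply: (hom_tens_eq gr) => [||p' q' a' b' da' db'].
- exact: (lin_comp (lin_kmr gr _) l).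
- exact: (lin_comp l (lin_kmr gr _)).
rewrite (kmE gr _ _ db da') (linZ l) (flipE da db) (flipE da' db').
rewrite (flipE (deg_mul gr da da') (deg_mul gr db db')).
rewrite (linZ (lin_kml gr _)) (linZ (lin_kmr gr _)) (kmE gr _ _ da db').
rewrite !scalerA -!exprD -signr_odd -[in RHS]signr_odd.
congr ((-1) ^+ nat_of_bool _ *: _).
rewrite !(oddD, oddM).
by case: (odd p); case: (odd q); case: (odd p'); case: (odd q').
Qed.

Lemma flip_tsign t : fl (tsign deg t) = tsign deg (fl t).
Proof.
have l := lin_flip; have lt := lin_tsign gr.
move: t; apply: (hom_tens_eq gr); try exact: lin_comp.
move=> p q a b da db; rewrite (flipE da db) (linZ lt) !(tsignE gr).
by rewrite (flipE (gsign_deg gr da) (gsign_deg gr db)).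
Qed.

Section Diff.
Variable d : R -> R.
Hypothesis ld : linear d.
Local Notation D := (koszul_diff deg d).

Lemma koszul_diff_spec : linear D /\
  forall a b, D (a ⊗ b) = d a ⊗ b + sg a ⊗ d b.
Proof.
have [l DE] : linear D /\ forall p a b, deg p a ->
      D (a ⊗ b) = d a ⊗ b + (-1) ^+ p *: (a ⊗ d b).
  apply: (@the_mapP _ _ [set t : R ⊗ R -> R ⊗ R | linear t /\
    forall p a b, deg p a ->
      t (a ⊗ b) = d a ⊗ b + (-1) ^+ p *: (a ⊗ d b)]%classic).
  exists (fun t => tmap d id t + tmap sg d t); split.
    by apply: lin_add; apply: lin_tmap => //; apply: (lin_gsign gr).
  move=> p a b da; rewrite !tmapE //; last exact: (lin_gsign gr).
  by rewrite (gsignE gr da) ptensZl.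
split=> // a b; move: a; apply: (graded_eq gr) => [||p a da].
- exact: (lin_comp (@lin_ptensl k R R b) l).
- apply: lin_add; first exact: (lin_comp ld (@lin_ptensl k R R b)).
  exact: (lin_comp (lin_gsign gr) (@lin_ptensl k R R (d b))).
- by rewrite (DE _ _ _ da) (gsignE gr da) ptensZl.
Qed.
Definition lin_kdiff := koszul_diff_spec.1.
Definition kdiffE := koszul_diff_spec.2.

Hypothesis d_anti : forall a, sg (d a) = - d (sg a).

(** Anticommutation of [d] with the sign involution is how its odd degree enters
    the sign computations; degree 0 then needs no separate treatment. *)
Lemma iter_anti n a : iter n sg (d a) = (-1) ^+ n *: d (iter n sg a).
Proof.
elim: n => [|n IH] /=; first by rewrite scale1r.
by rewrite IH (linZ (lin_gsign gr)) d_anti exprS mulN1r scaleNr scalerN.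
Qed.
Lemma iter_anti_deg n p a : deg p a ->
  iter n sg (d a) = (-1) ^+ (p * n) *: ((-1) ^+ n *: d a).
Proof.
by move=> da; rewrite iter_anti (iter_gsign gr _ da) (linZ ld) !scalerA mulrC.
Qed.

Lemma kdiff_flip t : fl (D t) = D (fl t).
Proof.
have l := lin_flip; have lD := lin_kdiff.
move: t; apply: (hom_tens_eq gr); try exact: lin_comp.
move=> p q a b da db; rewrite kdiffE (flipE da db) (linZ lD) kdiffE (linD l).
rewrite (flipEr _ db) (flipEl _ (gsign_deg gr da)).
rewrite (iter_anti_deg _ da) (iter_anti_deg _ db) scalerDr addrC.
rewrite (gsignE gr da) (gsignE gr db) !ptensZl !ptensZr mulnC.
by congr (_ + _); rewrite signZZ.
Qed.

Hypothesis d_leib : forall a b, d (a ** b) = d a ** b + sg a ** d b.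

(** The differential of the tensor square is again a super-derivation. *)
Lemma kdiffM s t : D (m s t) = m (D s) t + m (tsign deg s) (D t).
Proof.
have lD := lin_kdiff; have ls := lin_tsign gr.
move: s; apply: (hom_tens_eq gr) => [||p q a b da db].
- exact: (lin_comp (lin_kml gr _) lD).
- apply: lin_add; first exact: (lin_comp lD (lin_kml gr _)).
  exact: (lin_comp ls (lin_kml gr _)).
move: t; apply: (hom_tens_eq gr) => [||p' q' a' b' da' db'].
- exact: (lin_comp (lin_kmr gr _) lD).
- apply: lin_add; first exact: (lin_kmr gr _).
  exact: (lin_comp lD (lin_kmr gr _)).
rewrite (kmE gr _ _ db da') (linZ lD) !kdiffE (tsignE gr).
rewrite (linD (lin_kml gr _)) (linD (lin_kmr gr _)).
rewrite (kmE gr _ _ db da') (kmEr gr _ _ _ da').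
rewrite (kmE gr _ _ (gsign_deg gr db) (gsign_deg gr da')).
rewrite (kmEl gr _ _ _ (gsign_deg gr db)).
rewrite (iter_anti_deg _ db) (iter_anti_deg _ da') !d_leib (gsignM gr).
rewrite (gsignE gr da) (gsignE gr db) (gsignE gr da').
rewrite !(kmulZl, kmulZr, ptensZl, ptensZr, ptensDl, ptensDr, scalerDr).
rewrite mulnC -!addrA; congr (_ + _); rewrite addrC -addrA addrC -!addrA.
rewrite ![_ *: (_ *: _)]scalerA.
rewrite [in RHS]addrC -[in RHS]addrA [in RHS]addrCA.
rewrite -[_ * _ * (-1) ^+ q * (-1) ^+ q]mulrA -expr2 sqrr_sign mulr1.
by rewrite ![(-1) ^+ p * _]mulrC.
Qed.

End Diff.

Section Form.
Variables (q : nat) (f g : R -> k^o).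
Hypotheses (lf : linear f) (lg : linear g).
Local Notation F := (koszul_form deg q f g).

(** The sign (-1)^(q|b|) is q-fold application of the sign involution to b, which
    extends the formula to elements that are not homogeneous. *)
Lemma koszul_form_spec : linear F /\
  forall a b, F (a ⊗ b) = f (iter q sg a) * g b.
Proof.
have [l FE] : linear F /\ forall m b b', deg m b ->
    F (b ⊗ b') = (-1) ^+ (q * m) * (f b * g b').
  apply: (@the_mapP _ _ [set F : R ⊗ R -> k^o | linear F /\
    forall m b b', deg m b -> F (b ⊗ b') = (-1) ^+ (q * m) * (f b * g b')]%classic).
  pose beta a b : k^o := f (iter q sg a) * g b.
  have bb : bilin beta.
    split=> [b|a] z u v; rewrite /beta ?(lin_iter_gsign gr q) ?lf ?lg.
      by rewrite mulrDl; congr (_ + _); apply/esym/mulrA.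
    by rewrite mulrDr; congr (_ + _); apply: mulrCA.
  exists (tlift beta); split; first exact: tlift_is_linear.
  move=> p a b da; rewrite tliftE // /beta (iter_gsign gr _ da) (linZ lf) mulnC.
  by rewrite mulrA.
split=> // a b; move: a; apply: (graded_eq gr) => [||p a da].
- exact: (lin_comp (@lin_ptensl k R R b) l).
- move=> z u v; rewrite (lin_iter_gsign gr q) lf.
  by rewrite mulrDl; congr (_ + _); apply/esym/mulrA.
- by rewrite (FE _ _ _ da) (iter_gsign gr _ da) (linZ lf) mulnC mulrA.
Qed.
Definition lin_form := koszul_form_spec.1.
Definition formE := koszul_form_spec.2.

Lemma form_deg p n t :
  (forall m a, m <> p -> deg m a -> f a = 0) ->
  (forall m a, m <> q -> deg m a -> g a = 0) ->
  n <> (p + q)%N -> tens_deg deg n t -> F t = 0.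
Proof.
move=> f0 g0 npq dt; apply: (span_eq lin_form (@lin_zero k _ _)) dt.
move=> _ [i [j [a [b [da db ij ->]]]]]; rewrite formE (iter_gsign gr _ da) (linZ lf).
have [ip|/eqP ip] := eqVneq i p; last by rewrite (f0 _ _ ip da) scaler0 mul0r.
have [jq|/eqP jq] := eqVneq j q; last by rewrite (g0 _ _ jq db) mulr0.
by case: npq; rewrite -ij ip jq.
Qed.

End Form.

(** The signs of the Leibniz rule for cochains come from here: moving [d] across
    q sign involutions costs (-1)^q, and the sign involution in front of the
    second summand raises q to q + 1. *)
Lemma form_diff q (f g : R -> k^o) d t : linear f -> linear g -> linear d ->
  (forall a, sg (d a) = - d (sg a)) ->
  koszul_form deg q f g (koszul_diff deg d t)
   = (-1) ^+ q *: koszul_form deg q (f \o d) g t + koszul_form deg q.+1 f (g \o d) t.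
Proof.
move=> lf lg ld da; have lF := lin_form.
have lfd := lin_comp ld lf; have lgd := lin_comp ld lg.
move: t; apply: tens_eq => [||a b].
- exact: lin_comp (lin_kdiff ld) (lF _ _ _ lf lg).
- exact: lin_add (lin_scale _ (lF _ _ _ lfd lg)) (lF _ _ _ lf lgd).
rewrite (kdiffE ld) (linD (lF _ _ _ lf lg)) !formE //=.
rewrite (iter_anti da) (linZ lf) -iterSr.
by congr (_ + _); apply/esym/mulrA.
Qed.

(** Both sides vanish outside bidegree (p, q), and there two copies of (-1)^(pq)
    cancel on each side. *)
Lemma form_flip p q (f g : R -> k^o) t : linear f -> linear g ->
  (forall m a, m <> p -> deg m a -> f a = 0) ->
  (forall m a, m <> q -> deg m a -> g a = 0) ->
  koszul_form deg p g f (koszul_flip deg t)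
    = (-1) ^+ (p * q) *: koszul_form deg q f g t.
Proof.
move=> lf lg f0 g0; have lF := lin_form.
move: t; apply: (hom_tens_eq gr) => [||i j a b da db].
- exact: lin_comp lin_flip (lF _ _ _ lg lf).
- exact: lin_scale (lF _ _ _ lf lg).
rewrite (flipE da db) (linZ (lF _ _ _ lg lf)) !formE //.
rewrite (iter_gsign gr _ da) (iter_gsign gr _ db) (linZ lf) (linZ lg).
have [ip|/eqP ip] := eqVneq i p; last first.
  by rewrite (f0 _ _ ip da) scaler0 mulr0 mul0r !scaler0.
have [jq|/eqP jq] := eqVneq j q; last first.
  by rewrite (g0 _ _ jq db) scaler0 mulr0 mul0r !scaler0.
rewrite ip jq [in RHS]scalerA mulnC.
by rewrite -[in RHS]scalerA; congr (_ *: _); apply: mulrAC.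
Qed.
End KoszulCalculus.

(** * Algebras generated by a rack and its exterior letters *)
Section Generated.
Variables (k : comPzRingType) (R : kalgType k) (deg : nat -> set R).
Variables (X : rackType) (u e : X -> R).
Notation word := (seq (X + X)).

Definition letter (g : X + X) : R := match g with inl x => u x | inr x => e x end.
Definition mon (w : word) : R := foldr (fun g a => letter g ** a) kone w.
Definition cnt (w : word) : nat :=
  count (fun g : X + X => if g is inr _ then true else false) w.

(** The properties shared by [B] and its quotient by the squares: letters
    x in degree 0 and e_x in degree 1 that satisfy the defining relations, with
    each degree spanned by the words having that many letters e_x. *)
Record rack_gens : Prop := {
  gens_graded : is_graded deg;
  deg_x : forall x, deg 0 (u x);
  deg_e : forall x, deg 1 (e x);
  rel_xx : forall x y, u y ** u (x ◁ y) = u x ** u y;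
  rel_xe : forall x y, u y ** e (x ◁ y) = e x ** u y;
  deg_mon : forall n b, deg n b ->
    span [set a | exists w, cnt w = n /\ a = mon w] b
}.

Hypothesis G : rack_gens.
Notation gr := (gens_graded G).
Notation m := (koszul_mul deg).
Notation sg := (gsign deg).
Notation tsg := (tsign deg).
Notation flip := (koszul_flip deg).
Notation one := (kone : R).

Lemma mon_eq (V : lmodType k) (f g : R -> V) : linear f -> linear g ->
  (forall w, f (mon w) = g (mon w)) -> f =1 g.
Proof.
move=> lf lg E; apply: (graded_eq gr) => // n b /(deg_mon G).
by apply: span_eq => // _ [w [_ ->]].
Qed.

(** The induction principle behind all identities below: words are built by left
    multiplication by letters. *)
Lemma gen_eq (V : lmodType k) (f g : R -> V) : linear f -> linear g ->
  f one = g one ->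
  (forall x b, f b = g b -> f (u x ** b) = g (u x ** b)) ->
  (forall x b, f b = g b -> f (e x ** b) = g (e x ** b)) -> f =1 g.
Proof.
move=> lf lg f1 fx fe; apply: mon_eq => //.
by elim=> [//|[x|x] w IH] /=; [apply: fx|apply: fe].
Qed.

Lemma mon_cat v w : mon (v ++ w) = mon v ** mon w.
Proof. by elim: v => [|g v IH] /=; rewrite ?kmul1l // IH kmulA. Qed.

Lemma e_xs x (l : seq X) : exists y,
  e x ** mon (map inl l) = mon (map inl l) ** e y.
Proof.
elim: l x => [|z l IH] x /=; first by exists x; rewrite kmul1l kmul1r.
by rewrite kmulA -(rel_xe G) -kmulA; have [y ->] := IH (x ◁ z); exists y; rewrite kmulA.
Qed.

(** The relation e_x y = y e_(x^y) moves every letter y to the left. *)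
Lemma normal_form w : exists l s, mon w = mon (map inl l) ** mon (map inr s).
Proof.
elim: w => [|[x|x] w [l [s IH]]] /=; rewrite ?IH.
- by exists [::], [::]; rewrite kmul1l.
- by exists (x :: l), s; rewrite /= kmulA.
- by have [y E] := e_xs x l; exists l, (y :: s); rewrite kmulA E -kmulA.
Qed.

(** By the normal form, maps that are linear over the subalgebra A generated by
    the letters x are determined by the monomials in the letters e_x. *)
Lemma xlin_eq (V : lmodType k) (f g : R -> V) : linear f -> linear g ->
  (forall s, f (mon (map inr s)) = g (mon (map inr s))) ->
  (forall x b, f b = g b -> f (u x ** b) = g (u x ** b)) -> f =1 g.
Proof.
move=> lf lg fs fx; apply: mon_eq => // w; have [l [s ->]] := normal_form w.
elim: l => [|x l IH] /=; first by rewrite kmul1l.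
by rewrite -kmulA; apply: fx.
Qed.

Lemma mon_deg w : deg (cnt w) (mon w).
Proof.
elim: w => [|[y|y] v IHv] /=; first exact: (deg_one gr).
  exact: (deg_mul gr (deg_x G y) IHv).
exact: (deg_mul gr (deg_e G y) IHv).
Qed.

Lemma gsign_x x : sg (u x) = u x.
Proof. by rewrite (gsignE gr (deg_x G x)) scale1r. Qed.
Lemma gsign_e x : sg (e x) = - e x.
Proof. by rewrite (gsignE gr (deg_e G x)) expr1 scaleN1r. Qed.

Lemma km_x x a c d : m (a ⊗ u x) (c ⊗ d) = (a ** c) ⊗ (u x ** d).
Proof. exact: (kmEl gr _ _ _ (deg_x G x)). Qed.
Lemma km_e x a c d : m (a ⊗ e x) (c ⊗ d) = (a ** sg c) ⊗ (e x ** d).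
Proof. exact: (kmEl gr _ _ _ (deg_e G x)). Qed.
Lemma km_one a c d : m (a ⊗ one) (c ⊗ d) = (a ** c) ⊗ d.
Proof. by rewrite (kmEl gr _ _ _ (deg_one gr)) kmul1l. Qed.
Lemma kmDl s t v : m (s + t) v = m s v + m t v. Proof. exact: (linD (lin_kml gr v)). Qed.
Lemma kmDr s t v : m v (s + t) = m v s + m v t. Proof. exact: (linD (lin_kmr gr v)). Qed.
Lemma kmNl s v : m (- s) v = - m s v. Proof. exact: (linN (lin_kml gr v)). Qed.
Lemma kmNr s v : m v (- s) = - m v s. Proof. exact: (linN (lin_kmr gr v)). Qed.
Lemma km0l v : m 0 v = 0. Proof. exact: (lin0 (lin_kml gr v)). Qed.
Lemma km0r v : m v 0 = 0. Proof. exact: (lin0 (lin_kmr gr v)). Qed.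

(** The prescribed values of the comultiplication on the letters x and e_x. *)
Definition Dx x := u x ⊗ u x.
Definition De x := e x ⊗ u x + one ⊗ e x.

Lemma Dx_x x y : m (Dx y) (Dx (x ◁ y)) = m (Dx x) (Dx y).
Proof. by rewrite !km_x (rel_xx G). Qed.
Lemma Dx_e x y : m (Dx y) (De (x ◁ y)) = m (De x) (Dx y).
Proof.
by rewrite kmDr kmDl !km_x km_e gsign_x (rel_xx G) (rel_xe G) kmul1l kmul1r.
Qed.
Lemma km_De x a b : m (De x) (a ⊗ b) = e x ** a ⊗ (u x ** b) + sg a ⊗ (e x ** b).
Proof. by rewrite kmDl km_x km_e kmul1l. Qed.
(** The mixed terms are e_x (x) x e_x and, with the sign from exchanging two odd
    factors, - e_x (x) e_x x; they cancel when x and e_x commute. *)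
Lemma De_sqr x : u x ** e x = e x ** u x ->
  m (De x) (De x) = e x ** e x ⊗ (u x ** u x) + one ⊗ (e x ** e x).
Proof.
move=> ux; rewrite kmDr !km_De gsign_e (gsign1 gr) kmul1r ux ptensNl.
by rewrite -addrA addKr.
Qed.

Section Comul.
Variable D : R -> R ⊗ R.
Record is_comul : Prop := {
  lin_comul : linear D;
  comul1 : D one = one ⊗ one;
  comulM : forall a b, D (a ** b) = m (D a) (D b);
  comul_x : forall x, D (u x) = Dx x;
  comul_e : forall x, D (e x) = De x
}.
Hypothesis H : is_comul.

Lemma tsign_comul_x x : tsg (Dx x) = Dx x.
Proof. by rewrite (tsignE gr) gsign_x. Qed.
Lemma tsign_comul_e x : tsg (De x) = - De x.
Proof.
rewrite (linD (lin_tsign gr)) !(tsignE gr) gsign_x gsign_e (gsign1 gr).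
by rewrite ptensNl ptensNr opprD.
Qed.

Lemma comul_gsign b : D (sg b) = tsg (D b).
Proof.
have lc := lin_comul H; have ls := lin_gsign gr; have lt := lin_tsign gr.
move: b; apply: gen_eq; try exact: lin_comp.
- by rewrite (gsign1 gr) (comul1 H) (tsignE gr) (gsign1 gr).
- move=> x b IH; rewrite (gsignM gr) !(comulM H) (tsignM gr) IH gsign_x.
  by rewrite (comul_x H) tsign_comul_x.
- move=> x b IH; rewrite (gsignM gr) !(comulM H) (tsignM gr) IH gsign_e.
  by rewrite (linN lc) (comul_e H) tsign_comul_e.
Qed.

Lemma comul_deg n b : deg n b -> tens_deg deg n (D b).
Proof.
move/(deg_mon G); apply: (span_image (lin_comul H)) => _ [w [<- ->]].
elim: w => [|[x|x] w IH] /=.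
- by rewrite (comul1 H); apply: (tens_deg_pure (deg_one gr) (deg_one gr)).
- rewrite (comulM H) (comul_x H); apply: (tens_deg_mul gr (i := 0)) => //.
  exact: (tens_deg_pure (deg_x G x) (deg_x G x)).
- rewrite (comulM H) (comul_e H); apply: (tens_deg_mul gr (i := 1)) => //.
  apply: spanD; first exact: (tens_deg_pure (deg_e G x) (deg_x G x)).
  exact: (tens_deg_pure (deg_one gr) (deg_e G x)).
Qed.

(** Both sides turn left multiplication of b by a letter g into the action of the
    iterated comultiplication of g on the triple tensor product: multiplication
    by x (x) x (x) x, respectively by
    e_x (x) x (x) x + 1 (x) e_x (x) x + 1 (x) 1 (x) e_x with Koszul signs. *)
Lemma comul_coassociative b : tassoc (tmap D id (D b)) = tmap id D (D b).
Proof.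
have lc := lin_comul H; have lid := @lin_id k R; have la := @lin_tassoc k R R R.
have ls := lin_gsign gr; have lt := lin_tsign gr.
have ll := lin_tmap lc lid; have lr := lin_tmap lid lc.
have kr := @lin_kmulr k R; have krt := lin_kmr gr.
move: b; apply: gen_eq => [|||x b IH|x b IH].
- exact: (lin_comp lc (lin_comp ll la)).
- exact: (lin_comp lc lr).
- by rewrite !(comul1 H) !tmapE // (comul1 H) tassocE.
(* [L] multiplies by the iterated comultiplication of x. *)
- pose L : (R ⊗ (R ⊗ R) -> R ⊗ (R ⊗ R))%type :=
    tmap (fun a => u x ** a) (m (Dx x)).
  have lL : linear L by apply: lin_tmap.
  rewrite (comulM H) (comul_x H).
  have L1 t : tassoc (tmap D id (m (Dx x) t)) = L (tassoc (tmap D id t)).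
    move: t; apply: tens_eq => [||a c].
    + exact: (lin_comp (krt _) (lin_comp ll la)).
    + exact: (lin_comp ll (lin_comp la lL)).
    rewrite km_x !tmapE // (comulM H) (comul_x H).
    move: (D a); apply: tens_eq => [||a1 a2].
    + exact: (lin_comp (krt _) (lin_comp (@lin_ptensl _ _ _ _) la)).
    + exact: (lin_comp (@lin_ptensl _ _ _ _) (lin_comp la lL)).
    by rewrite km_x !tassocE /L tmapE // km_x.
  have L2 t : tmap id D (m (Dx x) t) = L (tmap id D t).
    move: t; apply: tens_eq => [||a c].
    + exact: (lin_comp (krt _) lr).
    + exact: (lin_comp lr lL).
    by rewrite km_x !tmapE // (comulM H) (comul_x H) /L tmapE.
  by rewrite L1 L2 IH.
(* [L] multiplies by the iterated comultiplication of e_x; in the second summand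
   the odd letter has passed the first tensor factor, whence the sign. *)
- pose L : (R ⊗ (R ⊗ R) -> R ⊗ (R ⊗ R))%type :=
    fun t => tmap (fun a => e x ** a) (m (Dx x)) t + tmap sg (m (De x)) t.
  have lL : linear L by apply: lin_add; apply: lin_tmap.
  rewrite (comulM H) (comul_e H).
  have L1 t : tassoc (tmap D id (m (De x) t)) = L (tassoc (tmap D id t)).
    move: t; apply: tens_eq => [||a c].
    + exact: (lin_comp (krt _) (lin_comp ll la)).
    + exact: (lin_comp ll (lin_comp la lL)).
    rewrite km_De (linD ll) !tmapE // (comulM H) (comul_e H) comul_gsign.
    move: (D a); apply: tens_eq => [||a1 a2].
    + apply: (lin_comp _ la); apply: lin_add.
        exact: (lin_comp (krt _) (@lin_ptensl _ _ _ _)).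
      exact: (lin_comp lt (@lin_ptensl _ _ _ _)).
    + exact: (lin_comp (@lin_ptensl _ _ _ _) (lin_comp la lL)).
    rewrite km_De (tsignE gr) ptensDl !(linD la) !tassocE /L !tmapE // km_x km_De.
    by rewrite ptensDr addrA.
  have L2 t : tmap id D (m (De x) t) = L (tmap id D t).
    move: t; apply: tens_eq => [||a c].
    + exact: (lin_comp (krt _) lr).
    + exact: (lin_comp lr lL).
    by rewrite km_De (linD lr) !tmapE // !(comulM H) (comul_x H) (comul_e H) /L !tmapE.
  by rewrite L1 L2 IH.
Qed.
End Comul.

Section Counit.
Variable eps : R -> k^o.
Record is_counit : Prop := {
  lin_counit : linear eps;
  counit1 : eps one = 1;
  counitM : forall a b, eps (a ** b) = eps a * eps b;
  counit_x : forall x, eps (u x) = 1;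
  counit_e : forall x, eps (e x) = 0
}.
Hypothesis E : is_counit.
Variable D : R -> R ⊗ R.
Hypothesis H : is_comul D.

Lemma bilin_counitl : bilin (fun a c : R => (eps a : k) *: c).
Proof.
split=> [c|a] z v w; last by rewrite scalerDr !scalerA mulrC.
by rewrite (lin_counit E) scalerDl; congr (_ + _); apply/esym/scalerA.
Qed.
Lemma bilin_counitr : bilin (fun a c : R => (eps c : k) *: a).
Proof.
split=> [c|a] z v w; first by rewrite scalerDr !scalerA mulrC.
by rewrite (lin_counit E) scalerDl; congr (_ + _); apply/esym/scalerA.
Qed.

Lemma counit_gsign b : eps (sg b) = eps b.
Proof.
have ls := lin_gsign gr; have le := lin_counit E.
move: b; apply: gen_eq => // [||x b IH|x b IH]; first exact: lin_comp.
- by rewrite (gsign1 gr).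
- by rewrite (gsignM gr) !(counitM E) gsign_x IH.
- by rewrite (gsignM gr) !(counitM E) gsign_e (linN le) (counit_e E) oppr0 !mul0r.
Qed.

Lemma counit_deg n b : n <> 0%N -> deg n b -> eps b = 0.
Proof.
move=> n0 /(deg_mon G).
apply: (span_eq (lin_counit E) (@lin_zero _ _ _)) => _ [w [wn ->]].
elim: w n n0 wn => [|[x|x] w IH] n n0 /=; rewrite ?(counitM E).
- by move=> n0'; case: n0.
- by move=> wn; rewrite (IH _ n0 wn) mulr0.
- by rewrite (counit_e E) mul0r.
Qed.

Lemma counit_left b : tlift (fun a c => (eps a : k) *: c) (D b) = b.
Proof.
have bb := bilin_counitl; have lt := tlift_is_linear bb.
move: b; apply: gen_eq => [|||x b IH|x b IH].
- exact: lin_comp (lin_comul H) lt.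
- exact: lin_id.
- by rewrite (comul1 H) (tliftE bb) (counit1 E) scale1r.
- rewrite (comulM H) (comul_x H) -[in RHS]IH; move: (D b); apply: tens_eq => [||a c].
  + exact: lin_comp (lin_kmr gr _) lt.
  + exact: lin_comp lt (@lin_kmulr _ _ _).
  by rewrite km_x !(tliftE bb) (counitM E) (counit_x E) mul1r kmulZr.
- rewrite (comulM H) (comul_e H) -[in RHS]IH; move: (D b); apply: tens_eq => [||a c].
  + exact: lin_comp (lin_kmr gr _) lt.
  + exact: lin_comp lt (@lin_kmulr _ _ _).
  rewrite km_De (linD lt) !(tliftE bb) (counitM E) (counit_e E) mul0r scale0r add0r.
  by rewrite counit_gsign kmulZr.
Qed.

Lemma counit_right b : tlift (fun a c => (eps c : k) *: a) (D b) = b.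
Proof.
have bb := bilin_counitr; have lt := tlift_is_linear bb.
move: b; apply: gen_eq => [|||x b IH|x b IH].
- exact: lin_comp (lin_comul H) lt.
- exact: lin_id.
- by rewrite (comul1 H) (tliftE bb) (counit1 E) scale1r.
- rewrite (comulM H) (comul_x H) -[in RHS]IH; move: (D b); apply: tens_eq => [||a c].
  + exact: lin_comp (lin_kmr gr _) lt.
  + exact: lin_comp lt (@lin_kmulr _ _ _).
  by rewrite km_x !(tliftE bb) (counitM E) (counit_x E) mul1r kmulZr.
- rewrite (comulM H) (comul_e H) -[in RHS]IH; move: (D b); apply: tens_eq => [||a c].
  + exact: lin_comp (lin_kmr gr _) lt.
  + exact: lin_comp lt (@lin_kmulr _ _ _).
  rewrite km_De (linD lt) !(tliftE bb) !(counitM E) (counit_e E) (counit_x E).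
  by rewrite mul0r scale0r addr0 mul1r kmulZr.
Qed.

Lemma comul_coalgebra : is_coalgebra D eps.
Proof.
split; [exact: lin_comul|exact: lin_counit|exact: comul_coassociative|
  exact: counit_left|exact: counit_right].
Qed.
End Counit.

Section Differential.
Variable d : R -> R.
Record is_bdiff : Prop := {
  lin_bdiff : linear d;
  bdiffM : forall a b, d (a ** b) = d a ** b + sg a ** d b;
  bdiff_x : forall x, d (u x) = 0;
  bdiff_e : forall x, d (e x) = u x - one
}.
Hypothesis I : is_bdiff.

Lemma bdiff1 : d one = 0.
Proof.
have := bdiffM I one one; rewrite (gsign1 gr) !kmul1l !kmul1r => /eqP.
by rewrite eq_sym -subr_eq0 addrK => /eqP.
Qed.

Lemma bdiff_anti b : sg (d b) = - d (sg b).
Proof.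
have ld := lin_bdiff I; have ls := lin_gsign gr.
move: b; apply: gen_eq.
- exact: lin_comp.
- exact: lin_opp (lin_comp ls ld).
- by rewrite bdiff1 (gsign1 gr) bdiff1 (lin0 ls) oppr0.
- move=> x b IH; rewrite (gsignM gr) gsign_x !(bdiffM I) gsign_x !(bdiff_x I).
  rewrite !kmul0l !add0r.
  by rewrite (gsignM gr) IH gsign_x kmulNr.
- move=> x b IH; rewrite (gsignM gr) gsign_e !(bdiffM I) (linN ls) !(linN ld) gsign_e.
  rewrite opprK (bdiff_e I) (linD ls) !(gsignM gr) IH (linB ls) gsign_x (gsign1 gr).
  by rewrite (linN ls) gsign_e opprK !kmulNl !kmulNr opprD opprK.
Qed.

Lemma bdiffK b : d (d b) = 0.
Proof.
have ld := lin_bdiff I.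
move: b; apply: gen_eq => [|||x b IH|x b IH].
- exact: lin_comp.
- exact: lin_zero.
- by rewrite bdiff1 (lin0 ld).
- by rewrite !(bdiffM I, bdiff_x I, kmul0l, add0r, gsign_x) IH kmul0r.
- rewrite (bdiffM I) (bdiff_e I) gsign_e (linD ld) !(bdiffM I) IH kmul0r addr0.
  rewrite (linB ld) (bdiff_x I) bdiff1 subr0 kmul0l add0r (linB (lin_gsign gr)).
  by rewrite gsign_x (gsign1 gr) (linN ld) (bdiff_e I) kmulNl subrr.
Qed.

Variable D : R -> R ⊗ R.
Hypothesis H : is_comul D.

Lemma kdiff_one : koszul_diff deg d (one ⊗ one) = 0.
Proof. by rewrite (kdiffE gr (lin_bdiff I)) bdiff1 ptens0l ptens0r addr0. Qed.
Lemma kdiff_Dx x : koszul_diff deg d (Dx x) = 0.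
Proof. by rewrite (kdiffE gr (lin_bdiff I)) (bdiff_x I) ptens0l ptens0r addr0. Qed.
Lemma kdiff_De x : koszul_diff deg d (De x) = Dx x - one ⊗ one.
Proof.
have ld := lin_bdiff I; rewrite (linD (lin_kdiff gr ld)) !(kdiffE gr ld).
rewrite (bdiff_e I) (bdiff_x I) bdiff1 ptens0l ptens0r addr0 add0r (gsign1 gr).
by rewrite ptensBl ptensBr addrA subrK.
Qed.

Definition kdiff_leib := kdiffM gr (lin_bdiff I) bdiff_anti (bdiffM I).

(** The case of degree 0 is needed along with the others, since the derivative of
    e_x w involves the derivative of w. *)
Lemma bdiff_mon_deg w : (cnt w = 0%N -> d (mon w) = 0) /\
  forall n, cnt w = n.+1 -> deg n (d (mon w)).
Proof.
elim: w => [|[x|x] w [IH0 IH]] /=; first by rewrite bdiff1.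
  rewrite (bdiffM I) (bdiff_x I) kmul0l add0r gsign_x.
  split=> [/IH0->|n /IH dn]; first by rewrite kmul0r.
  exact: (deg_mul gr (deg_x G x)).
split=> // n [wn]; rewrite (bdiffM I) (bdiff_e I) gsign_e.
apply: (deg_span gr); apply: spanD; apply: span_gen.
  rewrite -wn; apply: (deg_mul gr (p := 0)) (mon_deg w).
  apply: (deg_span gr); apply: spanB; apply: span_gen; first exact: (deg_x G).
  exact: (deg_one gr).
case: n wn => [/IH0->|n /IH dn]; first by rewrite kmul0r; apply: (deg0 gr).
rewrite kmulNl -scaleN1r; apply: (degZ gr).
exact: (deg_mul gr (deg_e G x) dn).
Qed.

Lemma bdiff_deg n b : deg n.+1 b -> deg n (d b).
Proof.
move=> /(deg_mon G) db; apply: (deg_span gr).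
apply: (span_image (lin_bdiff I)) db => _ [w [wn ->]].
by apply: span_gen; apply: (bdiff_mon_deg w).2.
Qed.

Lemma bdiff_deg0 b : deg 0 b -> d b = 0.
Proof.
move=> /(deg_mon G); apply: (span_eq (lin_bdiff I) (@lin_zero _ _ _)).
by move=> _ [w [wn ->]]; apply: (bdiff_mon_deg w).1.
Qed.

Lemma bdiff_mon x0 s : d (mon (map inr s)) = \sum_(0 <= i < size s) (-1) ^+ i *:
  (mon (map inr (take i s)) ** (u (nth x0 s i) - one) ** mon (map inr (drop i.+1 s))).
Proof.
elim: s => [|x s IH] /=; first by rewrite big_geq ?bdiff1.
rewrite (bdiffM I) big_nat_recl //= expr0 scale1r kmul1l drop0 (bdiff_e I).
congr (_ + _); rewrite IH gsign_e kmulNl (lin_sum (@lin_kmulr _ _ _)) -sumrN.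
apply: eq_bigr => i _; rewrite kmulZr exprS mulN1r scaleNr.
by congr (- (_ *: _)); rewrite !kmulA.
Qed.

Lemma mon_e_x s y : mon (map inr s) ** u y = u y ** mon (map inr [seq z ◁ y | z <- s]).
Proof.
elim: s => [|z s IH] /=; first by rewrite kmul1l kmul1r.
by rewrite -kmulA IH !kmulA (rel_xe G).
Qed.

(** For a form invariant under the letters x, the i-th term of d(e_{x_1} ... e_{x_n})
    contributes the two i-th faces of the rack complex: the summand x_i of
    d(e_{x_i}) moves to the front and acts on the preceding indices, and the
    summand - 1 deletes e_{x_i}. *)
Lemma xinv_bdiff_mon (F : R -> k^o) x0 s : linear F ->
  (forall x b, F (u x ** b) = F b) ->
  F (d (mon (map inr s))) = \sum_(0 <= i < size s) (-1) ^+ i *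
    (F (mon (map inr ([seq z ◁ nth x0 s i | z <- take i s] ++ drop i.+1 s)))
     - F (mon (map inr (take i s ++ drop i.+1 s)))).
Proof.
move=> lF Fx; rewrite (bdiff_mon x0) (lin_sum lF); apply: eq_bigr => i _.
rewrite (linZ lF) kmulDr kmulDl kmulNr kmulNl kmul1r mon_e_x (linB lF) -kmulA Fx.
by rewrite -!mon_cat -!map_cat.
Qed.

(** Both sides are derivations along the comultiplication, and they agree on
    the letters. *)
Lemma comul_diff b : D (d b) = koszul_diff deg d (D b).
Proof.
have ld := lin_bdiff I; have lc := lin_comul H; have lD := lin_kdiff gr ld.
move: b; apply: gen_eq; try exact: lin_comp.
- by rewrite bdiff1 (comul1 H) (lin0 lc) kdiff_one.
- move=> x b IH; rewrite (bdiffM I) (bdiff_x I) kmul0l add0r gsign_x !(comulM H).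
  by rewrite kdiff_leib (comul_x H) tsign_comul_x IH kdiff_Dx km0l add0r.
- move=> x b IH; rewrite (bdiffM I) (linD lc) !(comulM H) kdiff_leib.
  rewrite -IH (comul_gsign H) (bdiff_e I) (comul_e H) kdiff_De.
  by rewrite (linB lc) (comul_x H) (comul1 H).
Qed.

Variable h : R -> R ⊗ R.
(** The skew Leibniz rule replaces the explicit formula for h: it makes sense on
    all products, so identities can be checked on letters. *)
Record is_homotopy : Prop := {
  lin_h : linear h;
  h_skew : forall a b, h (a ** b) = m (h a) (D b) + m (flip (D (sg a))) (h b);
  h_x : forall x, h (u x) = 0;
  h_e : forall x, h (e x) = e x ⊗ e x
}.
Hypothesis K : is_homotopy.

Lemma flip_one : flip (one ⊗ one) = one ⊗ one.
Proof. by rewrite (flipE gr (deg_one gr) (deg_one gr)) scale1r. Qed.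
Lemma flip_Dx x : flip (Dx x) = Dx x.
Proof. by rewrite (flipE gr (deg_x G x) (deg_x G x)) scale1r. Qed.
Lemma flip_De x : flip (De x) = u x ⊗ e x + e x ⊗ one.
Proof.
rewrite (linD (lin_flip gr)) (flipE gr (deg_e G x) (deg_x G x)).
by rewrite (flipE gr (deg_one gr) (deg_e G x)) !scale1r.
Qed.

Lemma h_one : h one = 0.
Proof.
have := h_skew K one one; rewrite (gsign1 gr) (comul1 H) flip_one kmul1l.
by rewrite (km_1l gr) (km_1r gr) => /eqP; rewrite eq_sym -subr_eq0 addrK => /eqP.
Qed.

Lemma h_mulx x b : h (u x ** b) = m (Dx x) (h b).
Proof. by rewrite (h_skew K) (h_x K) km0l add0r gsign_x (comul_x H) flip_Dx. Qed.
Lemma h_mule x b :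
  h (e x ** b) = m (e x ⊗ e x) (D b) - m (flip (De x)) (h b).
Proof.
rewrite (h_skew K) (h_e K) gsign_e (linN (lin_comul H)) (comul_e H).
by rewrite (linN (lin_flip gr)) kmNl.
Qed.

(** The form in which h is seen to map squares into the kernel of the projection
    to the quotient by the squares. *)
Lemma h_sqr x : h (e x ** e x)
  = (e x ⊗ (e x ** e x) - e x ** e x ⊗ (e x ** u x))
    - (e x ** e x ⊗ e x - u x ** e x ⊗ (e x ** e x)).
Proof.
rewrite h_mule (comul_e H) (h_e K) flip_De kmDr !kmDl !km_e km_one gsign_e (gsign1 gr).
by rewrite !kmulNr !ptensNl kmul1r; congr (_ - _); apply: addrC.
Qed.

Lemma km_Dx x t : m (Dx x) t = tmap (kmul (u x)) (kmul (u x)) t.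
Proof.
move: t; apply: tens_eq => [||a b]; first exact: lin_kmr gr _.
  by apply: lin_tmap; apply: lin_kmulr.
by rewrite km_x tmapE //; apply: lin_kmulr.
Qed.

Local Notation tprod l := (\big[m/one ⊗ one]_(t <- l) t).

(** The description of h by A-linearity and the alternating sum on monomials in
    the letters e_x. *)
Record is_hmap (g : R -> R ⊗ R) : Prop := {
  lin_hmap : linear g;
  hmap_x : forall x b, g (u x ** b) = tmap (kmul (u x)) (kmul (u x)) (g b);
  hmap1 : g one = 0;
  hmap_e : forall x, g (e x) = e x ⊗ e x;
  hmap_mon : forall n (s : n.-tuple X), g (mon (map inr s)) =
    \sum_(i < n) (-1) ^+ i *:
      m (m (tprod [seq flip (D (e x)) | x <- take i s]) (g (e (tnth s i))))
        (tprod [seq D (e x) | x <- drop i.+1 s])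
}.

Lemma comul_mon s : D (mon (map inr s)) = tprod [seq D (e x) | x <- s].
Proof.
elim: s => [|x s IH] /=; first by rewrite big_nil (comul1 H).
by rewrite big_cons (comulM H) IH.
Qed.

(** The i-th term arises when the skew Leibniz rule applies h to the i-th letter:
    the letters before it contribute flipped comultiplications and the sign,
    those after it comultiplications. *)
Lemma h_mon x0 s : h (mon (map inr s)) =
  \sum_(0 <= i < size s) (-1) ^+ i *:
    m (m (tprod [seq flip (D (e x)) | x <- take i s])
         (e (nth x0 s i) ⊗ e (nth x0 s i)))
      (tprod [seq D (e x) | x <- drop i.+1 s]).
Proof.
elim: s => [|x s IH] /=; first by rewrite h_one big_geq.
rewrite h_mule comul_mon big_nat_recl //= expr0 scale1r big_nil (km_1l gr) drop0.
congr (_ + _); rewrite IH -kmNl (lin_sum (lin_kmr gr _)); apply: eq_bigr => i _.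
rewrite (linZ (lin_kmr gr _)) big_cons (comul_e H) !(kmA gr) exprS mulN1r scaleNr.
by rewrite !kmNl scalerN.
Qed.

Lemma homotopy_hmap : is_hmap h.
Proof.
split; [exact: lin_h| |exact: h_one|exact: h_e|].
  by move=> x b; rewrite h_mulx km_Dx.
move=> n s; have [x0] := @rack_inhabited X.
rewrite (h_mon x0) size_tuple big_mkord; apply: eq_bigr => i _.
by rewrite (h_e K) (tnth_nth x0).
Qed.

Lemma hmap_homotopy g : is_hmap g -> g =1 h.
Proof.
move=> Hg; apply: xlin_eq; [exact: lin_hmap|exact: lin_h| |].
  move=> s; have := hmap_mon Hg (in_tuple s); rewrite /= => ->.
  rewrite [RHS](hmap_mon homotopy_hmap (in_tuple s)); apply: eq_bigr => i _.
  by rewrite (hmap_e Hg) (h_e K).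
by move=> x b E; rewrite (hmap_x Hg) E h_mulx km_Dx.
Qed.

Lemma h_deg n b : deg n b -> tens_deg deg n.+1 (h b).
Proof.
move/(deg_mon G); apply: (span_image (lin_h K)) => _ [w [<- ->]].
elim: w => [|[x|x] w IH] /=.
- by rewrite h_one; apply: span0.
- rewrite h_mulx; apply: (tens_deg_mul gr (i := 0)) => //.
  exact: (tens_deg_pure (deg_x G x) (deg_x G x)).
- rewrite h_mule; apply: spanB.
    apply: (tens_deg_mul gr (i := 2)); last exact: (comul_deg H (mon_deg w)).
    exact: (tens_deg_pure (deg_e G x) (deg_e G x)).
  apply: (tens_deg_mul gr (i := 1)) => //; rewrite flip_De; apply: spanD.
    exact: (tens_deg_pure (deg_x G x) (deg_e G x)).
  exact: (tens_deg_pure (deg_e G x) (deg_one gr)).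
Qed.

(** Write K for the left-hand side. The cross terms cancel in
    K(gb) = K(g) D(b) + flip (D g) K(b), and flip D - D satisfies the same rule
    because D and flip D are multiplicative; so it is enough that both agree on
    letters, which for e_x is the formula [ee] in the proof. *)
Lemma homotopy b :
  koszul_diff deg d (h b) + h (d b) = flip (D b) - D b.
Proof.
have ld := lin_bdiff I; have lc := lin_comul H; have lD := lin_kdiff gr ld.
have lh := lin_h K; have lf := lin_flip gr.
move: b; apply: gen_eq => [|||x b IH|x b IH].
- exact: lin_add (lin_comp lh lD) (lin_comp ld lh).
- exact: lin_sub (lin_comp lc lf) lc.
- by rewrite h_one bdiff1 (lin0 lD) (lin0 lh) addr0 (comul1 H) flip_one subrr.
- rewrite h_mulx kdiff_leib kdiff_Dx km0l add0r tsign_comul_x.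
  rewrite (bdiffM I) (bdiff_x I) kmul0l add0r gsign_x h_mulx -kmDr IH.
  by rewrite (comulM H) (comul_x H) (flipM gr) flip_Dx kmDr kmNr.
(* [ee] is the homotopy identity at e_x. *)
- have ee : koszul_diff deg d (e x ⊗ e x) = flip (De x) - De x.
    rewrite (kdiffE gr ld) (bdiff_e I) gsign_e flip_De ptensBl ptensNl ptensBr.
    by rewrite opprB opprD -!addrA; congr (_ + _); rewrite addrC -addrA.
  have te : tsg (e x ⊗ e x) = e x ⊗ e x.
    by rewrite (tsignE gr) gsign_e ptensNl ptensNr opprK.
  rewrite h_mule (linB lD) !kdiff_leib -(comul_diff b) ee te.
  rewrite -(kdiff_flip gr ld bdiff_anti) kdiff_De (linB lf) flip_Dx flip_one.
  rewrite -(flip_tsign gr) tsign_comul_e (linN lf) kmNl.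
  rewrite (bdiffM I) (bdiff_e I) gsign_e kmulDl !kmulNl kmul1l (linB lh) (linB lh).
  rewrite h_mulx h_mule !kmDl !kmNl (km_1l gr) (comulM H) (comul_e H) (flipM gr).
  have := congr1 (m (flip (De x))) IH; rewrite !kmDr kmNr.
  (* What remains is an identity between sums in an abelian group. *)
  move: (m (Dx x) (h b) - h b) => w; move: (m (e x ⊗ e x) _) => q.
  move/(congr1 (+%R^~ (m (flip (De x)) (D b)))); rewrite subrK => <-.
  rewrite (opprB w) (opprB q) !addrA subrK.
  rewrite [X in X + _ - q]addrAC [X in X - q]addrAC addrK.
  by rewrite -addrA addrC addrA.
Qed.

End Differential.

Lemma bdiff_rel_xe x y :
  0 ** e (x ◁ y) + sg (u y) ** (u (x ◁ y) - one) = (u x - one) ** u y + sg (e x) ** 0.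
Proof.
rewrite kmul0l kmul0r add0r addr0 gsign_x kmulDr kmulDl kmulNl kmulNr (rel_xx G).
by rewrite kmul1l kmul1r.
Qed.

Lemma homotopy_rel_xe D : is_comul D -> forall x y,
  m 0 (D (e (x ◁ y))) + m (flip (D (sg (u y)))) (e (x ◁ y) ⊗ e (x ◁ y))
  = m (e x ⊗ e x) (D (u y)) + m (flip (D (sg (e x)))) 0.
Proof.
move=> H x y; rewrite km0l km0r add0r addr0 gsign_x (comul_x H) flip_Dx km_x km_e.
by rewrite gsign_x (rel_xe G).
Qed.

(** The next lemmas translate between maps into the module underlying the tensor
    square and maps into the algebra [ktens], which is the target when morphisms
    and skew derivations out of [B] are constructed. *)
Lemma ktens_comul (D : R -> ktens gr) : linear D -> D kone = kone ->
  (forall a b, D (a ** b) = D a ** D b) -> (forall x, D (u x) = Dx x) ->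
  (forall x, D (e x) = De x) -> is_comul D.
Proof. by move=> l d1 dM dx de; split. Qed.

Lemma ktens_homotopy D (h phi psi : R -> ktens gr) : phi = D ->
  psi = (fun a => flip (D (sg a))) -> linear h ->
  (forall a b, h (a ** b) = h a ** phi b + psi a ** h b) ->
  (forall x, h (u x) = 0) -> (forall x, h (e x) = e x ⊗ e x) -> is_homotopy D h.
Proof. by move=> -> -> l hM hx he; split. Qed.

Lemma ktens_lin (f : R -> R ⊗ R) : linear f -> linear (f : R -> ktens gr).
Proof. by []. Qed.

Lemma ktens_homotopy_rel_xe D : is_comul D -> forall x y,
  (0 : ktens gr) ** D (e (x ◁ y))
    + (flip (D (sg (u y))) : ktens gr) ** (e (x ◁ y) ⊗ e (x ◁ y))
  = ((e x ⊗ e x) : ktens gr) ** D (u y) + (flip (D (sg (e x))) : ktens gr) ** 0.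
Proof. exact: homotopy_rel_xe. Qed.

Lemma ktens_flip_comul D : is_comul D ->
  let psi : R -> ktens gr := fun a => flip (D (sg a)) in
  [/\ linear psi, psi kone = kone & forall a b, psi (a ** b) = psi a ** psi b].
Proof.
move=> H psi; split.
- exact: lin_comp (lin_gsign gr) (lin_comp (lin_comul H) (lin_flip gr)).
- by rewrite /psi (gsign1 gr) (comul1 H) flip_one.
- by move=> a b; rewrite /psi (gsignM gr) (comulM H) (flipM gr).
Qed.

End Generated.

(** * Naturality of the signed operations *)
Section GradedMorphism.
Variables (k : comPzRingType) (R R' : kalgType k).
Variables (deg : nat -> set R) (deg' : nat -> set R').
Hypotheses (gr : is_graded deg) (gr' : is_graded deg').
Variable f : R -> R'.
Hypotheses (lf : linear f) (fM : forall a b, f (a ** b) = f a ** f b).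
Hypothesis fdeg : forall n a, deg n a -> deg' n (f a).
Local Notation F := (tmap f f).

Lemma morph_gsign a : f (gsign deg a) = gsign deg' (f a).
Proof.
move: a; apply: (graded_eq gr) => [||n a da].
- exact: lin_comp (lin_gsign gr) lf.
- exact: lin_comp lf (lin_gsign gr').
by rewrite (gsignE gr da) (gsignE gr' (fdeg da)) (linZ lf).
Qed.

Lemma morph_km s t : F (koszul_mul deg s t) = koszul_mul deg' (F s) (F t).
Proof.
have lF := lin_tmap lf lf.
move: s; apply: (hom_tens_eq gr) => [||p q a b da db].
- exact: lin_comp (lin_kml gr _) lF.
- exact: lin_comp lF (lin_kml gr' _).
move: t; apply: (hom_tens_eq gr) => [||p' q' a' b' da' db'].
- exact: lin_comp (lin_kmr gr _) lF.
- exact: lin_comp lF (lin_kmr gr' _).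
rewrite (kmE gr _ _ db da') (linZ lF) !tmapE // (kmE gr' _ _ (fdeg db) (fdeg da')).
by rewrite !fM.
Qed.

Lemma morph_flip t : F (koszul_flip deg t) = koszul_flip deg' (F t).
Proof.
have lF := lin_tmap lf lf.
move: t; apply: (hom_tens_eq gr) => [||p q a b da db].
- exact: lin_comp (lin_flip gr) lF.
- exact: lin_comp lF (lin_flip gr').
by rewrite (flipE gr da db) (linZ lF) !tmapE // (flipE gr' (fdeg da) (fdeg db)).
Qed.
End GradedMorphism.

(** * Linear maps out of the algebra B *)
Lemma qalg_lift (k : pzRingType) (R : kalgType k) (S : set R) (V : lmodType k)
    (f : R -> V) : linear f -> (forall s a c, S s -> f (a ** s ** c) = 0) ->
  exists g : qalg S -> V, linear g /\ forall b, g (qproj S b) = f b.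
Proof.
move=> lf f0; pose F := GRing.isLinear.Build k R V _ f lf.
pose f' : {linear R -> V} := HB.pack f F.
have k0 v : ideal_gens S v -> f' v = 0.
  by move=> [s [a [c [Ss ->]]]]; apply: f0.
exists (qlift f'); split; first exact: (@qlift_is_linear _ _ _ _ f').
exact: (@qliftE _ _ _ _ f').
Qed.

Section Words.
Variables (k : comPzRingType) (X : rackType).
Notation B := (B k X).
Notation bx := (@bx k X).
Notation be := (@be k X).
Notation word := (seq (B_gen X)).
Notation gx x := (inl x : B_gen X).
Notation ge x := (inr x : B_gen X).

Definition bw (w : word) : B := qproj (@B_rel k X) (delta k w).

Lemma bw_cat u v : bw (u ++ v) = bw u ** bw v.
Proof. by rewrite -[RHS]/(qmul _ _) qmulE -[kmul _ _]/(fa_mul _ _) fa_mul_delta. Qed.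
Lemma bw_nil : bw [::] = kone. Proof. by []. Qed.
Lemma bwx x : bw [:: gx x] = bx x. Proof. by []. Qed.
Lemma bwe x : bw [:: ge x] = be x. Proof. by []. Qed.
Lemma bw_consx x w : bw (gx x :: w) = bx x ** bw w.
Proof. exact: (bw_cat [:: gx x]). Qed.
Lemma bw_conse x w : bw (ge x :: w) = be x ** bw w.
Proof. exact: (bw_cat [:: ge x]). Qed.

Lemma lin_qproj (R : kalgType k) (S : set R) : linear (qproj S).
Proof. exact: linearP. Qed.

Lemma bw_span (b : B) : span (range bw) b.
Proof.
elim/qproj_ind: b; elim/freemod_ind => [a f g Sf Sg||w].
- by rewrite lin_qproj; apply: spanD => //; apply: spanZ.
- by rewrite (lin0 (@lin_qproj _ _)); apply: span0.
- by apply: span_gen; exists w.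
Qed.

Lemma bw_eq (V : lmodType k) (f g : B -> V) : linear f -> linear g ->
  (forall w, f (bw w) = g (bw w)) -> f =1 g.
Proof. by move=> lf lg E b; apply: (span_eq lf lg) (bw_span b) => _ [w _ <-]. Qed.

(** Each defining relation is a difference of two words, recorded here as a pair. *)
Definition brel (r r' : word) : Prop := exists x y,
  (r = [:: gx y; gx (x ◁ y)] /\ r' = [:: gx x; gx y])
  \/ (r = [:: gx y; ge (x ◁ y)] /\ r' = [:: ge x; gx y]).

Lemma B_relP s :
  B_rel s <-> exists r r', brel r r' /\ s = delta k r - delta k r'.
Proof.
have E (v w : B_gen X) : fa_gen k v * fa_gen k w = delta k [:: v; w].
  exact: fa_mul_delta.
split=> [[x [y [->|->]]]|[r [r' [[x [y [[-> ->]|[-> ->]]]] ->]]]].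
- exists [:: gx y; gx (x ◁ y)], [:: gx x; gx y]; rewrite !E.
  by split=> //; exists x, y; left.
- exists [:: gx y; ge (x ◁ y)], [:: ge x; gx y]; rewrite !E.
  by split=> //; exists x, y; right.
- by exists x, y; left; rewrite !E.
- by exists x, y; right; rewrite !E.
Qed.

Lemma brel_bw r r' : brel r r' -> bw r = bw r'.
Proof.
move=> br; have Br : B_rel (delta k r - delta k r') by apply/B_relP; exists r, r'.
apply/eqP; rewrite -subr_eq0 -(linB (@lin_qproj _ _)).
apply/eqP/qpi_eq0/span_gen; exists (delta k r - delta k r'), kone, kone.
by split=> //; rewrite kmul1l kmul1r.
Qed.

(** The ideal of relations is spanned by the differences of words that differ by
    one relation, so nothing else has to be checked. *)
Lemma B_lift (V : lmodType k) (Phi : word -> V) :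
  (forall r r' u v, brel r r' -> Phi (u ++ r ++ v) = Phi (u ++ r' ++ v)) ->
  exists f : B -> V, linear f /\ forall w, f (bw w) = Phi w.
Proof.
move=> H; pose F := linext Phi; have lF : linear F by exact: linearP.
have [|f [lf fE]] := @qalg_lift k _ (@B_rel k X) V F lF; last first.
  by exists f; split=> // w; rewrite /bw fE /F linext_delta.
have kl (c : freealg k (B_gen X)) : linear (fun a : freealg k (B_gen X) => a ** c).
  exact: kmulPl.
have kr (c : freealg k (B_gen X)) : linear (fun a : freealg k (B_gen X) => c ** a).
  exact: kmulPr.
have E (u v : word) : (delta k u : freealg k (B_gen X)) ** delta k v = delta k (u ++ v).
  exact: fa_mul_delta.
move=> s a c /B_relP[r [r' [br ->]]].
elim/freemod_ind: a => [z f g Ff Fg||u].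
- by rewrite !kl lF Ff Fg scaler0 addr0.
- by rewrite (lin0 (kl _)) (lin0 (kl _)) (lin0 lF).
elim/freemod_ind: c => [z f g Ff Fg||v].
- by rewrite kr lF Ff Fg scaler0 addr0.
- by rewrite (lin0 (kr _)) (lin0 lF).
rewrite (linB (kr _)) (linB (kl _)) !E (linB lF) /F !linext_delta -!catA.
by rewrite (H _ _ _ _ br) subrr.
Qed.

Lemma cnt_brel r r' : brel r r' -> cnt r = cnt r'.
Proof. by case=> x [y [[-> ->]|[-> ->]]]. Qed.

Lemma bw_deg w : B_deg (cnt w) (bw w).
Proof. by apply: span_gen; exists w. Qed.

(** Relations preserve the number of letters e_x, so the projection on the odd
    part is well defined on words. *)
Lemma B_graded : is_graded (@B_deg k X).
Proof.
split.
- by move=> n b; apply: span_span.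
- exact: (bw_deg [::]).
- move=> p q a b da db.
  apply: (span_image (@lin_kmull _ _ b)) da => _ [u [<- ->]].
  apply: (span_image (@lin_kmulr _ _ _)) db => _ [v [<- ->]].
  rewrite -[X in X ** _]/(bw u) -[X in _ ** X]/(bw v) -bw_cat.
  by apply: span_gen; exists (u ++ v); rewrite count_cat.
- move=> b; apply: span_sub (bw_span b) => _ [w _ <-].
  by apply: span_gen; exists (cnt w); apply: bw_deg.
have [|o [lo oE]] := @B_lift B (fun w => (odd (cnt w))%:R *: bw w).
  move=> r r' u v br; rewrite !bw_cat (brel_bw br) /cnt !count_cat.
  by have := cnt_brel br; rewrite /cnt => ->.
exists o; split=> // n a; apply: (span_eq lo (lin_scale _ (@lin_id _ _))).
by move=> _ [w [<- ->]]; apply: oE.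
Qed.

Lemma bw_mon w : mon bx be w = bw w.
Proof. by elim: w => [//|[x|x] w IH] /=; rewrite ?bw_consx ?bw_conse IH. Qed.

Lemma B_gens : rack_gens (@B_deg k X) bx be.
Proof.
split; [exact: B_graded|exact: (fun x => bw_deg [:: gx x])
  |exact: (fun x => bw_deg [:: ge x])| | |].
- by move=> x y; rewrite -!bwx -!bw_cat; apply: brel_bw; exists x, y; left.
- by move=> x y; rewrite -!bwx -!bwe -!bw_cat; apply: brel_bw; exists x, y; right.
move=> n b; apply: span_sub => _ [w [<- ->]]; apply: span_gen.
by exists w; split=> //; rewrite bw_mon.
Qed.

Lemma emonE s : emon k s = mon bx be (map inr s).
Proof. by elim: s => [|x s IH] /=; rewrite /emon ?big_nil // big_cons -IH. Qed.

Section Morphisms.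
Variables (T : kalgType k) (u v : X -> T).
Hypothesis uu : forall x y, u y ** u (x ◁ y) = u x ** u y.
Hypothesis uv : forall x y, u y ** v (x ◁ y) = v x ** u y.

Lemma B_morph : exists f : B -> T, [/\ linear f, f kone = kone,
  forall a b, f (a ** b) = f a ** f b, forall x, f (bx x) = u x
  & forall x, f (be x) = v x].
Proof.
pose gen (g : B_gen X) : T := match g with inl x => u x | inr x => v x end.
pose Phi (w : word) : T := foldr (fun g t => gen g ** t) kone w.
have Pcat w w' : Phi (w ++ w') = Phi w ** Phi w'.
  by elim: w => [|g w IH] /=; rewrite ?kmul1l // IH kmulA.
have [r r' w w' br|f [lf fE]] := @B_lift T Phi.
  rewrite !Pcat; congr (_ ** (_ ** _)).
  by case: br => x [y [[-> ->]|[-> ->]]]; rewrite /= !kmul1r.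
have f2 a b : f (a ** b) = f a ** f b.
  move: a; apply: bw_eq => [||w].
  - exact: (lin_comp (@lin_kmull _ _ b) lf).
  - exact: (lin_comp lf (@lin_kmull _ _ (f b))).
  move: b; apply: bw_eq => [||w'].
  - exact: (lin_comp (@lin_kmulr _ _ _) lf).
  - exact: (lin_comp lf (@lin_kmulr _ _ _)).
  by rewrite -bw_cat !fE.
exists f; split=> // [|x|x]; first exact: (fE [::]).
- by rewrite -bwx fE /= kmul1r.
- by rewrite -bwe fE /= kmul1r.
Qed.
End Morphisms.

Section Skew.
Variables (T : kalgType k) (phi psi : B -> T) (dx de : X -> T).
Hypotheses (lphi : linear phi) (lpsi : linear psi).
Hypotheses (phi1 : phi kone = kone) (psi1 : psi kone = kone).
Hypotheses (phiM : forall a b, phi (a ** b) = phi a ** phi b)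
  (psiM : forall a b, psi (a ** b) = psi a ** psi b).
Hypothesis dxx : forall x y, dx y ** phi (bx (x ◁ y)) + psi (bx y) ** dx (x ◁ y)
   = dx x ** phi (bx y) + psi (bx x) ** dx y.
Hypothesis dxe : forall x y, dx y ** phi (be (x ◁ y)) + psi (bx y) ** de (x ◁ y)
   = de x ** phi (bx y) + psi (be x) ** dx y.

(** Skew derivations along two morphisms [phi] and [psi]: the rule determines the
    value on a word letter by letter, and it respects the relations as soon as
    it does so on the relations themselves. *)
Lemma B_skew : exists f : B -> T, [/\ linear f,
  forall a b, f (a ** b) = f a ** phi b + psi a ** f b,
  forall x, f (bx x) = dx x & forall x, f (be x) = de x].
Proof.
pose gen (g : B_gen X) : T := match g with inl x => dx x | inr x => de x end.
pose Phi := fix Phi (w : word) : T :=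
  if w is g :: w' then gen g ** phi (bw w') + psi (bw [:: g]) ** Phi w' else 0.
have Pcat w w' : Phi (w ++ w') = Phi w ** phi (bw w') + psi (bw w) ** Phi w'.
  elim: w => [|g w IH] /=; first by rewrite bw_nil psi1 kmul1l kmul0l add0r.
  rewrite IH kmulDr kmulDl addrA !kmulA -psiM -bw_cat; congr (_ + _ + _).
  by rewrite bw_cat phiM kmulA.
have [r r' w w' br|f [lf fE]] := @B_lift T Phi.
  rewrite !Pcat !bw_cat (brel_bw br); congr (_ + _ ** (_ ** _ + _)).
  case: br => x [y [[-> ->]|[-> ->]]];
    by rewrite /= !bw_nil !phi1 !kmul1r !kmul0r !addr0 ?dxx ?dxe.
exists f; split=> // [a b|x|x].
- move: a; apply: bw_eq => [||w].
  + exact: (lin_comp (@lin_kmull _ _ b) lf).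
  + apply: lin_add; first exact: (lin_comp lf (@lin_kmull _ _ _)).
    exact: (lin_comp lpsi (@lin_kmull _ _ _)).
  move: b; apply: bw_eq => [||w'].
  + exact: (lin_comp (@lin_kmulr _ _ _) lf).
  + apply: lin_add; first exact: (lin_comp lphi (@lin_kmulr _ _ _)).
    exact: (lin_comp lf (@lin_kmulr _ _ _)).
  by rewrite -bw_cat !fE.
- by rewrite -bwx fE /= bw_nil phi1 kmul1r kmul0r addr0.
- by rewrite -bwe fE /= bw_nil phi1 kmul1r kmul0r addr0.
Qed.
End Skew.
End Words.

(** * The comultiplication, counit, differential and homotopy of B *)
Section StructureOnB.
Variables (k : comPzRingType) (X : rackType).
Notation B := (B k X).
Notation bx := (@bx k X).
Notation be := (@be k X).
Notation G := (@B_gens k X).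
Notation gr := (gens_graded (@B_gens k X)).
Notation deg := (@B_deg k X).

Lemma B_comul_spec : is_comul deg bx be (@B_comul k X).
Proof.
have [D H] : exists D, is_comul deg bx be D.
  have [D [lD D1 DM Dbx Dbe]] := @B_morph k X (ktens gr) _ _ (Dx_x G) (Dx_e G).
  by exists D; exact: (ktens_comul lD D1 DM Dbx Dbe).
have [l m1 mM mx me] : [/\ linear (@B_comul k X), B_comul 1 = (1 : B) ⊗ (1 : B),
    forall a b : B, B_comul (a * b) = BB_mul (B_comul a) (B_comul b),
    forall x, B_comul (bx x) = bx x ⊗ bx x
    & forall x, B_comul (be x) = be x ⊗ bx x + (1 : B) ⊗ be x].
  apply: (@the_mapP _ _ [set D : B -> (B ⊗ B)%type | [/\ linear D,
    D 1 = (1 : B) ⊗ (1 : B),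
    forall a b, D (a * b) = BB_mul (D a) (D b),
    forall x, D (bx x) = bx x ⊗ bx x
    & forall x, D (be x) = be x ⊗ bx x + (1 : B) ⊗ be x]]%classic).
  exists D; split.

  - exact: (lin_comul H).
  - exact: (comul1 H).
  - exact: (comulM H).
  - exact: (comul_x H).
  - exact: (comul_e H).
by split; [exact: l|exact: m1|exact: mM|exact: mx|exact: me].
Qed.

Lemma B_counit_spec : is_counit bx be (@B_counit k X).
Proof.
have [l m1 mM mx me] : [/\ linear (@B_counit k X), B_counit (1 : B) = 1,
    forall a b : B, B_counit (a * b) = B_counit a * B_counit b,
    forall x, B_counit (bx x) = 1
    & forall x, B_counit (be x) = 0]; last first.
  by split; [exact: l|exact: m1|exact: mM|exact: mx|exact: me].
apply: (@the_mapP _ _ [set eps : B -> k^o | [/\ linear eps, eps 1 = 1,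
    forall a b, eps (a * b) = eps a * eps b,
    forall x, eps (bx x) = 1
    & forall x, eps (be x) = 0]]%classic).
have [r r' w w' br|f [lf fE]] := @B_lift k X k^o (fun w => (cnt w == 0%N)%:R).
  by rewrite /cnt !count_cat; have := cnt_brel br; rewrite /cnt => ->.
have fM (a b : B) : f (a ** b) = f a * f b.
  move: a; apply: bw_eq => [||w].
  - exact: (lin_comp (@lin_kmull _ _ b) lf).
  - by move=> z a a'; rewrite lf mulrDl; congr (_ + _); apply/esym/mulrA.
  move: b; apply: bw_eq => [||w'].
  - exact: (lin_comp (@lin_kmulr _ _ _) lf).
  - by move=> z a a'; rewrite lf mulrDr; congr (_ + _); apply/mulrCA.
  rewrite -bw_cat !fE /cnt count_cat addn_eq0.
  by case: eqP; case: eqP; rewrite ?mulr0 ?mulr1.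
exists f; split; [exact: lf|exact: (fE [::])|exact: fM| |] => x.
- exact: (fE [:: inl x]).
- exact: (fE [:: inr x]).
Qed.

Lemma B_diff_spec : is_bdiff deg bx be (@B_diff k X).
Proof.
have [l _ dM dx de] : [/\ linear (@B_diff k X),
    forall n (b : B), B_deg n.+1 b -> B_deg n (B_diff b),
    forall p (a b : B), B_deg p a ->
      B_diff (a * b) = B_diff a * b + (-1) ^+ p *: (a * B_diff b),
    forall x, B_diff (bx x) = 0 :> B
    & forall x, B_diff (be x) = bx x - 1]; last first.
  split; [exact: l| |exact: dx|exact: de].
  move=> a b; move: a; apply: (graded_eq gr) => [||p a da].
  - exact: (lin_comp (@lin_kmull _ _ b) l).
  - apply: lin_add; first exact: (lin_comp l (@lin_kmull _ _ b)).
    exact: (lin_comp (lin_gsign gr) (@lin_kmull _ _ _)).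
  - by rewrite (gsignE gr da) kmulZl; exact: dM.
have := (@the_mapP B _ [set d : B -> B | [/\ linear d,
    forall n b, B_deg n.+1 b -> B_deg n (d b),
    forall p a b, B_deg p a -> d (a * b) = d a * b + (-1) ^+ p *: (a * d b),
    forall x, d (bx x) = 0
    & forall x, d (be x) = bx x - 1]]%classic); apply.
have [||d [ld dM dx de]] := @B_skew k X B id (gsign deg) (fun=> 0) (fun x => bx x - kone)
  (@lin_id _ _) (lin_gsign gr) erefl (gsign1 gr) (fun _ _ => erefl) (gsignM gr).
- by move=> x y; rewrite !kmul0l !kmul0r.
- exact: (bdiff_rel_xe G).
have I : is_bdiff deg bx be d by split.
exists d; split; [exact: ld|exact: (bdiff_deg G I)| |exact: dx|exact: de].
by move=> p a b da; rewrite [LHS]dM (gsignE gr da) kmulZl.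
Qed.

Lemma B_homotopy_exists : exists h, is_homotopy deg bx be (@B_comul k X) h.
Proof.
have H := B_comul_spec.
have [lpsi psi1 psiM] := ktens_flip_comul G H.
have [x y||h [lh hM hx he]] := @B_skew k X (ktens gr) (@B_comul k X)
  (fun a => koszul_flip deg (B_comul (gsign deg a))) (fun=> 0) (fun x => be x ⊗ be x)
  (ktens_lin G (lin_comul H)) lpsi (comul1 H) psi1 (comulM H) psiM.
- by rewrite !kmul0l !kmul0r.
- exact: (ktens_homotopy_rel_xe G H).
by exists h; exact: (ktens_homotopy erefl erefl lh hM hx he).
Qed.

(** The skew derivation satisfies the A-linear description of h, and that
    description has only one solution. *)
Lemma B_h_spec : is_homotopy deg bx be (@B_comul k X) (@B_h k X).
Proof.
have H := B_comul_spec; have [h K] := B_homotopy_exists.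
suff Hg : is_hmap deg bx be (@B_comul k X) (@B_h k X).
  have -> : @B_h k X = h by apply/funext; exact: (hmap_homotopy G H K Hg).
  exact: K.
have [lh hx h_one he hs] : [/\ linear (@B_h k X),
    forall x b, B_h (bx x * b) = B_diag x (B_h b),
    B_h (1 : B) = 0,
    forall x, B_h (be x) = be x ⊗ be x
    & forall n (s : n.-tuple X), B_h (emon k s) =
        \sum_(i < n) (-1) ^+ i *:
          BB_mul
            (BB_mul (BB_prod [seq B_flip (B_comul (be x)) | x <- take i s])
                    (B_h (be (tnth s i))))
            (BB_prod [seq B_comul (be x) | x <- drop i.+1 s])].
  have Hh := homotopy_hmap G H K.
  have := (@the_mapP B _ [set h : B -> (B ⊗ B)%type | [/\ linear h,
    forall x b, h (bx x * b) = B_diag x (h b),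
    h (1 : B) = 0,
    forall x, h (be x) = be x ⊗ be x
    & forall n (s : n.-tuple X), h (emon k s) =
        \sum_(i < n) (-1) ^+ i *:
          BB_mul
            (BB_mul (BB_prod [seq B_flip (B_comul (be x)) | x <- take i s])
                    (h (be (tnth s i))))
            (BB_prod [seq B_comul (be x) | x <- drop i.+1 s])]]%classic); apply.
  exists h; split; [exact: (lin_hmap Hh)|exact: (hmap_x Hh)|exact: (hmap1 Hh)
    |exact: (hmap_e Hh)|].
  move=> n s; rewrite emonE; exact: (hmap_mon Hh).
split; [exact: lh|exact: hx|exact: h_one|exact: he|].
move=> n s; rewrite -emonE; exact: hs.
Qed.
End StructureOnB.

(** * The quotient by the squares of the exterior letters *)
Section SquareQuotient.
Variables (k : comPzRingType) (R R' : kalgType k) (deg : nat -> set R).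
Variables (X : rackType) (u e : X -> R) (pi : R -> R').
Hypothesis G : rack_gens deg u e.
Notation gr := (gens_graded G).
Hypothesis ue : forall x, u x ** e x = e x ** u x.
Hypotheses (lpi : linear pi) (pi1 : pi kone = kone).
Hypothesis piM : forall a b, pi (a ** b) = pi a ** pi b.
Hypothesis pi_surj : forall b, exists a, pi a = b.
Hypothesis pi_sqr : forall x, pi (e x ** e x) = 0.
Hypothesis pi_lift : forall (V : lmodType k) (f : R -> V), linear f ->
  (forall x a c, f (a ** (e x ** e x) ** c) = 0) ->
  exists g : R' -> V, linear g /\ forall b, g (pi b) = f b.

Definition qdeg (n : nat) : set R' := pi @` deg n.
Let pu x := pi (u x).
Let pe x := pi (e x).
Let P := tmap pi pi.
Let lP : linear P := lin_tmap lpi lpi.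
Notation m := (koszul_mul deg).

Lemma qdeg_pi n a : deg n a -> qdeg n (pi a).
Proof. by move=> da; exists a. Qed.

Lemma pi_ideal x a c : pi (a ** (e x ** e x) ** c) = 0.
Proof. by rewrite (piM _ c) (piM a) pi_sqr kmul0r kmul0l. Qed.

Lemma gsign_sqr x : gsign deg (e x ** e x) = e x ** e x.
Proof. by rewrite (gsignM gr) (gsign_e G) kmulNl kmulNr opprK. Qed.

(** A square has even degree and the ideal it generates is spanned by products of
    homogeneous elements, so the parity projection descends. *)
Lemma qdeg_graded : is_graded qdeg.
Proof.
split.
- move=> n b; elim=> [|//|_ _ _ [a da <-] _ [c dc <-]|z _ _ [a da <-]].
  + by exists 0; [apply: (deg0 gr)|apply: lin0].
  + by rewrite -(linD lpi); apply: qdeg_pi; rewrite -[a]scale1r; apply: (deg_lin gr).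
  + by rewrite -(linZ lpi); apply: qdeg_pi; apply: (degZ gr).
- by rewrite -pi1; apply: qdeg_pi (deg_one gr).
- move=> p q _ _ [a da <-] [b db <-]; rewrite -piM; apply: qdeg_pi.
  exact: (deg_mul gr da db).
- move=> b; have [a <-] := pi_surj b.
  apply: (span_image lpi) (deg_total gr a) => {}a [n da].
  by apply: span_gen; exists n; apply: qdeg_pi.
have [o [lo oE]] := deg_odd gr.
have [x a c|o' [lo' o'E]] := pi_lift (lin_comp lo lpi).
  move: a; apply: (graded_eq gr) => [||p a da].
  - exact: (lin_comp (@lin_kmull _ _ _) (lin_comp (@lin_kmull _ _ c) (lin_comp lo lpi))).
  - exact: lin_zero.
  move: c; apply: (graded_eq gr) => [||q c dc].
  - exact: (lin_comp (@lin_kmulr _ _ _) (lin_comp lo lpi)).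
  - exact: lin_zero.
  have ds := deg_mul gr (deg_e G x) (deg_e G x).
  rewrite /= (oE _ _ (deg_mul gr (deg_mul gr da ds) dc)) (linZ lpi).
  by rewrite pi_ideal scaler0.
exists o'; split=> // n _ [a da <-].
by rewrite o'E /= (oE _ _ da) (linZ lpi).
Qed.

Lemma pi_mon w : mon pu pe w = pi (mon u e w).
Proof. by elim: w => [//|[x|x] w IH] /=; rewrite ?pi1 // piM -IH. Qed.

Lemma qgens : rack_gens qdeg pu pe.
Proof.
split; [exact: qdeg_graded| | | | |] => [x|x|x y|x y|n _ [a da <-]].
- exact: qdeg_pi (deg_x G x).
- exact: qdeg_pi (deg_e G x).
- by rewrite /pu -!piM (rel_xx G).
- by rewrite /pu /pe -!piM (rel_xe G).
apply: (span_image lpi) (deg_mon G da) => _ [w [wn ->]].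
by apply: span_gen; exists w; rewrite pi_mon.
Qed.

Let gr' := qdeg_graded.
Local Notation m' := (koszul_mul qdeg).
Let pi_gsign := morph_gsign gr gr' lpi qdeg_pi.
Let P_km : forall s t, P (m s t) = m' (P s) (P t) := morph_km gr gr' lpi piM qdeg_pi.
Let P_flip t : P (koszul_flip deg t) = koszul_flip qdeg (P t).
Proof. exact: (morph_flip gr gr' lpi qdeg_pi). Qed.
Let PE a b : P (a ⊗ b) = pi a ⊗ pi b. Proof. by rewrite /P tmapE. Qed.

Section Comul.
Variable D : R -> R ⊗ R.
Hypothesis H : is_comul deg u e D.

Lemma pi_comul_sqr x : P (D (e x ** e x)) = 0.
Proof.
rewrite (comulM H) (comul_e H) (De_sqr G (ue x)) (linD lP) !PE pi_sqr.
by rewrite ptens0l ptens0r addr0.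
Qed.

Lemma pi_comul_ideal x a c : P (D (a ** (e x ** e x) ** c)) = 0.
Proof.
rewrite !(comulM H) !P_km -(P_km (D (e x))) -(comulM H) pi_comul_sqr.
by rewrite (lin0 (lin_kmr gr' _)) (lin0 (lin_kml gr' _)).
Qed.

Lemma qcomul : exists D', (forall b, D' (pi b) = P (D b)) /\ is_comul qdeg pu pe D'.
Proof.
have [|D' [lD D'E]] := pi_lift (lin_comp (lin_comul H) lP).
  exact: pi_comul_ideal.
exists D'; split=> //; split=> // [|a b|x|x].
- by rewrite -pi1 D'E /= (comul1 H) PE pi1.
- have [c <-] := pi_surj a; have [d <-] := pi_surj b.
  by rewrite -piM !D'E /= (comulM H) P_km.
- by rewrite D'E /= (comul_x H) PE.
- by rewrite D'E /= (comul_e H) (linD lP) !PE pi1.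
Qed.
End Comul.

Lemma qcounit eps : is_counit u e eps ->
  exists eps', (forall b, eps' (pi b) = eps b) /\ is_counit pu pe eps'.
Proof.
move=> E; have [|f [lf fE]] := pi_lift (lin_counit E).
  by move=> x a c; rewrite !(counitM E) (counit_e E) !(mul0r, mulr0).
exists f; split=> //; split=> // [|a b|x|x].
- by rewrite -pi1 fE (counit1 E).
- have [c <-] := pi_surj a; have [d <-] := pi_surj b.
  by rewrite -piM !fE (counitM E).
- by rewrite fE (counit_x E).
- by rewrite fE (counit_e E).
Qed.

Lemma qbdiff d : is_bdiff deg u e d ->
  exists d', (forall b, d' (pi b) = pi (d b)) /\ is_bdiff qdeg pu pe d'.
Proof.
move=> I; have [|f [lf fE]] := pi_lift (lin_comp (lin_bdiff I) lpi).
  move=> x a c; have ds : d (e x ** e x) = 0.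
    rewrite (bdiffM I) (bdiff_e I) (gsign_e G) kmulNl kmulDl kmulDr kmulNl kmulNr.
    by rewrite kmul1l kmul1r ue opprB addrC addrA subrK subrr.
  rewrite /= (bdiffM I _ c) (bdiffM I a) ds kmul0r addr0 (linD lpi) pi_ideal add0r.
  by rewrite (gsignM gr) gsign_sqr pi_ideal.
exists f; split=> //; split=> // [a b|x|x].
- have [c <-] := pi_surj a; have [c' <-] := pi_surj b.
  by rewrite -piM !fE /= (bdiffM I) (linD lpi) !piM pi_gsign.
- by rewrite fE /= (bdiff_x I) (lin0 lpi).
- by rewrite fE /= (bdiff_e I) (linB lpi) pi1.
Qed.

Lemma qhomotopy D D' h : is_comul deg u e D -> (forall b, D' (pi b) = P (D b)) ->
  is_homotopy deg u e D h ->
  exists h', (forall b, h' (pi b) = P (h b)) /\ is_homotopy qdeg pu pe D' h'.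
Proof.
move=> H D'E K; have [|f [lf fE]] := pi_lift (lin_comp (lin_h K) lP).
  move=> x a c; have hs : P (h (e x ** e x)) = 0.
    rewrite (h_sqr G H K) !(linB lP) !PE pi_sqr (piM (u x)).
    by rewrite !(ptens0l, ptens0r) !subr0.
  have mr := lin0 (lin_kmr gr' _); have ml := lin0 (lin_kml gr' _).
  rewrite /= (h_skew K _ c) (h_skew K a) (linD lP) !P_km (linD lP) !P_km.
  rewrite hs (pi_comul_sqr H) !mr addr0 ml add0r P_flip.
  have := pi_comul_ideal H x (gsign deg a) kone.
  rewrite kmul1r (gsignM gr) gsign_sqr => ->.
  by rewrite (lin0 (lin_flip gr')) ml.
exists f; split=> //; split=> // [a b|x|x].
- have [c <-] := pi_surj a; have [c' <-] := pi_surj b.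
  by rewrite -pi_gsign -piM !fE /= (h_skew K) (linD lP) !P_km !D'E P_flip.
- by rewrite fE /= (h_x K) (lin0 lP).
- by rewrite fE /= (h_e K) PE.
Qed.

End SquareQuotient.

(** * The differential graded algebra of invariant forms *)
Section CochainAlgebra.
Variables (k : comPzRingType) (R : kalgType k) (deg : nat -> set R).
Variables (X : rackType) (u e : X -> R).
Hypothesis G : rack_gens deg u e.
Notation gr := (gens_graded G).
Notation sg := (gsign deg).
Variables (D : R -> R ⊗ R) (d : R -> R) (h : R -> R ⊗ R) (eps : R -> k^o).
Hypotheses (H : is_comul deg u e D) (I : is_bdiff deg u e d).
Hypotheses (K : is_homotopy deg u e D h) (E : is_counit u e eps).

(** Forms linear over A, with values in the trivial module, concentrated in
    degree n: the elements of Hom_A(B_n, k) extended by zero. *)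
Definition deg_form (n : nat) (F : R -> k^o) : Prop :=
  [/\ linear F, forall x b, F (u x ** b) = F b
    & forall i b, i <> n -> deg i b -> F b = 0].

Variables (C : nat -> lmodType k) (dC : forall n, {linear C n -> C n.+1}).
Variable ext : forall n, C n -> R -> k^o.
Hypothesis ext_form : forall n f, deg_form n (@ext n f).
Hypothesis ext_surj : forall n F, deg_form n F -> exists f, @ext n f = F.
Hypothesis ext_inj : forall n, injective (@ext n).
Hypothesis extP : forall n a (f g : C n) b, ext (a *: f + g) b = a * ext f b + ext g b.
Hypothesis ext_d : forall n (f : C n), ext (dC n f) = ext f \o d.

Let lext n f : linear (@ext n f). Proof. by have [] := @ext_form n f. Qed.
Let extx n f x b : @ext n f (u x ** b) = ext f b.
Proof. by have [_ ->] := @ext_form n f. Qed.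
Let extdeg n f i b : i <> n -> deg i b -> @ext n f b = 0.
Proof. by have [_ _] := @ext_form n f; apply. Qed.

Lemma ext_eq n (f g : C n) : ext f =1 ext g -> f = g.
Proof. by move=> fg; apply: ext_inj; apply/funext. Qed.
Lemma ext0 n b : ext (0 : C n) b = 0.
Proof. by have := extP (-1) (0 : C n) 0 b; rewrite scaler0 addr0 mulN1r addNr. Qed.
Lemma extZ n a (f : C n) b : ext (a *: f) b = a * ext f b.
Proof. by have := extP a f 0 b; rewrite addr0 ext0 addr0. Qed.
Lemma extB n (f g : C n) b : ext (f - g) b = ext f b - ext g b.
Proof. by have := extP (-1) g f b; rewrite scaleN1r mulN1r addrC [in RHS]addrC. Qed.
Lemma ext_cast m n (E0 : m = n) (f : C m) : ext (castdeg E0 f) = ext f.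
Proof. by case: n / E0. Qed.

Lemma iter_gsign_x n x b : iter n sg (u x ** b) = u x ** iter n sg b.
Proof. by elim: n => [//|n /= ->]; rewrite (gsignM gr) (gsign_x G). Qed.

Lemma form_Dx q p r (f : C p) (g : C r) x t :
  koszul_form deg q (ext f) (ext g) (koszul_mul deg (Dx u x) t)
   = koszul_form deg q (ext f) (ext g) t.
Proof.
have lF := lin_form gr q (lext f) (lext g).
move: t; apply: tens_eq => [||a b].
- exact: lin_comp (lin_kmr gr _) lF.
- exact: lF.
by rewrite (km_x G) !(formE gr) // iter_gsign_x !extx.
Qed.

(** The comultiplication of x b is that of b multiplied by x (x) x, which invariant
    forms do not see; so composition with it preserves invariance. *)
Lemma cup_ex p q (f : C p) (g : C q) :
  exists c : C (p + q), ext c = koszul_form deg q (ext f) (ext g) \o D.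
Proof.
have lF := lin_form gr q (lext f) (lext g).
apply: ext_surj; split=> [|x b|i b ipq db] /=.
- exact: lin_comp (lin_comul H) lF.
- by rewrite (comulM H) (comul_x H) form_Dx.
apply: (form_deg gr (lext f) (lext g) _ _ ipq); [exact: extdeg|exact: extdeg|].
exact: (comul_deg G H).
Qed.

Definition cup : graded_product C := fun p q f g => projT1 (cid (cup_ex f g)).

Lemma cupE p q (f : C p) (g : C q) b :
  ext (cup f g) b = koszul_form deg q (ext f) (ext g) (D b).
Proof. by rewrite /cup; case: cid => c /= ->. Qed.

Lemma one_ex : exists c : C 0, ext c = eps.
Proof.
apply: ext_surj; split; first exact: lin_counit E.
  by move=> x b; rewrite (counitM E) (counit_x E) mul1r.
by move=> i b; apply: (counit_deg G E).
Qed.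
Definition cup_one : C 0 := projT1 (cid one_ex).
Lemma ext_one : ext cup_one = eps.
Proof. by rewrite /cup_one; case: cid. Qed.

Lemma form_tsign q r F F' t : linear F -> linear F' ->
  koszul_form deg q F F' (iter r (tsign deg) t) =
  koszul_form deg q (F \o iter r sg) (F' \o iter r sg) t.
Proof.
move=> lF lF'; have ls := lin_iter_gsign gr r.
have lt : linear (iter r (tsign deg)).
  elim: r {ls} => [|r IH]; first exact: lin_id.
  exact: lin_comp IH (lin_tsign gr).
have lF1 := lin_comp ls lF; have lF1' := lin_comp ls lF'.
move: t; apply: tens_eq => [||a b].
- exact: lin_comp lt (lin_form gr q lF lF').
- exact: (lin_form gr q lF1 lF1').
have -> : iter r (tsign deg) (a ⊗ b) = iter r sg a ⊗ iter r sg b.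
  by elim: (r) => [//|i /= ->]; rewrite (tsignE gr).
by rewrite !(formE gr) //= -!iterD addnC.
Qed.

Lemma comul_iter r b : D (iter r sg b) = iter r (tsign deg) (D b).
Proof. by elim: r => [//|r /= <-]; rewrite (comul_gsign G H). Qed.

(** Both products are values of one pairing on the triple tensor product, at the
    two sides of coassociativity. *)
Lemma cupA p q r (f : C p) (g : C q) (l : C r) :
  castdeg (addnA p q r) (cup f (cup g l)) = cup (cup f g) l.
Proof.
apply: ext_eq => b; rewrite ext_cast !cupE.
have -> : ext (cup g l) = koszul_form deg r (ext g) (ext l) \o D.
  by apply/funext => c; rewrite cupE.
have -> : ext (cup f g) = koszul_form deg q (ext f) (ext g) \o D.
  by apply/funext => c; rewrite cupE.
have lgl := lin_form gr r (lext g) (lext l).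
have lfg := lin_form gr q (lext f) (lext g).
have lD := lin_comul H; have lid := @lin_id k R.
pose beta (a : R) (s : R ⊗ R) : k^o :=
  ext f (iter (q + r) sg a) * koszul_form deg r (ext g) (ext l) s.
have bb : bilin beta.
  split=> [s|a] z v w; rewrite /beta ?(lin_iter_gsign gr) ?lext ?lgl.
    by rewrite mulrDl; congr (_ + _); apply/esym/mulrA.
  by rewrite mulrDr; congr (_ + _); apply: mulrCA.
have lb := tlift_is_linear bb.
have E1 : koszul_form deg (q + r) (ext f) (koszul_form deg r (ext g) (ext l) \o D)
    =1 tlift beta \o tmap id D.
  apply: tens_eq => [||a c].
  - exact: (lin_form gr _ (lext f) (lin_comp lD lgl)).
  - exact: lin_comp (lin_tmap lid lD) lb.
  by rewrite (formE gr) //=; [rewrite tmapE // tliftE|exact: lin_comp lD lgl].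
have E2 : koszul_form deg r (koszul_form deg q (ext f) (ext g) \o D) (ext l)
    =1 tlift beta \o @tassoc k R R R \o tmap D id.
  apply: tens_eq => [||a c].
  - exact: (lin_form gr _ (lin_comp lD lfg) (lext l)).
  - exact: lin_comp (lin_tmap lD lid) (lin_comp (@lin_tassoc k R R R) lb).
  rewrite (formE gr) //=; last exact: lin_comp lD lfg.
  rewrite tmapE // comul_iter form_tsign //.
  have lsr := lin_iter_gsign gr r.
  have lf1 := lin_comp lsr (lext f); have lg1 := lin_comp lsr (lext g).
  move: (D a); apply: tens_eq => [||a1 a2].
  - have l2 := lin_form gr q lf1 lg1.
    by move=> z v w; rewrite l2 mulrDl; congr (_ + _); apply/esym/mulrA.
  - exact: lin_comp (@lin_ptensl _ _ _ c) (lin_comp (@lin_tassoc k R R R) lb).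
  rewrite (formE gr) // tassocE tliftE // /beta (formE gr) //= mulrA.
  by rewrite -iterD addnC.
by rewrite E1 E2 /= (comul_coassociative G H).
Qed.

Lemma cup_bilin p q : (forall g : C q, linear (fun f : C p => cup f g)) /\
  (forall f : C p, linear (@cup p q f)).
Proof.
split=> [g|f] a v w; apply: ext_eq => b; rewrite extP !cupE.
- have lF c := lin_form gr q (lext (c : C p)) (lext g).
  apply: (@tens_eq k k^o R R (koszul_form deg q (ext (a *: v + w)) (ext g))
   (fun t => a * koszul_form deg q (ext v) (ext g) t
      + koszul_form deg q (ext w) (ext g) t)).
  + exact: lF.
  + exact: lin_add (lin_scale _ (lF _)) (lF _).
  by move=> s t; rewrite !(formE gr) // extP mulrDl mulrA.
- have lF c := lin_form gr q (lext f) (lext (c : C q)).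
  apply: (@tens_eq k k^o R R (koszul_form deg q (ext f) (ext (a *: v + w)))
   (fun t => a * koszul_form deg q (ext f) (ext v) t
      + koszul_form deg q (ext f) (ext w) t)).
  + exact: lF.
  + exact: lin_add (lin_scale _ (lF _)) (lF _).
  by move=> s t; rewrite !(formE gr) // extP mulrDr mulrCA.
Qed.

Lemma cup1l p (f : C p) : castdeg (add0n p) (cup cup_one f) = f.
Proof.
apply: ext_eq => b; rewrite ext_cast cupE ext_one.
have bb := bilin_counitl E; have lt := tlift_is_linear bb.
rewrite -[in RHS](counit_left G E H b); move: (D b).
have le := lin_counit E.
apply: tens_eq => [||a c].
- exact: (lin_form gr _ le (lext f)).
- exact: lin_comp lt (lext f).
rewrite (formE gr) // (tliftE bb) (linZ (lext f)).
by congr (_ * _); elim: (p) => //= i; rewrite (counit_gsign G E).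
Qed.

Lemma cup1r p (f : C p) : castdeg (addn0 p) (cup f cup_one) = f.
Proof.
apply: ext_eq => b; rewrite ext_cast cupE ext_one.
have bb := bilin_counitr E; have lt := tlift_is_linear bb.
rewrite -[in RHS](counit_right G E H b); move: (D b).
have le := lin_counit E.
apply: tens_eq => [||a c].
- exact: (lin_form gr _ (lext f) le).
- exact: lin_comp lt (lext f).
by rewrite (formE gr) // (tliftE bb) (linZ (lext f)) mulrC.
Qed.

(** The transpose of the compatibility of the comultiplication with d. *)
Lemma cup_leibniz p q (f : C p) (g : C q) : dC _ (cup f g)
  = (-1) ^+ q *: castdeg (addSn p q) (cup (dC _ f) g)
    + castdeg (addnS p q) (cup f (dC _ g)).
Proof.
apply: ext_eq => b; rewrite ext_d extP !ext_cast /= !cupE !ext_d.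
rewrite (comul_diff G I H).
by rewrite (form_diff gr _ _ (lext f) (lext g) (lin_bdiff I) (bdiff_anti G I)).
Qed.

Lemma dCK n (f : C n) : dC _ (dC _ f) = 0.
Proof.
by apply: ext_eq => b; rewrite !ext_d /= (bdiffK G I) (lin0 (lext f)) ext0.
Qed.

Lemma cup_dga : is_dga dC cup_one cup.
Proof.
split; [split| |].
- exact: cup_bilin.
- exact: cupA.
- exact: cup1l.
- exact: cup1r.
- exact: dCK.
- exact: cup_leibniz.
Qed.

(** In degree 0 the hypothesis forces W to vanish, which matches the convention
    that 0 is the only coboundary there. *)
Lemma ext_coboundary n (c : C n) (W : R -> k^o) :
  linear W -> (forall x b, W (u x ** b) = W b) ->
  (forall i b, i.+1 <> n -> deg i b -> W b = 0) ->
  ext c =1 W \o d -> is_coboundary dC c.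
Proof.
case: n c => [|n] c lW Wx Wd cW.
  apply: ext_eq => b; rewrite cW ext0 /=; move: (d b).
  by apply: (graded_eq gr) => // [|i a da]; [exact: lin_zero|exact: (Wd i)].
have [|w wE] := @ext_surj n W.
  by split=> // i b i_n; apply: Wd => - [].
by exists w => //; apply: ext_eq => b; rewrite ext_d cW wE.
Qed.

(** Apply the pairing of g and f to the homotopy identity: the term with the
    differential of the tensor square vanishes because f and g are cocycles, and
    the other one is a coboundary since h raises the degree by one. *)
Lemma cup_comm p q (f : C p) (g : C q) : dC _ f = 0 -> dC _ g = 0 ->
  is_coboundary dC ((-1) ^+ (p * q) *: cup f g - castdeg (addnC q p) (cup g f)).
Proof.
move=> df dg; have lF := lin_form gr p (lext g) (lext f).
apply: (@ext_coboundary _ _ (koszul_form deg p (ext g) (ext f) \o h)).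
- exact: lin_comp (lin_h K) lF.
- by move=> x b; rewrite /= (h_mulx G H K) form_Dx.
- move=> i b ipq db /=; apply: (form_deg gr (lext g) (lext f) _ _ _ (h_deg G H K db)).
  + exact: extdeg.
  + exact: extdeg.
  + by rewrite addnC.
move=> b; rewrite extB extZ ext_cast !cupE /=.
have fg := form_flip gr (D b) (lext f) (lext g) (@extdeg p f) (@extdeg q g).
rewrite -[_ * _]fg -(linB lF) -(homotopy G I H K) (linD lF).
rewrite (form_diff gr _ _ (lext g) (lext f) (lin_bdiff I) (bdiff_anti G I)).
have z (l : R -> k^o) : linear l -> forall i j (t : R ⊗ R),
    koszul_form deg j (ext (0 : C i)) l t = 0
    /\ koszul_form deg j l (ext (0 : C i)) t = 0.
  move=> ll i j t; split; move: t; apply: tens_eq;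
    try exact: lin_zero; try exact: (lin_form gr _ _ _) => //; move=> a a';
    by rewrite (formE gr) // ext0 ?mul0r ?mulr0.
by rewrite -!ext_d df dg (z _ (lext f) _ _ _).1 (z _ (lext g) _ _ _).2 scaler0 !add0r.
Qed.

End CochainAlgebra.

(** * The cohomology of a differential graded algebra *)
Section CohomologyAlgebra.
Variables (k : comPzRingType) (C : nat -> lmodType k).
Variable d : forall n, {linear C n -> C n.+1}.
Variables (one : C 0) (mul : graded_product C).
Hypothesis A : is_dga d one mul.
Hypothesis mul_comm : forall p q (f : C p) (g : C q), d _ f = 0 -> d _ g = 0 ->
  is_coboundary d ((-1) ^+ (p * q) *: mul f g - castdeg (addnC q p) (mul g f)).

Let mulPl p q (g : C q) : linear (fun f : C p => mul f g).
Proof. exact: ((gr_bilin (dga_alg A) p q).1 g). Qed.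
Let mulPr p q (f : C p) : linear (@mul p q f).
Proof. exact: ((gr_bilin (dga_alg A) p q).2 f). Qed.

Lemma castdeg0 m n (E : m = n) : castdeg E (0 : C m) = 0.
Proof. by case: n / E. Qed.
Lemma coboundaryP n a (f g : C n) :
  is_coboundary d f -> is_coboundary d g -> is_coboundary d (a *: f + g).
Proof.
case: n f g => [|n] f g /=.
  by move=> -> ->; rewrite scaler0 addr0.
by move=> [f' _ <-] [g' _ <-]; exists (a *: f' + g') => //; rewrite linearP.
Qed.
Lemma coboundary0 n : is_coboundary d (0 : C n).
Proof. by case: n => [//|n]; exists 0 => //; rewrite linear0. Qed.
Lemma coboundaryZ n a (f : C n) : is_coboundary d f -> is_coboundary d (a *: f).
Proof. by move=> cf; rewrite -[_ *: _]addr0; apply: coboundaryP (coboundary0 n). Qed.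
Lemma coboundary_uncast m n (E : m = n) (f : C m) :
  is_coboundary d (castdeg E f) -> is_coboundary d f.
Proof. by case: n / E. Qed.

Lemma cocycle_d n (z : cocycle d n) : d n (cocycle_val z) = 0.
Proof. by case: z => z /= /eqP. Qed.

Definition mkcocycle n (f : C n) (df : d n f = 0) : cocycle d n :=
  @Cocycle k C d n f (introT eqP df).

Lemma mul_cocycle p q (f : C p) (g : C q) :
  d p f = 0 -> d q g = 0 -> d _ (mul f g) = 0.
Proof.
move=> df dg; rewrite (dga_leibniz A) df dg (lin0 (mulPl _)) (lin0 (mulPr _)).
by rewrite !castdeg0 scaler0 addr0.
Qed.

Definition mulz p q (f : cocycle d p) (g : cocycle d q) : cocycle d (p + q) :=
  mkcocycle (mul_cocycle (cocycle_d f) (cocycle_d g)).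

(** If f = d a and g is a cocycle, the Leibniz rule for a g exhibits f g as a
    coboundary up to sign. *)
Lemma mul_coboundaryl p q (f : C p) (g : C q) :
  is_coboundary d f -> d q g = 0 -> is_coboundary d (mul f g).
Proof.
case: p f => [|p] f /=.
  by move=> -> _; rewrite (lin0 (mulPl _)); apply: coboundary0.
move=> [a _ <-] dg; apply: (@coboundary_uncast _ _ (addSn p q)).
rewrite -[castdeg _ _](signZZ q); apply: coboundaryZ.
exists (mul a g) => //; rewrite (dga_leibniz A) dg (lin0 (mulPr _)).
by rewrite castdeg0 addr0.
Qed.

Lemma mul_coboundaryr p q (f : C p) (g : C q) :
  d p f = 0 -> is_coboundary d g -> is_coboundary d (mul f g).
Proof.
case: q g => [|q] g df /=.
  by move=> ->; rewrite (lin0 (mulPr _)); apply: coboundary0.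
move=> [a _ <-]; apply: (@coboundary_uncast _ _ (addnS p q)).
exists (mul f a) => //; rewrite (dga_leibniz A) df (lin0 (mulPl _)).
by rewrite castdeg0 scaler0 add0r.
Qed.

Lemma cclass_eqP n (z w : cocycle d n) :
  cclass z = cclass w <-> is_coboundary d (cocycle_val z - cocycle_val w).
Proof.
rewrite /cclass qpiP; split=> [szw|cb]; last exact: span_gen.
have -> : cocycle_val z - cocycle_val w = cocycle_val (z - w) by [].
elim: szw => [|//|f g _ cf _ cg|a f _ cf].
- exact: coboundary0.
- by have := coboundaryP 1 cf cg; rewrite scale1r.
- exact: coboundaryZ.
Qed.

Lemma cclass_val n (z w : cocycle d n) :
  cocycle_val z = cocycle_val w -> cclass z = cclass w.
Proof. by move=> zw; apply/cclass_eqP; rewrite zw subrr; apply: coboundary0. Qed.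

Lemma cclassP n a (z w : cocycle d n) :
  cclass (a *: z + w) = a *: cclass z + cclass w.
Proof. exact: linearP. Qed.

Lemma cclass_ind n (Q : cohomology d n -> Prop) :
  (forall z, Q (cclass z)) -> forall c, Q c.
Proof. exact: qpi_ind. Qed.

Definition hmul : graded_product (cohomology d) := fun p q a b =>
  cclass (mulz (qrepr a) (qrepr b)).

(** Changing the representatives from (f, g) to (f', g') changes the product by
    (f' - f) g' + f (g' - g), a sum of two coboundaries. *)
Lemma hmulE p q (f : cocycle d p) (g : cocycle d q) :
  hmul (cclass f) (cclass g) = cclass (mulz f g).
Proof.
apply/cclass_eqP => /=; set f' := qrepr _; set g' := qrepr _.
have cf : is_coboundary d (cocycle_val f' - cocycle_val f).
  by apply/cclass_eqP; rewrite /cclass qreprK.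
have cg : is_coboundary d (cocycle_val g' - cocycle_val g).
  by apply/cclass_eqP; rewrite /cclass qreprK.
rewrite -(subrKA (mul (cocycle_val f) (cocycle_val g'))).
rewrite -(linB (mulPl _)) -(linB (mulPr _)) -[X in X + _]scale1r.
apply: coboundaryP; first exact: mul_coboundaryl cf (cocycle_d g').
exact: mul_coboundaryr (cocycle_d f) cg.
Qed.

Lemma castdeg_cclass m n (E : m = n) (z : cocycle d m) :
  exists2 w : cocycle d n, castdeg E (cclass z) = cclass w
    & cocycle_val w = castdeg E (cocycle_val z).
Proof. by case: n / E; exists z. Qed.

(** The Leibniz rule for 1 = 1 * 1 gives d(1) = d(1) + d(1). *)
Lemma one_cocycle : d 0 one = 0.
Proof.
have e1 : mul one one = one :> C 0.
  by rewrite -[RHS](gr_mul1l (dga_alg A)) (eq_irrelevance (add0n 0) erefl).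
have := dga_leibniz A one one; rewrite [X in d _ X]e1 expr0 scale1r.
have -> : castdeg (addSn 0 0) (mul (d 0 one) one) = d 0 one.
  rewrite -[RHS](gr_mul1r (dga_alg A)).
  by rewrite (eq_irrelevance (addn0 1) erefl) (eq_irrelevance (addSn 0 0) erefl).
have -> : castdeg (addnS 0 0) (mul one (d 0 one)) = d 0 one.
  rewrite -[RHS](gr_mul1l (dga_alg A)).
  by rewrite (eq_irrelevance (add0n 1) erefl) (eq_irrelevance (addnS 0 0) erefl).
by move=> /eqP; rewrite eq_sym -subr_eq0 addrK => /eqP.
Qed.

Definition hone : cohomology d 0 := cclass (mkcocycle one_cocycle).

Lemma cohomology_induced : is_induced_product one mul hone hmul.
Proof.
split; first by exists (mkcocycle one_cocycle).
by move=> p q f g; exists (mulz f g) => //; apply: hmulE.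
Qed.

Lemma cohomology_algebra : is_graded_algebra hone hmul.
Proof.
split=> [p q|p q r f g l|p f|p f].
- split; elim/cclass_ind=> g a; elim/cclass_ind=> v; elim/cclass_ind=> w.
    rewrite -cclassP !hmulE -cclassP; apply: cclass_val => /=.
    by rewrite mulPl.
  by rewrite -cclassP !hmulE -cclassP; apply: cclass_val => /=; rewrite mulPr.
- elim/cclass_ind: f => f; elim/cclass_ind: g => g; elim/cclass_ind: l => l.
  rewrite !hmulE; have [w -> wE] := castdeg_cclass (addnA p q r) (mulz f (mulz g l)).
  by apply: cclass_val; rewrite wE /= (gr_assoc (dga_alg A)).
- elim/cclass_ind: f => f; rewrite /hone hmulE.
  have [w -> wE] := castdeg_cclass (add0n p) (mulz (mkcocycle one_cocycle) f).
  by apply: cclass_val; rewrite wE /= (gr_mul1l (dga_alg A)).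
- elim/cclass_ind: f => f; rewrite /hone hmulE.
  have [w -> wE] := castdeg_cclass (addn0 p) (mulz f (mkcocycle one_cocycle)).
  by apply: cclass_val; rewrite wE /= (gr_mul1r (dga_alg A)).
Qed.

Lemma cohomology_commutative : is_graded_commutative hmul.
Proof.
move=> p q; elim/cclass_ind=> f; elim/cclass_ind=> g; rewrite !hmulE.
have [w -> wE] := castdeg_cclass (addnC q p) (mulz g f).
rewrite -[LHS](signZZ (p * q)); congr (_ *: _).
have lc : linear (@cclass k C d (p + q)) by exact: cclassP.
rewrite -(linZ lc); apply/cclass_eqP; rewrite wE.
exact: mul_comm (cocycle_d f) (cocycle_d g).
Qed.
End CohomologyAlgebra.

(** * Quandle cochains as invariant forms on the quotient algebra *)
Section QuandleAlgebra.
Variables (k : comPzRingType) (X : quandleType).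
Notation B := (B k X).
Notation BQ := (BQ k X).
Notation bx := (@bx k X).
Notation be := (@be k X).
Notation G := (@B_gens k X).
Notation deg := (@B_deg k X).
Notation pi := (@BQ_proj k X).
Notation qx := (fun x => pi (bx x)).
Notation qe := (fun x => pi (be x)).

Lemma lin_BQ_proj : linear pi. Proof. exact: lin_qproj. Qed.
Lemma BQ_projM (a b : B) : pi (a ** b) = pi a ** pi b.
Proof. exact/esym/qmulE. Qed.
Lemma BQ_proj_surj (b : BQ) : exists a, pi a = b.
Proof. by exists (qrepr b); apply: reprK. Qed.
Lemma BQ_proj_sqr x : pi (be x ** be x) = 0.
Proof.
apply/qpi_eq0/span_gen; exists (be x ** be x), kone, kone.
by split; [exists x|rewrite kmul1l kmul1r].
Qed.
Lemma BQ_lift (V : lmodType k) (f : B -> V) : linear f ->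
  (forall x a c, f (a ** (be x ** be x) ** c) = 0) ->
  exists g : BQ -> V, linear g /\ forall b, g (pi b) = f b.
Proof.
by move=> lf f0; apply: qalg_lift => // s a c [x ->]; apply: f0.
Qed.
Lemma bx_be x : bx x ** be x = be x ** bx x.
Proof. by rewrite -[in RHS](rel_xe G) quandle_idem. Qed.

Lemma BQ_gens : rack_gens (@BQ_deg k X) qx qe.
Proof.
exact: (qgens G lin_BQ_proj erefl BQ_projM BQ_proj_surj BQ_proj_sqr BQ_lift).
Qed.

Lemma B_ideal_coideal : is_coideal (@B_comul k X) (@B_counit k X) (@B_ideal k X).
Proof.
have H := B_comul_spec k X; have E := B_counit_spec k X.
have sq b : B_ideal b -> tmap pi pi (B_comul b) = 0 /\ B_counit b = 0.
  have lP := lin_tmap lin_BQ_proj lin_BQ_proj.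
  move=> Ib; split; move: b Ib.
    apply: (span_eq (lin_comp (lin_comul H) lP) (@lin_zero _ _ _)).
    move=> _ [_ [a [c [[x ->] ->]]]].
    exact: (pi_comul_ideal G bx_be lin_BQ_proj erefl BQ_projM BQ_proj_surj
      BQ_proj_sqr BQ_lift H).
  apply: (span_eq (lin_counit E) (@lin_zero _ _ _)).
  move=> _ [_ [a [c [[x ->] ->]]]].
  by rewrite !(counitM E) (counit_e E) !(mul0r, mulr0).
split=> b /sq[] // Pb _; exact: ker_tmap_qpi Pb.
Qed.

Definition shift (acc : seq X) (g : B_gen X) : seq X :=
  match g with inl y => [seq z ◁ y | z <- acc] | inr x => rcons acc x end.
(** Reading a word from the left, a letter e_x is appended to the list of indices
    and a letter y acts on the indices collected so far. This computes the
    indices of the normal form in which the letters x stand on the left. *)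
Definition nform (w : seq (B_gen X)) : seq X := foldl shift [::] w.

Lemma size_nform w : size (nform w) = cnt w.
Proof.
suff E acc : size (foldl shift acc w) = (size acc + cnt w)%N by apply: E.
elim: w acc => [|[x|x] w IH] acc /=; rewrite ?addn0 // IH ?size_map //.
by rewrite size_rcons addnS addSn.
Qed.

(** Both relations between letters respect this rule; the first one does so because
    the rack operation is self-distributive. *)
Lemma nform_brel r r' u v : brel r r' -> nform (u ++ r ++ v) = nform (u ++ r' ++ v).
Proof.
rewrite /nform !foldl_cat; move: (foldl _ _ u) => acc.
case=> x [y [[-> ->]|[-> ->]]] /=; last by rewrite map_rcons.
by rewrite -!map_comp; congr (foldl _ _ _); apply: eq_map => z /=; apply/esym/rack_distr.
Qed.

Lemma nform_e s : nform (map inr s) = s.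
Proof.
suff E acc : foldl shift acc (map inr s) = acc ++ s by apply: E.
by elim: s acc => [|x s IH] acc /=; rewrite ?cats0 // IH cat_rcons.
Qed.

(** Lists with two equal neighbours, that is, degenerate tuples of any length. *)
Definition adj (s : seq X) : Prop := exists s1 z s2, s = s1 ++ z :: z :: s2.

(** Letters act on two equal neighbours in the same way and new indices are added
    at the end, so a square in a word leaves a degenerate normal form. *)
Lemma adj_foldl w acc : adj acc -> adj (foldl shift acc w).
Proof.
elim: w acc => [//|g w IH] acc [s1 [z [s2 ->]]] /=; apply: IH.
case: g => x /=.
  by rewrite map_cat; exists [seq y ◁ x | y <- s1], (z ◁ x), [seq y ◁ x | y <- s2].
by exists s1, z, (rcons s2 x); rewrite rcons_cat.
Qed.

Lemma nform_sqr u x v : adj (nform (u ++ [:: inr x; inr x] ++ v)).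
Proof.
rewrite /nform !foldl_cat; apply: adj_foldl => /=.
by exists (foldl shift [::] u), x, [::]; rewrite -!cats1 -catA.
Qed.

Lemma adj_degenerate n (t : n.-tuple X) : adj t -> qclass k t = 0.
Proof.
move=> [s1 [z [s2 E]]]; apply/qpi_eq0/span_gen; exists t; split=> //.
have szn : n = (size s1 + (size s2).+2)%N by rewrite -(size_tuple t) E size_cat.
have i1 : (size s1 < n)%N by rewrite szn -addSnnS ltn_addr.
have i2 : ((size s1).+1 < n)%N by rewrite szn -2!addSnnS ltn_addr.
exists (Ordinal i1), (Ordinal i2); split=> //.
by rewrite !(tnth_nth z) /= E !nth_cat ltnn subnn ltnNge leqnSn /= subSnn.
Qed.

Lemma degenerate_adj n (t : n.-tuple X) (i j : 'I_n) :
  j = i.+1 :> nat -> tnth t i = tnth t j -> adj t.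
Proof.
move=> ij tij; pose x0 := tnth t i.
exists (take i t), x0, (drop i.+2 t).
have szi : (i < size t)%N by rewrite size_tuple.
have szj : (i.+1 < size t)%N by rewrite size_tuple -ij.
rewrite -[LHS](cat_take_drop i); congr (_ ++ _).
rewrite (drop_nth x0 szi) (drop_nth x0 szj); congr (_ :: _ :: _).
  by rewrite -tnth_nth.
by rewrite -ij -tnth_nth -tij.
Qed.

(** A cochain of degree n on lists, with value 0 on lists of another length. *)
Definition eval_seq n (f : cochain k X n) (s : seq X) : k^o :=
  if insub s is Some t then f (qclass k (t : n.-tuple X)) else 0.

Lemma lin_cochain n (f : cochain k X n) : linear f.
Proof. by case: f => f /= /asboolP. Qed.

Lemma eval_tuple n (f : cochain k X n) (t : n.-tuple X) :
  eval_seq f t = f (qclass k t).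
Proof. by rewrite /eval_seq valK. Qed.

Lemma eval_adj n (f : cochain k X n) s : adj s -> eval_seq f s = 0.
Proof.
rewrite /eval_seq; case: insubP => // t _ <- /adj_degenerate ->.
exact: (lin0 (lin_cochain f)).
Qed.

Lemma eval_size n (f : cochain k X n) s : size s <> n -> eval_seq f s = 0.
Proof. by move=> /eqP sn; rewrite /eval_seq insubF //; apply/negbTE. Qed.

(** The extension sends a word to the value of f on its normal form. It respects
    the relations, kills squares since f kills degenerate tuples, and ignores a
    letter x in front because at that moment no index has been collected. *)
Lemma cochain_ext_spec n (f : cochain k X n) :
  deg_form (@BQ_deg k X) qx n (cochain_ext f) /\
  forall s, cochain_ext f (mon qx qe (map inr s)) = eval_seq f s.
Proof.
have monE w : mon qx qe w = pi (bw k w).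
  by rewrite -bw_mon; exact: (pi_mon bx be erefl BQ_projM).
have [l Fx Fs Fd] : [/\ linear (cochain_ext f),
    forall x (b : BQ), cochain_ext f (BQ_proj (bx x) * b) = cochain_ext f b,
    forall s : n.-tuple X, cochain_ext f (BQ_proj (emon k s)) = f (qclass k s)
    & forall m (b : BQ), m <> n -> BQ_deg m b -> cochain_ext f b = 0].
  have := (@the_mapP BQ _ [set F : BQ -> k^o | [/\ linear F,
    forall x b, F (BQ_proj (bx x) * b) = F b,
    forall s : n.-tuple X, F (BQ_proj (emon k s)) = f (qclass k s)
    & forall m b, m <> n -> BQ_deg m b -> F b = 0]]%classic); apply.
  have [r r' u v br|F0 [lF0 F0E]] := @B_lift k X k^o (fun w => eval_seq f (nform w)).
    by rewrite (nform_brel _ _ br).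
  have [x|F [lF FE]] := BQ_lift lF0.
    move=> a c; move: a; apply: bw_eq => [||u].
    - exact: (lin_comp (@lin_kmull _ _ _) (lin_comp (@lin_kmull _ _ c) lF0)).
    - exact: lin_zero.
    move: c; apply: bw_eq => [||v].
    - exact: (lin_comp (@lin_kmulr _ _ _) lF0).
    - exact: lin_zero.
    rewrite -!bwe -!bw_cat F0E -catA; exact: (eval_adj f (nform_sqr u x v)).
  exists F; split; [exact: lF| | |].
  - move=> x b; have [a <-] := BQ_proj_surj b; rewrite -[_ * _]BQ_projM !FE.
    move: a; apply: bw_eq => [||w].
    + exact: (lin_comp (@lin_kmulr _ _ _) lF0).
    + exact: lF0.
    by rewrite -bw_consx !F0E.
  - by move=> s; rewrite FE emonE bw_mon F0E nform_e eval_tuple.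
  - move=> m _ mn [b db <-]; rewrite FE.
    apply: (span_eq lF0 (@lin_zero _ _ _)) db => _ [w [wm ->]].
    rewrite [LHS]F0E eval_size // size_nform => wn; apply: mn.
    by rewrite -wm -wn.
split; first by split.
move=> s; have [sn|sn] := eqVneq (size s) n.
  rewrite monE; have := Fs (Tuple (introT eqP sn)).
  by rewrite emonE bw_mon /= => ->; rewrite -eval_tuple.
rewrite eval_size ?(eqP _) //; last exact/eqP.
apply: (Fd (size s)); first exact/eqP.
have := mon_deg BQ_gens (map inr s).
suff -> : cnt (map inr s : seq (X + X)) = size s by [].
by rewrite -size_nform nform_e.
Qed.

Lemma cnt_e (s : seq X) : cnt (map inr s : seq (X + X)) = size s.
Proof. by elim: s => //= x s ->. Qed.

Lemma deg_form_eq n F F' :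
  deg_form (@BQ_deg k X) qx n F -> deg_form (@BQ_deg k X) qx n F' ->
  (forall s : n.-tuple X, F (mon qx qe (map inr s)) = F' (mon qx qe (map inr s))) ->
  F = F'.
Proof.
move=> [lF Fx Fd] [lF' Fx' Fd'] FF; apply/funext.
apply: (xlin_eq BQ_gens) => // [s|x b]; last by rewrite Fx Fx'.
have [sn|/eqP sn] := eqVneq (size s) n.
  exact: FF (Tuple (introT eqP sn)).
have ds := mon_deg BQ_gens (map inr s); rewrite cnt_e in ds.
by rewrite (Fd _ _ sn ds) (Fd' _ _ sn ds).
Qed.

Lemma ext_tuple n (f : cochain k X n) (s : n.-tuple X) :
  cochain_ext f (mon qx qe (map inr s)) = f (qclass k s).
Proof. by rewrite (cochain_ext_spec f).2 eval_tuple. Qed.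

Lemma cochain_eq n (f g : cochain k X n) :
  (forall s, f (qclass k s) = g (qclass k s)) -> f = g.
Proof.
move=> fg; apply/val_inj/funext; elim/qpi_ind => /=.
have lq : linear (qpi (@degenerate k X n)) by exact: linearP.
elim/freemod_ind => [a u v fu fv||s]; last exact: fg.
  by rewrite lq !lin_cochain fu fv.
by rewrite (lin0 lq) !(lin0 (lin_cochain _)).
Qed.

Lemma cochain_ext_inj n : injective (@cochain_ext k X n).
Proof. by move=> f g fg; apply: cochain_eq => s; rewrite -!ext_tuple fg. Qed.

Lemma cochain_extP n a (f g : cochain k X n) b :
  cochain_ext (a *: f + g) b = a * cochain_ext f b + cochain_ext g b.
Proof.
have [lf fx fd] := (cochain_ext_spec f).1; have [lg gx gd] := (cochain_ext_spec g).1.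
pose F b := a *: cochain_ext f b + cochain_ext g b : k^o.
rewrite -[RHS]/(F b); congr (_ b); apply: deg_form_eq.
- exact: (cochain_ext_spec _).1.
- split=> [|x c|i c ni dc]; rewrite /F.
  + exact: lin_add (lin_scale _ lf) lg.
  + by rewrite fx gx.
  + by rewrite (fd _ _ ni dc) (gd _ _ ni dc) scaler0 addr0.
- by move=> s; rewrite /F !ext_tuple.
Qed.

Lemma mon_adj s : adj s -> mon qx qe (map inr s) = 0.
Proof.
move=> [s1 [z [s2 ->]]]; rewrite map_cat mon_cat /= (kmulA (pi (be z))).
by rewrite -BQ_projM BQ_proj_sqr kmul0l kmul0r.
Qed.

(** The cochain is recovered from the values on monomials; a degenerate tuple
    gives a monomial containing a square, which is zero in the quotient. *)
Lemma cochain_ext_surj n F : deg_form (@BQ_deg k X) qx n F ->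
  exists f, @cochain_ext k X n f = F.
Proof.
move=> FF; have [lF Fx Fd] := FF.
pose phi : chain k X n -> k^o :=
  linext (fun s : n.-tuple X => F (mon qx qe (map inr s))).
have lphi : linear phi by exact: linearP.
have phi0 c : degenerate c -> phi c = 0.
  move=> [s [-> [i [j [ij sij]]]]]; rewrite /phi linext_delta mon_adj ?(lin0 lF) //.
  exact: degenerate_adj ij sij.
have lq : linear (qlift phi : qchain k X n -> k^o).
  exact: (@qlift_is_linear _ _ _ _ (linext _) phi0).
pose f : cochain k X n :=
  @Defs.Hom k (qchain k X n) k^o (qlift phi) (introT (asboolP _) lq).
exists f; apply: deg_form_eq FF _; first exact: (cochain_ext_spec f).1.
move=> s; rewrite ext_tuple.
by rewrite [LHS](@qliftE _ _ _ _ (linext _) phi0) /= linext_delta.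
Qed.

Lemma face0_seq n (s : n.+1.-tuple X) (i : 'I_n.+1) :
  face0 s i = take i s ++ drop i.+1 s :> seq X.
Proof.
have x0 := tnth s i.
have szi : size (take i s) = i by rewrite size_takel // size_tuple ltnW.
apply: (@eq_from_nth _ x0).
  by rewrite size_cat szi size_drop !size_tuple subSS subnKC // -ltnS.
move=> j; rewrite size_tuple => jn.
rewrite -[j in LHS]/(nat_of_ord (Ordinal jn)) -tnth_nth.
rewrite tnth_mktuple (tnth_nth x0) nth_cat szi /= /bump.
case: ltnP => ij /=; first by rewrite nth_take.
by rewrite nth_drop add1n addSn subnKC.
Qed.

Lemma face1_seq n (s : n.+1.-tuple X) (i : 'I_n.+1) :
  face1 s i = [seq z ◁ tnth s i | z <- take i s] ++ drop i.+1 s :> seq X.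
Proof.
have x0 := tnth s i.
have szi : size (take i s) = i by rewrite size_takel // size_tuple ltnW.
apply: (@eq_from_nth _ x0).
  by rewrite size_tuple size_cat size_map szi size_drop size_tuple subSS subnKC // -ltnS.
move=> j; rewrite size_tuple => jn.
rewrite -[j in LHS]/(nat_of_ord (Ordinal jn)) -tnth_nth.
rewrite tnth_mktuple !(tnth_nth x0) nth_cat size_map szi /= /bump.
case: (ltnP j i) => ij /=; first by rewrite add0n ij (nth_map x0) ?szi // nth_take.
by rewrite add1n ltnNge (leq_trans ij (leqnSn _)) /= nth_drop addSn subnKC.
Qed.

Section Diff.
Variable d : BQ -> BQ.
Hypothesis I : is_bdiff (@BQ_deg k X) qx qe d.

Lemma cochain_ext_diff n (f : cochain k X n) :
  cochain_ext (quandle_diff k X n f) = cochain_ext f \o d.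
Proof.
have [lf fx fd] := (cochain_ext_spec f).1.
apply: deg_form_eq; first exact: (cochain_ext_spec _).1.
  split=> [|x b|[|i] b ni db] /=.
  - exact: lin_comp (lin_bdiff I) lf.
  - by rewrite (bdiffM I) (bdiff_x I) kmul0l add0r (gsign_x BQ_gens) fx.
  - by rewrite (bdiff_deg0 BQ_gens I db) (lin0 lf).
  - by apply: (fd i); [move=> ii; apply: ni; rewrite ii|exact: (bdiff_deg BQ_gens I)].
move=> s; rewrite ext_tuple /= (xinv_bdiff_mon BQ_gens I (thead s) s lf fx).
rewrite size_tuple big_mkord.
transitivity (f (qpi (@degenerate k X n) (bdry (delta k s)))).
  congr (f _).
  apply: (@qliftE _ _ _ _ (qpi (@degenerate k X n) \o @bdry k X n)) => c cd.
  exact/qpi_eq0/bdry_degenerate.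
have lb : linear (f \o qpi (@degenerate k X n)).
  apply: (lin_comp _ (lin_cochain f)); exact: linearP.
rewrite /bdry linext_delta -[LHS]/((f \o qpi (@degenerate k X n)) _).
rewrite (linB lb) !(lin_sum lb).
rewrite -sumrB; apply: eq_bigr => i _; rewrite !(linZ lb) /=.
rewrite -(tnth_nth _ s i) -face0_seq -face1_seq !ext_tuple.
by rewrite exprS mulN1r !scaleNr opprK mulrBr addrC.
Qed.
End Diff.

End QuandleAlgebra.

Theorem mainTheorem4 (k : comPzRingType) (X : quandleType) :
  is_coideal (@B_comul k X) (@B_counit k X) (@B_ideal k X) /\
  exists (dQ : BQ k X -> BQ k X) (DQ : BQ k X -> BQ k X ⊗ BQ k X)
         (epsQ : BQ k X -> k^o),
  [/\ [/\ forall b, dQ (BQ_proj b) = BQ_proj (B_diff b),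
          forall b, DQ (BQ_proj b)
                    = tmap (@BQ_proj k X) (@BQ_proj k X) (B_comul b),
          forall b, epsQ (BQ_proj b) = B_counit b,
          is_coalgebra DQ epsQ
        & forall b, DQ (dQ b) = koszul_diff (@BQ_deg k X) dQ (DQ b)],
      exists hQ : BQ k X -> BQ k X ⊗ BQ k X,
        [/\ forall b, hQ (BQ_proj b)
                      = tmap (@BQ_proj k X) (@BQ_proj k X) (B_h b),
            linear hQ,
            forall x b, hQ (BQ_proj (bx k x) * b) = BQ_diag x (hQ b),
            forall n b, BQ_deg n b -> tens_deg (@BQ_deg k X) n.+1 (hQ b)
          & forall b, koszul_diff (@BQ_deg k X) dQ (hQ b) + hQ (dQ b)
                      = koszul_flip (@BQ_deg k X) (DQ b) - DQ b]
    & exists (one : cochain k X 0) (cup : graded_product (cochain k X)),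
        [/\ one (qclass k [tuple]) = 1,
            is_cup_product DQ cup,
            is_dga (@quandle_diff k X) one cup
          & exists (hone : cohomology (@quandle_diff k X) 0)
                   (hmul : graded_product (cohomology (@quandle_diff k X))),
              [/\ is_induced_product one cup hone hmul,
                  is_graded_algebra hone hmul
                & is_graded_commutative hmul]]].

Proof.
have HB := B_comul_spec k X; have EB := B_counit_spec k X.
have IB := B_diff_spec k X; have KB := B_h_spec k X.
have lpi := @lin_BQ_proj k X; have piM := @BQ_projM k X.
have surj := @BQ_proj_surj k X; have sqr := @BQ_proj_sqr k X.
have lift := @BQ_lift k X; have G := @BQ_gens k X.
split; first exact: B_ideal_coideal.
have [dQ [dQE I]] := qbdiff (B_gens k X) (@bx_be k X) lpi erefl piM surj sqr lift IB.
have [DQ [DQE H]] := qcomul (B_gens k X) (@bx_be k X) lpi erefl piM surj sqr lift HB.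
have [epsQ [epsQE E]] := qcounit erefl piM surj lift EB.
have [hQ [hQE K]] :=
  qhomotopy (B_gens k X) (@bx_be k X) lpi erefl piM surj sqr lift HB DQE KB.
exists dQ, DQ, epsQ; split.
- split; [exact: dQE|exact: DQE|exact: epsQE| |].
    exact: (comul_coalgebra G E H).
  exact: (comul_diff G I H).
- exists hQ; split; [exact: hQE|exact: (lin_h K)| | |].
  + move=> x b; rewrite [LHS](h_mulx G H K); exact: (km_Dx G).
  + move=> n b; exact: (h_deg G H K).
  + exact: (homotopy G I H K).
have ef n f := (@cochain_ext_spec k X n f).1.
have es := @cochain_ext_surj k X; have ei := @cochain_ext_inj k X.
have eP := @cochain_extP k X; have ed := cochain_ext_diff I.
exists (cup_one G E es), (cup G H ef es); split.
- rewrite -ext_tuple (ext_one G E es).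
  exact: (counit1 E).
- exact: (cupE G H ef es).
- exact: (cup_dga G H I E ef es ei eP ed).
have A := cup_dga G H I E ef es ei eP ed.
exists (hone A), (hmul A); split.
- exact: cohomology_induced.
- exact: cohomology_algebra.
- apply: cohomology_commutative; exact: (cup_comm G H I K ef es ei eP ed).
Qed.
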